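(* Let $\mathcal O$ be a $W$-conjugacy class of $\tilde W$ with $\mathcal O\subseteq\tilde W_G\sigma$ for some $\sigma\in\Omega'$. The following are equivalent: (1) $\mathcal O$ is nice; (2) for some (equivalently, any) $y\in\mathcal O$, $s_H(V_y)=V_y$ for every $H\in\mathfrak H(\nu_y)$ with $H\cap V_y\neq\emptyset$, where $\mathfrak H(\nu_y)=\{H_{\alpha,k}:\alpha\in\Phi,\langle\nu_y,\alpha\rangle=0,k\in\mathbb Z\}$ and $s_H$ is the reflection in $H$; (3) for some (equivalently, any) $y\in\mathcal O$ with $\nu_y=\nu_{\mathcal O}$, the finite part $\bar y$ is a weakly elliptic element of $W_{J_{\mathcal O}}\rtimes\langle\sigma\rangle$.
   Context: Setting: $G$ connected complex reductive, maximal torus, reduced root system $\Phi$ with simple roots $\alpha_i$ ($i\in S_0$), finite Weyl group $W_0$; $Q\subset P$ coroot and coweight lattices; $V=P\otimes\mathbb R$; $\Omega'$ finite group of diagram automorphisms inducing automorphisms of $G$; $\tilde W_G=P\rtimes W_0$, $W=W_G=Q\rtimes W_0$ (Coxeter group with affine simple reflections $S$), $\tilde W=\tilde W_G\rtimes\Omega'=P\rtimes(W_0\rtimes\Omega')$ acting affinely on $V$. $H_{\alpha,k}=\{x:\langle x,\alpha\rangle=k\}$; $\ell$ = number of such hyperplanes separating the fundamental alcove and its image. Newton point $\nu_y=\lambda/n$ if $y^n=t^\lambda$; $\nu_{\mathcal O}$ = dominant $W_0$-conjugate of $\nu_y$ ($y\in\mathcal O$); $V_y=\{v:y(v)=v+\nu_y\}$;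 $J_{\mathcal O}=\{i\in S_0:\langle\nu_{\mathcal O},\alpha_i\rangle=0\}$ (then $\sigma(J_{\mathcal O})=J_{\mathcal O}$). The finite part $\bar y$ is the image of $y$ under $\tilde W=P\rtimes(W_0\rtimes\Omega')\to W_0\rtimes\Omega'$. For a Coxeter group $(W_1,S_1)$ with automorphism group $\Gamma$ preserving $S_1$: supp of $w\gamma$ is $\bigcup_n\gamma^n(\mathrm{supp}(w))$; an element $z$ of $W_1\rtimes\Gamma$ (with $W_1$ finite) is weakly elliptic if for every $W_1$-conjugate $z'$ of $z$, $\mathrm{supp}(z')$ is a union of connected components of the Dynkin diagram of $S_1$ and $z'$ commutes with every element of $S_1-\mathrm{supp}(z')$. Nice: for $\tilde w$ of minimal length in its $W$-conjugacy class, a path from $\tilde w$ is a sequence $(s_1,\dots,s_r)$ in $S$ with $\ell(s_i\cdots s_1\tilde ws_1\cdots s_i)\le\ell(s_{i-1}\cdots s_1\tilde ws_1\cdots s_{i-1})$ for all $i$; with $W_{\tilde w}=\{x\in W:\ell(x^{-1}\tilde wx)=\ell(\tilde w)\}$, the class $\mathcal O$ is nice if for some (equivalently any) minimal length $\tilde w\in\mathcal O$ every $x\in W_{\tilde w}$ is $s_1\cdots s_r$ for some path $(s_1,\dots,s_r)$ from $\tilde w$. *)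

(* Defs.v *)
From HB Require Import structures.
From mathcomp Require Import all_boot all_order all_fingroup all_algebra.
From Stdlib Require Import ClassicalEpsilon.
Set Implicit Arguments. Unset Strict Implicit. Unset Printing Implicit Defensive.
Import Order.TTheory GRing.Theory Num.Theory.
Local Open Scope ring_scope.

(* A root datum on the cocharacter lattice P = Z^n (characters also Z^n,
   pairing = dot product), roots indexed by a finite type I. *)
Record RD (n : nat) (I : finType) := MkRD {
  root : I -> 'rV[int]_n ;
  coroot : I -> 'rV[int]_n ;
  simple : {set I} }.

Section Defs.
Variables (n : nat) (I : finType) (D : RD n I).

Definition ipair (a b : 'rV[int]_n) : int := (a *m b^T) 0 0.

Definition is_based_root_datum : Prop :=
  (forall i, ipair (coroot D i) (root D i) = 2) /\
      (forall i j, exists k,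
        root D k = root D j - ipair (coroot D i) (root D j) *: root D i /\
        coroot D k = coroot D j - ipair (coroot D j) (root D i) *: coroot D i) /\
      injective (root D) /\
      (forall i j, root D j != 2%:~R *: root D i) /\
      (forall c : I -> int, \sum_(i in simple D) c i *: root D i = 0 ->
          forall i, i \in simple D -> c i = 0) /\
      (forall i, (exists c : I -> nat,
                   root D i = \sum_(j in simple D) (c j)%:Z *: root D j) \/
                (exists c : I -> nat,
                   root D i = - \sum_(j in simple D) (c j)%:Z *: root D j)).

(* finite parts act on row vectors by right multiplication; fmul A B = A o B *)
Definition fmul (A B : 'M[int]_n) : 'M[int]_n := B *m A.

(* simple/root reflection x |-> x - <x,a_i> a_i^vee *)
Definition sref (i : I) : 'M[int]_n := 1%:M - (root D i)^T *m coroot D i.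

Definition diag_aut (g : 'M[int]_n) : Prop :=
  g \in unitmx /\ exists p : {perm I},
    [/\ forall i, coroot D i *m g = coroot D (p i),
        forall i, g *m (root D (p i))^T = (root D i)^T &
        forall i, (p i \in simple D) = (i \in simple D)].

Definition diag_aut_group (Om : 'M[int]_n -> Prop) : Prop :=
  [/\ Om 1%:M, (forall g h, Om g -> Om h -> Om (fmul g h)),
      (exists s : seq 'M[int]_n, forall g, Om g <-> g \in s) &
      forall g, Om g -> diag_aut g].

(* elements t^l A of P x| (W_0 x| Omega'): x |-> x A + l *)
Definition aff := ('rV[int]_n * 'M[int]_n)%type.
Definition amul (y z : aff) : aff := (z.1 *m y.2 + y.1, z.2 *m y.2).
Definition aone : aff := (0, 1%:M).
Definition ainv (y : aff) : aff := (- (y.1 *m invmx y.2), invmx y.2).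
Definition aconj (x w : aff) : aff := amul (ainv x) (amul w x).
Fixpoint apow (y : aff) (m : nat) : aff :=
  if m is m'.+1 then amul y (apow y m') else aone.

Definition wordmx (s : seq I) : 'M[int]_n :=
  foldr (fun i M => fmul (sref i) M) 1%:M s.
Definition inW0 (A : 'M[int]_n) : Prop :=
  exists s, all (fun i => i \in simple D) s /\ A = wordmx s.
Definition inQ (l : 'rV[int]_n) : Prop :=
  exists c : I -> int, l = \sum_i c i *: coroot D i.
Definition inW (x : aff) : Prop := inQ x.1 /\ inW0 x.2.
Definition in_tWG_coset (sigma : 'M[int]_n) (y : aff) : Prop :=
  exists w, inW0 w /\ y.2 = fmul w sigma.

(* affine reflection in H_{a_i,k}: x |-> x - (<x,a_i> - k) a_i^vee *)
Definition aref (i : I) (k : int) : aff := (k *: coroot D i, sref i).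

Definition posroot (i : I) : Prop :=
  exists c : I -> nat, root D i = \sum_(j in simple D) (c j)%:Z *: root D j.

Section Real.
Variable R : realFieldType.

Definition toR m p (A : 'M[int]_(m, p)) : 'M[R]_(m, p) :=
  map_mx (fun z : int => z%:~R) A.
Definition pairR (x : 'rV[R]_n) (a : 'rV[int]_n) : R := (x *m (toR a)^T) 0 0.
Definition act (y : aff) (x : 'rV[R]_n) : 'rV[R]_n := x *m toR y.2 + toR y.1.

Definition alcove (x : 'rV[R]_n) : Prop :=
  forall i, posroot i -> 0 < pairR x (root D i) < 1.

Definition separates (y : aff) (p : I * int) : Prop :=
  posroot p.1 /\ forall x x', alcove x -> alcove x' ->
    (pairR x (root D p.1) - p.2%:~R) * (pairR (act y x') (root D p.1) - p.2%:~R) < 0.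

Definition ell (y : aff) : nat :=
  epsilon (inhabits 0%N) (fun m => exists s : seq (I * int),
    [/\ uniq s, (forall p, p \in s <-> separates y p) & size s = m]).

(* affine simple reflections: reflections in walls of the alcove *)
Definition inS (s : aff) : Prop :=
  exists i k, s = aref i k /\ ell (aref i k) = 1%N.

Fixpoint isPath (w : aff) (s : seq aff) : Prop :=
  match s with
  | [::] => True
  | a :: t => [/\ inS a, (ell (amul a (amul w a)) <= ell w)%N &
                  isPath (amul a (amul w a)) t]
  end.
Definition prodS (s : seq aff) : aff := foldr amul aone s.

Definition inO (y0 y : aff) : Prop := exists x, inW x /\ y = aconj x y0.

Definition nice (y0 : aff) : Prop :=
  exists w, [/\ inO y0 w, (forall w', inO y0 w' -> (ell w <= ell w')%N) &
    forall x, inW x -> ell (aconj x w) = ell w ->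
      exists s, isPath w s /\ x = prodS s].

Definition newton (y : aff) : 'rV[R]_n :=
  epsilon (inhabits 0) (fun nu => exists m, (0 < m)%N /\
    exists l, apow y m = (l, 1%:M) /\ nu = (m%:R)^-1 *: toR l).

Definition Vy (y : aff) (v : 'rV[R]_n) : Prop := act y v = v + newton y.

Definition dominant (nu : 'rV[R]_n) : Prop :=
  forall i, i \in simple D -> 0 <= pairR nu (root D i).

Definition nuO (y0 : aff) : 'rV[R]_n :=
  epsilon (inhabits 0) (fun nu => dominant nu /\
    exists w, inW0 w /\ nu = newton y0 *m toR w).

Definition JO (y0 : aff) : {set I} :=
  [set i in simple D | pairR (nuO y0) (root D i) == 0].

Definition reflH (i : I) (k : int) (u : 'rV[R]_n) : 'rV[R]_n :=
  u - (pairR u (root D i) - k%:~R) *: toR (coroot D i).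

Definition cond2 (y : aff) : Prop :=
  forall i (k : int), pairR (newton y) (root D i) = 0 ->
    (exists v, Vy y v /\ pairR v (root D i) = k%:~R) ->
    forall v, Vy y v <-> exists u, Vy y u /\ reflH i k u = v.

End Real.

Definition inWJ (J : {set I}) (A : 'M[int]_n) : Prop :=
  exists s, all (fun i => i \in J) s /\ A = wordmx s.
Definition reduced_word (J : {set I}) (A : 'M[int]_n) (s : seq I) : Prop :=
  [/\ all (fun i => i \in J) s, A = wordmx s &
      forall t, all (fun i => i \in J) t -> A = wordmx t -> (size s <= size t)%N].
Definition suppW (J : {set I}) (A : 'M[int]_n) (i : I) : Prop :=
  exists s, reduced_word J A s /\ i \in s.
Definition in_WJ_sigma (J : {set I}) (sigma z : 'M[int]_n) : Prop :=
  exists w m, inWJ J w /\ z = fmul w (sigma ^+ m).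
(* supp(w gamma) = union of gamma^e(supp w) *)
Definition gsupp (J : {set I}) (sigma z : 'M[int]_n) (i : I) : Prop :=
  exists w m, [/\ inWJ J w, z = fmul w (sigma ^+ m) &
    exists e j, suppW J w j /\ coroot D j *m (sigma ^+ m) ^+ e = coroot D i].
Definition adjacent (i j : I) : Prop :=
  i != j /\ ipair (coroot D i) (root D j) != 0.
Definition weakly_elliptic (J : {set I}) (sigma z : 'M[int]_n) : Prop :=
  in_WJ_sigma J sigma z /\
  forall z', (exists u, inWJ J u /\ fmul u z' = fmul z u) ->
    (forall i j, gsupp J sigma z' i -> j \in J -> adjacent i j ->
        gsupp J sigma z' j) /\
    (forall j, j \in J -> ~ gsupp J sigma z' j ->
        fmul (sref j) z' = fmul z' (sref j)).

End Defs.

(* Main.v *)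
(* Niceness says that the alcoves on which w has minimal displacement, for w of minimal length in the
   class, form a connected set for adjacency: the length of x^-1 w x counts the hyperplanes separating
   the alcove of x from its image under w. Put nu = nu_w and let z be the linear part of w. Condition
   (2) amounts to: every root orthogonal to nu either vanishes on the fixed space of z or is fixed by z.

   Necessity: a path of minimal alcoves crossing a hyperplane of a root orthogonal to nu and not
   constant on V_w must cross its image under w in the same step, so the root is fixed by z.
   Sufficiency: iterating h -> (h + w h) / 2 pushes a minimal alcove next to a generic point v of V_w.
   The minimal alcoves around v are the minimal chambers of an elliptic linear map, and these are
   connected. When v moves in V_w across a further wall, moving along nu preserves minimality and
   leaves only walls fixed by w to be crossed, and these can be crossed one at a time.

   For (3): if the simple root alpha_j of J is outside the support of a W_J-conjugate z' of z, the orbit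
   sum of a fundamental coweight is fixed by z' and not orthogonal to alpha_j, so z' fixes alpha_j.
   Conversely, a J-dominant vector fixed by z' is orthogonal to the support of z'; weak ellipticity
   splits J into the support and its complement, which z' fixes, so a root of J not orthogonal to
   that vector lies in the span of the complement and is fixed. *)
Require Import Defs.
From HB Require Import structures.
From mathcomp Require Import boolp classical_sets reals topology normedtype derive Rstruct.
From mathcomp Require Import all_boot all_order all_fingroup all_algebra.
From mathcomp Require Import ring lra zify.
From Stdlib Require Import Relations ClassicalEpsilon.
Import Defs.
Set Implicit Arguments. Unset Strict Implicit. Unset Printing Implicit Defensive.
Import Order.TTheory GRing.Theory Num.Theory.
Import numFieldNormedType.Exports.
Local Open Scope ring_scope.

(** * Root data *)

(** The theorem allows any ordered field, but the variational argument needs maxima of continuous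
    functions on compact sets. Lengths and the dichotomy for roots are therefore expressed by
    integer data, and the alcove geometry is carried out over the reals, where an alcove is only a
    generic point up to equality of the floors of all roots. The hard case is an elliptic linear map
    [z], which has no fixed directions to move along. Eigenvectors of [z + z^-1] take their place:
    this operator plus 2 is [T^* T] for [T = 1 + z], and replacing [x] by [x + x z] never lowers its
    Rayleigh quotient, so every component of minimal chambers has a vector of the largest eigenvalue
    in its closure. For such a vector [v], a wall through [v] and [v z] also contains [v z^-1], and
    a wall through [v] that misses [v z] has [v z] and [v z^-1] on opposite sides. Chasing the image
    forwards and then backwards thus turns a chamber around [v] across walls of the second kind, and
    induction treats those of the first kind. This makes it possible to walk inside the eigenspace
    from one component to another. *)

Section IntPairing.
Variable n : nat.
Implicit Types (a b c : 'rV[int]_n) (A : 'M[int]_n).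

Lemma ipairE a b : ipair a b = \sum_k a 0 k * b 0 k.
Proof. by rewrite /ipair mxE; apply: eq_bigr => k _; rewrite mxE. Qed.
Lemma ipairC a b : ipair a b = ipair b a.
Proof. by rewrite !ipairE; apply: eq_bigr => k _; rewrite mulrC. Qed.
Lemma ipairDl a b c : ipair (a + b) c = ipair a c + ipair b c.
Proof. by rewrite /ipair mulmxDl mxE. Qed.
Lemma ipairZl x a c : ipair (x *: a) c = x * ipair a c.
Proof. by rewrite /ipair -scalemxAl mxE. Qed.
Lemma ipairNl a c : ipair (- a) c = - ipair a c.
Proof. by rewrite /ipair mulNmx mxE. Qed.
Lemma ipairDr a b c : ipair a (b + c) = ipair a b + ipair a c.
Proof. by rewrite ipairC ipairDl !(ipairC a). Qed.
Lemma ipairZr a x c : ipair a (x *: c) = x * ipair a c.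
Proof. by rewrite ipairC ipairZl ipairC. Qed.
Lemma ipairNr a c : ipair a (- c) = - ipair a c.
Proof. by rewrite ipairC ipairNl ipairC. Qed.
Lemma ipair_sumr (T : finType) (P : pred T) (G : T -> 'rV[int]_n) a :
  ipair a (\sum_(t | P t) G t) = \sum_(t | P t) ipair a (G t).
Proof. by rewrite ipairC {1}/ipair mulmx_suml summxE; apply: eq_bigr => t _; exact: ipairC. Qed.
Lemma mulmx_tr_ipair a b : a *m b^T = (ipair a b)%:M.
Proof. by apply/matrixP => i j; rewrite !ord1 [RHS]mxE eqxx mulr1n. Qed.
Lemma ipair0_eq0 a : (forall b, ipair b a = 0) -> a = 0.
Proof.
move=> h; apply/rowP => k; have := h (delta_mx 0 k).
by rewrite /ipair -rowE !mxE.
Qed.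
End IntPairing.

Section RootDatum.
Variables (n : nat) (I : finType) (D : RD n I).
Hypothesis HD : is_based_root_datum D.
Local Notation rt := (root D).
Local Notation cr := (coroot D).
Local Notation Sm := (simple D).
Local Notation sref := (sref D).
Local Notation wordmx := (wordmx D).
Local Notation inWJ := (inWJ D).

Lemma cr_rt i : ipair (cr i) (rt i) = 2. Proof. by case: HD. Qed.
Lemma refl_ex i j : exists k, rt k = rt j - ipair (cr i) (rt j) *: rt i /\
  cr k = cr j - ipair (cr j) (rt i) *: cr i.
Proof. by case: HD => _ []. Qed.
Lemma rt_inj : injective rt. Proof. by case: HD => _ [] _ []. Qed.
Lemma rt_reduced i j : rt j <> 2 *: rt i.
Proof. by apply/eqP; case: HD => _ [] _ [] _ []. Qed.
Lemma rt_indep (c : I -> int) : \sum_(i in Sm) c i *: rt i = 0 -> forall i, i \in Sm -> c i = 0.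
Proof. by case: HD => _ [_ [_ [_ [h _]]]]; exact: h. Qed.

(** Weyl group elements, diagram automorphisms and finite parts are all handled as a matrix together
    with the permutation of root indices that it induces; the last equation says that the pairing is
    preserved. *)
Definition raut (p : {perm I}) (A : 'M[int]_n) :=
  [/\ A \in unitmx, forall i, cr i *m A = cr (p i) & forall i, A *m (rt (p i))^T = (rt i)^T].

Lemma raut1 : raut 1 1%:M.
Proof. by split=> [|i|i]; rewrite ?unitmx1 ?perm1 ?mulmx1 ?mul1mx. Qed.

Lemma raut_mul p q A B : raut p A -> raut q B -> raut (p * q) (A *m B).
Proof.
move=> [uA cA rA] [uB cB rB]; split=> [|i|i]; first by rewrite unitmx_mul uA.
  by rewrite mulmxA cA cB permM.
by rewrite permM -mulmxA rB rA.
Qed.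

Lemma raut_inv p A : raut p A -> raut p^-1 (invmx A).
Proof.
move=> [uA cA rA]; split=> [|i|i]; first by rewrite unitmx_inv.
  by rewrite -[i in LHS](permKV p) -cA mulmxK.
by rewrite -rA mulKmx // permKV.
Qed.

Lemma raut_conj_sref p A i : raut p A -> A *m sref (p i) = sref i *m A.
Proof.
move=> [_ cA rA]; rewrite /Defs.sref mulmxBr mulmx1 mulmxA rA mulmxBl mul1mx.
by rewrite -mulmxA cA.
Qed.

Lemma raut_pair p A a i : raut p A -> ipair (a *m A) (rt (p i)) = ipair a (rt i).
Proof. by case=> _ _ h; rewrite /ipair -mulmxA h. Qed.

Lemma srefE a i : a *m sref i = a - ipair a (rt i) *: cr i.
Proof. by rewrite /Defs.sref mulmxBr mulmx1 mulmxA mulmx_tr_ipair mul_scalar_mx. Qed.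

Lemma srefK i : sref i *m sref i = 1%:M.
Proof.
rewrite {2}/Defs.sref mulmxBr mulmx1 mulmxA.
have -> : sref i *m (rt i)^T = - (rt i)^T.
  rewrite /Defs.sref mulmxBl mul1mx -mulmxA mulmx_tr_ipair cr_rt mul_mx_scalar.
  by rewrite scaler_nat mulr2n opprD addrA subrr add0r.
by rewrite mulNmx opprK /Defs.sref subrK.
Qed.

(** The reflected index is only known to exist, so it is searched for; by [refl_ex] the default [j]
    is never returned for want of a hit. *)
Definition ridx i j := odflt j [pick k | (rt k == rt j - ipair (cr i) (rt j) *: rt i) &&
  (cr k == cr j - ipair (cr j) (rt i) *: cr i)].

Lemma ridxP i j : rt (ridx i j) = rt j - ipair (cr i) (rt j) *: rt i /\
  cr (ridx i j) = cr j - ipair (cr j) (rt i) *: cr i.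
Proof.
rewrite /ridx; case: pickP => [k /andP[/eqP ? /eqP ?] //|no].
have [k [e1 e2]] := refl_ex i j.
by have := no k; rewrite e1 e2 !eqxx.
Qed.

Lemma ridxK i : involutive (ridx i).
Proof.
move=> j; apply: rt_inj; have [-> _] := ridxP i (ridx i j); have [-> _] := ridxP i j.
rewrite ipairDr ipairNr ipairZr cr_rt -addrA -opprD -scalerDl.
set a := ipair (cr i) (rt j); have -> : a + (a - a * 2) = 0 by ring.
by rewrite scale0r subr0.
Qed.

Definition srp i : {perm I} := perm (can_inj (ridxK i)).

Lemma rt_srp i j : rt (srp i j) = rt j - ipair (cr i) (rt j) *: rt i.
Proof. by rewrite permE; case: (ridxP i j). Qed.
Lemma cr_srp i j : cr (srp i j) = cr j - ipair (cr j) (rt i) *: cr i.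
Proof. by rewrite permE; case: (ridxP i j). Qed.
Lemma srpK i : involutive (srp i).
Proof. by move=> j; rewrite !permE ridxK. Qed.

Lemma raut_sref i : raut (srp i) (sref i).
Proof.
split=> [|j|j]; first by case: (mulmx1_unit (srefK i)).
  by rewrite srefE cr_srp.
rewrite rt_srp /Defs.sref mulmxBl mul1mx -mulmxA mulmx_tr_ipair.
rewrite ipairDr ipairNr ipairZr cr_rt mul_mx_scalar linearB linearZ /=.
set a := ipair (cr i) (rt j); rewrite -addrA -opprD -scalerDl.
have -> : a + (a - a * 2) = 0 by ring.
by rewrite scale0r subr0.
Qed.

Definition root_opp i := srp i i.
Lemma rt_opp i : rt (root_opp i) = - rt i.
Proof. by rewrite rt_srp cr_rt scaler_nat mulr2n opprD addrA subrr add0r. Qed.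
Lemma cr_opp i : cr (root_opp i) = - cr i.
Proof. by rewrite cr_srp cr_rt scaler_nat mulr2n opprD addrA subrr add0r. Qed.
Lemma oppK : involutive root_opp.
Proof. by move=> i; apply: rt_inj; rewrite !rt_opp opprK. Qed.
Lemma rt_neq0 i : rt i != 0.
Proof. by apply/eqP => h; have := cr_rt i; rewrite h -(scale0r 0) ipairZr mul0r. Qed.
Lemma opp_neq i : root_opp i != i.
Proof.
by apply/eqP => h; have := cr_rt i; rewrite -{2}h rt_opp ipairNr cr_rt.
Qed.
Lemma raut_opp p A i : raut p A -> p (root_opp i) = root_opp (p i).
Proof.
move=> [uA cA rA]; apply: rt_inj; apply: trmx_inj; rewrite rt_opp linearN /=.
apply: (can_inj (mulKmx uA)); rewrite rA mulmxN rA rt_opp linearN //.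
Qed.

(** The two mutual Cartan integers are positive with product 4, so one root is 1/2, 1 or 2 times the
    other, and reducedness leaves only 1. *)
Lemma rt_par i j (c d : int) : 0 < c -> 0 < d -> c *: rt i = d *: rt j -> i = j.
Proof.
move=> c0 d0 e.
have e1 : c * ipair (cr j) (rt i) = d * 2 by rewrite -ipairZr e ipairZr cr_rt.
have e2 : c * 2 = d * ipair (cr i) (rt j) by rewrite -ipairZr -e ipairZr cr_rt.
have a0 : 0 < ipair (cr j) (rt i) by nia.
have b0 : 0 < ipair (cr i) (rt j) by nia.
set a := ipair (cr j) (rt i) in e1 a0; set b := ipair _ _ in e2 b0.
have ab : a * b = 4.
  have : c * d * (a * b) = c * d * 4 by nia.
  by apply: mulfI; rewrite mulf_neq0 // gt_eqF.
have : a = 1 \/ a = 2 \/ a = 4.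
  have : a <= 4 by nia.
  case: (a) a0 ab => // [] [|[|[|[|[|]]]]] //; auto; lia.
have cZ x y : c *: x = c *: y -> x = y :> 'rV[int]_n.
  by move=> h; apply/rowP => k; have /rowP/(_ k) := h; rewrite !mxE => /mulfI; apply; rewrite gt_eqF.
case=> [a1|[a2|a4]].
- case: (rt_reduced (i := i) (j := j)); apply: cZ.
  have -> : c *: rt j = 2 *: (d *: rt j) by rewrite scalerA; congr (_ *: _); lia.
  by rewrite -e !scalerA; congr (_ *: _); lia.
- by apply: rt_inj; apply: cZ; rewrite e; congr (_ *: _); lia.
- case: (rt_reduced (i := j) (j := i)); apply: cZ.
  by rewrite e scalerA; congr (_ *: _); lia.
Qed.

(** The canonical form given by all roots. Reindexing makes it invariant under [raut]; it is
    positive on coroots but may be degenerate, since the roots need not span. *)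
Definition bi (u v : 'rV[int]_n) : int := \sum_k ipair u (rt k) * ipair v (rt k).

Lemma bi_raut p A u v : raut p A -> bi (u *m A) (v *m A) = bi u v.
Proof.
move=> h; rewrite /bi (reindex_inj (@perm_inj _ p)).
by apply: eq_bigr => k _; rewrite !(raut_pair _ _ h).
Qed.

Lemma bi_cr_gt0 i : 0 < bi (cr i) (cr i).
Proof.
rewrite /bi (bigD1 i) //= cr_rt ltr_pwDl // sumr_ge0 // => k _.
by rewrite -expr2 sqr_ge0.
Qed.

(** Invariance under the reflection in [i], which negates [cr i], turns pairing with a coroot into a
    multiple of the root. *)
Lemma bi_cr i v : 2 * bi (cr i) v = ipair v (rt i) * bi (cr i) (cr i).
Proof.
have := bi_raut (cr i) v (raut_sref i).
have [_ -> _] := raut_sref i; rewrite -/(root_opp i) cr_opp srefE /bi mulr_sumr mulr_sumr.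
move=> e; apply/eqP; rewrite -subr_eq0 -sumrB; apply/eqP.
have : \sum_k ipair (- cr i) (rt k) * ipair (v - ipair v (rt i) *: cr i) (rt k) -
   \sum_k ipair (cr i) (rt k) * ipair v (rt k) = 0 by rewrite e subrr.
rewrite -sumrB => h; apply: oppr_inj; rewrite oppr0 -[RHS]h -sumrN; apply: eq_bigr => k _.
rewrite ipairDl !ipairNl ipairZl; ring.
Qed.

Lemma bi_sym u v : bi u v = bi v u.
Proof. by apply: eq_bigr => k _; rewrite mulrC. Qed.

Lemma pair_sym i j : ipair (cr j) (rt i) * bi (cr i) (cr i) = ipair (cr i) (rt j) * bi (cr j) (cr j).
Proof. by rewrite -!bi_cr bi_sym. Qed.

(** By [bi_cr] a coroot determines its root as a linear form. This makes the permutation in [raut] a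
    function of the matrix. *)
Lemma cr_inj : injective cr.
Proof.
move=> i j e; apply: rt_inj; apply/eqP; rewrite -subr_eq0; apply/eqP; apply: ipair0_eq0 => v.
rewrite ipairDr ipairNr; apply/eqP; rewrite subr_eq0; apply/eqP.
have h1 := bi_cr i v; have h2 := bi_cr j v; rewrite e in h1.
by apply: (mulIf (x := bi (cr j) (cr j))); rewrite ?gt_eqF ?bi_cr_gt0 // -h1 -h2.
Qed.

Lemma raut_uniq p q A : raut p A -> raut q A -> p = q.
Proof. by move=> [_ h _] [_ h' _]; apply/permP => i; apply: cr_inj; rewrite -h h'. Qed.

(** The coefficients are extracted as data so that they can be computed with; only their values at
    simple indices are determined. *)
Lemma simple_coef_ex i : {c : I -> int | rt i = \sum_(j in Sm) c j *: rt j /\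
  ((forall j, 0 <= c j) \/ (forall j, c j <= 0))}.
Proof.
apply: constructive_indefinite_description.
case: HD => _ [_ [_ [_ [_ /(_ i)]]]] [[c e]|[c e]].
  by exists (fun j => (c j)%:Z); split=> //; left.
exists (fun j => - (c j)%:Z); split; last by right=> j; rewrite oppr_le0.
by rewrite e -sumrN; apply: eq_bigr => j _; rewrite scaleNr.
Qed.
Definition simple_coef i := sval (simple_coef_ex i).
Lemma zcE i : rt i = \sum_(j in Sm) simple_coef i j *: rt j.
Proof. by rewrite /simple_coef; case: (simple_coef_ex i) => c []. Qed.
Lemma simple_coef_sign i : (forall j, 0 <= simple_coef i j) \/ (forall j, simple_coef i j <= 0).
Proof. by rewrite /simple_coef; case: (simple_coef_ex i) => c []. Qed.

Lemma simple_coef_uniq i (c : I -> int) : rt i = \sum_(j in Sm) c j *: rt j ->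
  forall j, j \in Sm -> simple_coef i j = c j.
Proof.
move=> e j jS; apply/eqP; rewrite -subr_eq0; apply/eqP.
apply: (rt_indep (c := fun j => simple_coef i j - c j)) jS.
rewrite (eq_bigr (fun j => simple_coef i j *: rt j - c j *: rt j)) => [|k _]; last by rewrite scalerBl.
by rewrite sumrB -zcE -e subrr.
Qed.

Lemma posrootP i : posroot D i <-> (forall j, j \in Sm -> 0 <= simple_coef i j).
Proof.
split=> [[c e] j jS|h]; first by rewrite (simple_coef_uniq e).
exists (fun j => `|simple_coef i j|%N); rewrite [LHS]zcE; apply: eq_bigr => j jS.
by rewrite gez0_abs // h.
Qed.

Lemma simple_coef_opp i j : j \in Sm -> simple_coef (root_opp i) j = - simple_coef i j.
Proof.
apply: (simple_coef_uniq (c := fun j => - simple_coef i j)); rewrite rt_opp [in LHS]zcE -sumrN.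
by apply: eq_bigr => k _; rewrite scaleNr.
Qed.

Lemma simple_coef_nz i : exists2 j, j \in Sm & simple_coef i j != 0.
Proof.
case: (boolP [exists j in Sm, simple_coef i j != 0]) => [/exists_inP//|/exists_inPn h].
have := rt_neq0 i; rewrite zcE big1 ?eqxx // => j jS.
by have := h j jS; rewrite negbK => /eqP ->; rewrite scale0r.
Qed.

Lemma pos_opp i : ~ posroot D i <-> posroot D (root_opp i).
Proof.
split=> [np|/posrootP h /posrootP h'].
  apply/posrootP => j jS; rewrite simple_coef_opp // oppr_ge0.
  by case: (simple_coef_sign i) => // h; case: np; apply/posrootP => k _.
have [j jS] := simple_coef_nz i; have := h j jS; have := h' j jS.
by rewrite simple_coef_opp // oppr_ge0 eq_le => -> ->.
Qed.

Lemma pos_dec i : {posroot D i} + {posroot D (root_opp i)}.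
Proof.
case: (excluded_middle_informative (posroot D i)) => h; [by left|right].
exact/pos_opp.
Qed.

Lemma simple_coef_simple i j : i \in Sm -> j \in Sm -> simple_coef i j = (i == j)%:Z.
Proof.
move=> iS; apply: (simple_coef_uniq (c := fun j => (i == j)%:Z)).
rewrite (bigD1 i) //= eqxx scale1r big1 ?addr0 // => k /andP[_ /negPf].
by rewrite eq_sym => ->; rewrite scale0r.
Qed.

Lemma pos_simple i : i \in Sm -> posroot D i.
Proof. by move=> iS; apply/posrootP => j jS; rewrite simple_coef_simple. Qed.

Lemma simple_coef_srp j i k : j \in Sm -> k \in Sm ->
  simple_coef (srp j i) k = simple_coef i k - ipair (cr j) (rt i) * (k == j)%:Z.
Proof.
move=> jS; apply: (simple_coef_uniq (c := fun k => simple_coef i k - ipair (cr j) (rt i) * (k == j)%:Z)).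
rewrite rt_srp {1}[rt i]zcE.
rewrite [RHS](eq_bigr (fun k => simple_coef i k *: rt k - (ipair (cr j) (rt i) * (k == j)%:Z) *: rt k)) => [|l _]; last by rewrite scalerBl.
rewrite sumrB; congr (_ - _); rewrite (bigD1 j) //= eqxx mulr1 big1 ?addr0 // => l /andP[_ /negPf ->].
by rewrite mulr0 scale0r.
Qed.

(** The reflection changes only the coefficient at [j]. If the result were negative, all other
    coefficients would vanish and the root would be a positive multiple of the simple root [j]. *)
Lemma pos_srp i j : j \in Sm -> posroot D i -> i <> j -> posroot D (srp j i).
Proof.
move=> jS /posrootP pi ij; case: (pos_dec (srp j i)) => // /posrootP h; exfalso; apply: ij.
have z k : k \in Sm -> k != j -> simple_coef i k = 0.
  move=> kS kj; have := h k kS; rewrite simple_coef_opp // simple_coef_srp // (negPf kj) mulr0 subr0 oppr_ge0 => le.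
  by apply/eqP; rewrite eq_le le pi.
have e : rt i = simple_coef i j *: rt j.
  rewrite zcE (bigD1 j) //= big1 ?addr0 // => k /andP[kS kj].
  by rewrite z // scale0r.
have nz : 0 < simple_coef i j.
  rewrite lt_neqAle pi // andbT eq_sym; apply/eqP => z0.
  by have := rt_neq0 i; rewrite e z0 scale0r eqxx.
by apply: (@rt_par i j 1 (simple_coef i j)); rewrite // scale1r.
Qed.

(** Induction on the height. Expanding the pairing 2 of a root with its coroot gives a simple root
    with positive coefficient and positive pairing; reflecting in it lowers the height, keeps the
    root positive and stays in the span of [J]. *)
Lemma root_ind (J : {set I}) (P : I -> Prop) : J \subset Sm ->
  (forall j, j \in J -> P j) -> (forall k i, k \in J -> P i -> P (srp k i)) ->
  forall i, posroot D i -> (forall j, j \in Sm -> j \notin J -> simple_coef i j = 0) -> P i.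
Proof.
move=> /subsetP JS P0 PS i; have [N] := ubnP `|(\sum_(j in Sm) simple_coef i j)%R|%N.
elim: N i => // N IH i; rewrite ltnS => hN pi hJ.
have pi' := (posrootP i).1 pi.
have : \sum_(j in Sm) simple_coef i j * ipair (cr i) (rt j) = 2.
  rewrite -(cr_rt i) [in RHS]zcE ipair_sumr; apply: eq_bigr => j _; exact/esym/ipairZr.
move=> e.
have [j jS jp] : exists2 j, j \in Sm & 0 < simple_coef i j * ipair (cr i) (rt j).
  case: (boolP [exists j in Sm, 0 < simple_coef i j * ipair (cr i) (rt j)]) => [/exists_inP//|/exists_inPn h].
  have : \sum_(j in Sm) simple_coef i j * ipair (cr i) (rt j) <= 0.
    by apply: sumr_le0 => j jS; rewrite leNgt; exact: h.
  by rewrite e.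
have jz := pi' j jS.
have jp1 : 0 < simple_coef i j.
  by rewrite lt_neqAle jz // andbT; apply: contraTneq jp => <-; rewrite mul0r ltxx.
have jp2 : 0 < ipair (cr i) (rt j) by rewrite -(pmulr_rgt0 _ jp1).
have jJ : j \in J by apply/negPn/negP => nJ; rewrite hJ in jp1.
have [->|ij] := eqVneq i j; first exact: P0.
have sp : 0 < ipair (cr j) (rt i).
  by rewrite -(pmulr_lgt0 _ (bi_cr_gt0 i)) pair_sym mulr_gt0 ?bi_cr_gt0.
have pj : posroot D (srp j i) by apply: pos_srp => //; apply/eqP.
rewrite -(srpK j i); apply: PS => //; apply: IH => //.
- have s1 : \sum_(k in Sm) simple_coef (srp j i) k = \sum_(k in Sm) simple_coef i k - ipair (cr j) (rt i).
    rewrite (eq_bigr (fun k => simple_coef i k - ipair (cr j) (rt i) * (k == j)%:Z)) => [|k kS]; last exact: simple_coef_srp.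
    rewrite sumrB; congr (_ - _); rewrite (bigD1 j) //= eqxx mulr1 big1 ?addr0 //.
    by move=> k /andP[_ /negPf ->]; rewrite mulr0.
  have s2 : 0 <= \sum_(k in Sm) simple_coef (srp j i) k by apply: sumr_ge0 => k kS; exact: (posrootP _).1.
  move: hN s2; rewrite s1; move: (\sum_(k in Sm) simple_coef i k) => S; lia.
- move=> k kS kJ; rewrite simple_coef_srp // hJ // (_ : k == j = false) ?mulr0 //.
  by apply: contraNF kJ => /eqP ->.
Qed.

Fixpoint word_perm (s : seq I) : {perm I} := if s is i :: s' then (word_perm s' * srp i)%g else 1%g.

Lemma raut_word s : raut (word_perm s) (wordmx s).
Proof. by elim: s => [|i s IH] /=; [exact: raut1|exact: raut_mul IH (raut_sref i)]. Qed.

Lemma word_cat s t : wordmx (s ++ t) = wordmx t *m wordmx s.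
Proof. by elim: s => [|i s IH] /=; rewrite ?mulmx1 // /fmul IH mulmxA. Qed.
Lemma word1 i : wordmx [:: i] = sref i.
Proof. by rewrite /= /fmul mul1mx. Qed.
Lemma word_rcons s i : wordmx (rcons s i) = sref i *m wordmx s.
Proof. by rewrite -cats1 word_cat word1. Qed.
Lemma word_rev s : wordmx (rev s) *m wordmx s = 1%:M.
Proof.
elim: s => [|i s IH]; first by rewrite mulmx1.
by rewrite rev_cons word_rcons /= /fmul -mulmxA (mulmxA (wordmx (rev s))) IH mul1mx srefK.
Qed.
Lemma word_inv s : invmx (wordmx s) = wordmx (rev s).
Proof.
have [u _ _] := raut_word s; apply: (can_inj (mulmxK u)); rewrite mulVmx //.
by rewrite word_rev.
Qed.

Lemma inWJ1 J : inWJ J 1%:M. Proof. by exists [::]. Qed.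
Lemma inWJ_mul J A B : inWJ J A -> inWJ J B -> inWJ J (A *m B).
Proof. by move=> [s [hs ->]] [t [ht ->]]; exists (t ++ s); rewrite all_cat ht hs word_cat. Qed.
Lemma inWJ_inv J A : inWJ J A -> inWJ J (invmx A).
Proof. by move=> [s [hs ->]]; exists (rev s); rewrite all_rev word_inv. Qed.
Lemma inWJ_sref (J : {set I}) j : j \in J -> inWJ J (sref j).
Proof. by move=> jJ; exists [:: j]; rewrite word1 /= jJ. Qed.
Lemma inWJ_raut J A : inWJ J A -> exists p, raut p A.
Proof. by move=> [s [_ ->]]; exists (word_perm s); exact: raut_word. Qed.

Lemma sref_srp k i : sref (srp k i) = sref k *m sref i *m sref k.
Proof.
have := raut_conj_sref i (raut_sref k) => /(congr1 (mulmx (sref k))).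
by rewrite mulmxA srefK mul1mx mulmxA.
Qed.

Lemma sref_opp i : sref (root_opp i) = sref i.
Proof. by rewrite sref_srp srefK mul1mx. Qed.

Lemma inWJ_sref_root (J : {set I}) i : J \subset Sm -> (forall j, j \in Sm -> j \notin J -> simple_coef i j = 0) ->
  inWJ J (sref i).
Proof.
move=> JS; have pos k : posroot D k -> (forall j, j \in Sm -> j \notin J -> simple_coef k j = 0) -> inWJ J (sref k).
  apply: (root_ind JS (P := fun k => inWJ J (sref k))) => [j|{}k l kJ h]; first exact: inWJ_sref.
  rewrite sref_srp; apply: inWJ_mul; last exact: inWJ_sref.
  by apply: inWJ_mul => //; exact: inWJ_sref.
case: (pos_dec i) => h hJ; first exact: pos.
by rewrite -sref_opp; apply: pos => // j jS jJ; rewrite simple_coef_opp // hJ // oppr0.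
Qed.

Lemma inW0_sref i : inW0 D (sref i).
Proof. by apply: inWJ_sref_root => // j -> . Qed.

(** Applying the letters one after the other, the root turns negative at some letter [k], hence
    equals the simple root [k] just before; conjugation then identifies the two reflections and both
    letters cancel. *)
Lemma deletion s i : all (fun k => k \in Sm) s -> i \in Sm -> ~ posroot D (word_perm s i) ->
  exists s', [/\ wordmx (rcons s i) = wordmx s', (size s' < size (rcons s i))%N & {subset s' <= s}].
Proof.
elim: s => [|k s IH] /=; first by move=> _ iS; rewrite perm1 => /(_ (pos_simple iS)).
move=> /andP[kS hs] iS; rewrite permM => np.
case: (excluded_middle_informative (posroot D (word_perm s i))) => h; last first.
  have [s' [e lt sub]] := IH hs iS h.
  exists (k :: s'); split; rewrite /= ?e //.
  by move=> j; rewrite !inE => /orP[->//|/sub ->]; rewrite orbT.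
have wk : word_perm s i = k.
  by case: (eqVneq (word_perm s i) k) => // /eqP ne; case: np; exact: pos_srp.
exists s; split.
- rewrite word_rcons /fmul -mulmxA -wk (raut_conj_sref i (raut_word s)).
  by rewrite mulmxA srefK mul1mx.
- by rewrite size_rcons ltnW.
- by move=> j; rewrite inE => ->; rewrite orbT.
Qed.

Lemma reduced_ex J A : inWJ J A -> exists s, reduced_word D J A s.
Proof.
move=> [s [hs e]]; have [N] := ubnP (size s); elim: N s hs e => // N IH s hs e; rewrite ltnS => hN.
case: (excluded_middle_informative (exists t, [/\ all (fun i => i \in J) t, A = wordmx t & (size t < size s)%N])).
  by move=> [t [ht et lt]]; apply: (IH t) => //; exact: leq_trans lt hN.
move=> no; exists s; split=> // t ht et; rewrite leqNgt; apply/negP => lt; apply: no; by exists t.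
Qed.

(** [deletion] only removes letters, so it stays within words in [J] and contradicts minimality
    there if the root were negative. *)
Lemma reduced_rcons (J : {set I}) A s i : J \subset Sm -> reduced_word D J A (rcons s i) ->
  posroot D (word_perm s i) /\ reduced_word D J (wordmx s) s.
Proof.
move=> /subsetP JS [hs e mn]; move: (hs); rewrite all_rcons => /andP[iJ hs'].
split.
  case: (excluded_middle_informative (posroot D (word_perm s i))) => // np; exfalso.
  have [||s' [e' lt sub]] := @deletion s i _ _ np; [|exact: JS|].
    by apply/allP => k /(allP hs'); exact: JS.
  have : (size (rcons s i) <= size s')%N.
    apply: mn; last by rewrite e e'.
    by apply/allP => k /sub /(allP hs').
  by rewrite leqNgt lt.
split=> // t ht et; have := mn (rcons t i); rewrite all_rcons iJ ht e !word_rcons et => /(_ isT erefl).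
by rewrite !size_rcons ltnS.
Qed.

End RootDatum.

(** * Pairing of real vectors with integral roots, and dual bases *)

Section RealPairing.
Variables (R : realFieldType) (n : nat).
Implicit Types (x y : 'rV[R]_n) (a : 'rV[int]_n).

Lemma pairRD x y a : pairR (x + y) a = pairR x a + pairR y a.
Proof. by rewrite /pairR mulmxDl mxE. Qed.
Lemma pairRZ c x a : pairR (c *: x) a = c * pairR x a.
Proof. by rewrite /pairR -scalemxAl mxE. Qed.
Lemma pairRN x a : pairR (- x) a = - pairR x a.
Proof. by rewrite /pairR mulNmx mxE. Qed.
Lemma pairRB x y a : pairR (x - y) a = pairR x a - pairR y a.
Proof. by rewrite pairRD pairRN. Qed.
Lemma pairR0 a : pairR (0 : 'rV[R]_n) a = 0.
Proof. by rewrite /pairR mul0mx mxE. Qed.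
Lemma pairR_sum (T : finType) (P : pred T) (G : T -> 'rV[R]_n) a :
  pairR (\sum_(t | P t) G t) a = \sum_(t | P t) pairR (G t) a.
Proof. by rewrite /pairR mulmx_suml summxE. Qed.
Lemma pairRE x a : pairR x a = \sum_k x 0 k * (a 0 k)%:~R.
Proof. by rewrite /pairR mxE; apply: eq_bigr => k _; rewrite !mxE. Qed.
Lemma pairR_toR a b : pairR (toR R a) b = (ipair a b)%:~R.
Proof. by rewrite pairRE ipairE rmorph_sum; apply: eq_bigr => k _; rewrite rmorphM mxE. Qed.
Lemma pairR_Dr x a b : pairR x (a + b) = pairR x a + pairR x b.
Proof. by rewrite !pairRE -big_split; apply: eq_bigr => k _; rewrite /= mxE rmorphD mulrDr. Qed.
Lemma pairR_Zr x c a : pairR x (c *: a) = c%:~R * pairR x a.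
Proof. by rewrite !pairRE mulr_sumr; apply: eq_bigr => k _; rewrite mxE rmorphM mulrCA. Qed.
Lemma pairR_Nr x a : pairR x (- a) = - pairR x a.
Proof. by rewrite -scaleN1r pairR_Zr mulN1r. Qed.
Lemma pairR_sumr (T : finType) (P : pred T) (G : T -> 'rV[int]_n) x :
  pairR x (\sum_(t | P t) G t) = \sum_(t | P t) pairR x (G t).
Proof.
elim/big_rec2: _ => [|t u v _ e]; last by rewrite pairR_Dr e.
by rewrite pairRE big1 // => k _; rewrite mxE mulr0.
Qed.
Lemma pairR0_eq0 a : (forall x : 'rV[R]_n, pairR x a = 0) -> a = 0.
Proof.
move=> h; apply/rowP => k; have := h (delta_mx 0 k).
by rewrite /pairR -rowE !mxE => /eqP; rewrite intr_eq0 => /eqP.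
Qed.

Lemma toRD m p (A B : 'M[int]_(m, p)) : toR R (A + B) = toR R A + toR R B.
Proof. by apply/matrixP => i j; rewrite !mxE rmorphD. Qed.
Lemma toRN m p (A : 'M[int]_(m, p)) : toR R (- A) = - toR R A.
Proof. by apply/matrixP => i j; rewrite !mxE rmorphN. Qed.
Lemma toRM m p q (A : 'M[int]_(m, p)) (B : 'M[int]_(p, q)) : toR R (A *m B) = toR R A *m toR R B.
Proof. exact: map_mxM. Qed.
Lemma toR1 : toR R (1%:M : 'M[int]_n) = 1%:M.
Proof. exact: map_mx1. Qed.
Lemma toRZ m p c (A : 'M[int]_(m, p)) : toR R (c *: A) = c%:~R *: toR R A.
Proof. by apply/matrixP => i j; rewrite !mxE rmorphM. Qed.
Lemma toRT m p (A : 'M[int]_(m, p)) : toR R A^T = (toR R A)^T.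
Proof. by apply/matrixP => i j; rewrite !mxE. Qed.
Lemma toR_inj m p : injective (@toR R m p).
Proof. by move=> A B /matrixP h; apply/matrixP => i j; have := h i j; rewrite !mxE => /intr_inj. Qed.
End RealPairing.

Lemma denominators n (v : 'rV[rat]_n) : exists (d : int) (c : 'rV[int]_n),
  d != 0 /\ d%:~R *: v = map_mx intr c.
Proof.
exists (\prod_j denq (v 0 j)), (\row_k (numq (v 0 k) * \prod_(j | j != k) denq (v 0 j))).
split; first by apply/prodf_neq0 => j _; exact: denq_neq0.
apply/rowP => k; rewrite !mxE (bigD1 k) //= !rmorphM /=.
have e : (denq (v 0 k))%:~R * v 0 k = (numq (v 0 k))%:~R :> rat.
  by rewrite -{2}[v 0 k]divq_num_den mulrC divfK // intr_eq0 denq_neq0.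
by rewrite mulrAC e.
Qed.

(** Independence is given with integer coefficients. Clearing denominators upgrades it to rational
    ones, a right inverse over the rationals gives the dual vectors, and these are mapped into the
    arbitrary field [R]. *)
Lemma dual_basis (R : realFieldType) n (I : finType) (S : {set I}) (r : I -> 'rV[int]_n) :
  (forall c : I -> int, \sum_(i in S) c i *: r i = 0 -> forall i, i \in S -> c i = 0) ->
  forall j, j \in S -> exists x : 'rV[R]_n, forall i, i \in S -> pairR x (r i) = (i == j)%:R.
Proof.
move=> ind j jS; pose M : 'M[rat]_(#|S|, n) := \matrix_(k, l) (r (enum_val k) 0 l)%:~R.
have fM : row_free M.
  rewrite -kermx_eq0; apply/eqP/row_matrixP => k; rewrite row0.
  set v := row k _; have vM : v *m M = 0 by apply/eqP; rewrite /v -row_mul mulmx_ker row0.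
  have [d [c [d0 e]]] := denominators v.
  suff c0 : c = 0.
    apply/rowP => l; have /rowP/(_ l) := e; rewrite c0 !mxE => /eqP.
    by rewrite mulf_eq0 intr_eq0 (negPf d0) => /eqP.
  have ec : \sum_(i in S) c 0 (enum_rank_in jS i) *: r i = 0.
    apply/rowP => l; rewrite mxE summxE.
    have : (d%:~R *: (v *m M)) 0 l = 0 by rewrite vM scaler0 mxE.
    rewrite scalemxAl e mxE => h; apply: (@intr_inj rat); rewrite -[RHS]h rmorph_sum.
    rewrite (reindex_onto (enum_val (A := S)) (enum_rank_in jS)) => [|i iS]; last exact: enum_rankK_in.
    apply: eq_big => [k'|k' _]; first by rewrite enum_valP enum_valK_in eqxx.
    by rewrite !mxE rmorphM enum_valK_in.
  apply/rowP => l; rewrite mxE.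
  have := ind (fun i => c 0 (enum_rank_in jS i)) _ (enum_val l) (enum_valP l).
  by rewrite enum_valK_in; apply.
move: (pinvmx M) (mulmxVp fM) => B MB.
pose x : 'rV[rat]_n := (col (enum_rank_in jS j) B)^T.
exists (map_mx ratr x) => i iS; rewrite pairRE.
have /matrixP/(_ (enum_rank_in jS i) (enum_rank_in jS j)) := MB.
rewrite !mxE => e.
transitivity (ratr (\sum_k M (enum_rank_in jS i) k * B k (enum_rank_in jS j)) : R).
  rewrite rmorph_sum; apply: eq_bigr => k _; rewrite rmorphM [M _ _]mxE !mxE enum_rankK_in //.
  by rewrite rmorph_int mulrC.
rewrite e; have -> : (enum_rank_in jS i == enum_rank_in jS j) = (i == j).
  by apply/eqP/eqP => [h|->//]; rewrite -(enum_rankK_in jS iS) h enum_rankK_in.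
by case: eqP => _; rewrite ?rmorph1 ?rmorph0.
Qed.

(** * Dominance and reduced words *)

Section RealRoots.
Variables (R : realFieldType) (n : nat) (I : finType) (D : RD n I).
Hypothesis HD : is_based_root_datum D.
Local Notation rt := (root D).
Local Notation cr := (coroot D).
Local Notation Sm := (simple D).
Local Notation sref := (sref D).
Local Notation wordmx := (wordmx D).
Local Notation inWJ := (inWJ D).
Local Notation srp := (srp HD).
Local Notation ropp := (root_opp HD).
Local Notation raut := (raut D).
Local Notation simple_coef := (simple_coef HD).
Implicit Types (x y : 'rV[R]_n).

Lemma raut_pairR p A x i : raut p A -> pairR (x *m toR R A) (rt (p i)) = pairR x (rt i).
Proof.
by case=> _ _ h; rewrite /pairR -mulmxA -!toRT -toRM h.
Qed.

Lemma pairR_opp x i : pairR x (rt (ropp i)) = - pairR x (rt i).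
Proof. by rewrite rt_opp pairR_Nr. Qed.

Lemma toR_sref x i : x *m toR R (sref i) = x - pairR x (rt i) *: toR R (cr i).
Proof.
rewrite /Defs.sref toRD toR1 toRN toRM mulmxBr mulmx1 mulmxA; congr (_ - _).
have -> : x *m toR R (rt i)^T = (pairR x (rt i))%:M.
  apply/matrixP => a b; rewrite !ord1 [RHS]mxE eqxx mulr1n /pairR; congr ((x *m _) 0 0).
  by apply/matrixP => k l; rewrite !mxE.
by rewrite mul_scalar_mx.
Qed.

Lemma pairR_simple_coef x i : pairR x (rt i) = \sum_(j in Sm) (simple_coef i j)%:~R * pairR x (rt j).
Proof. by rewrite [in LHS](zcE HD i) pairR_sumr; apply: eq_bigr => j _; rewrite pairR_Zr. Qed.

Lemma coweight_ex j : j \in Sm -> exists x, forall i, i \in Sm -> pairR x (rt i) = (i == j)%:R.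
Proof. by apply: dual_basis; exact: rt_indep. Qed.

Lemma rho_ex : exists x : 'rV[R]_n, forall i, i \in Sm -> pairR x (rt i) = 1.
Proof.
have h j : exists x : 'rV[R]_n, j \in Sm -> forall i, i \in Sm -> pairR x (rt i) = (i == j)%:R.
  case: (boolP (j \in Sm)) => jS; last by exists 0.
  by have [x hx] := coweight_ex jS; exists x.
pose om j := epsilon (inhabits (0 : 'rV[R]_n)) (fun x => j \in Sm -> forall i, i \in Sm -> pairR x (rt i) = (i == j)%:R).
have omP j : j \in Sm -> forall i, i \in Sm -> pairR (om j) (rt i) = (i == j)%:R.
  by apply: (epsilon_spec (inhabits (0 : 'rV[R]_n)) (fun x => j \in Sm -> forall i, i \in Sm -> pairR x (rt i) = (i == j)%:R)); exact: h.
exists (\sum_(j in Sm) om j) => i iS; rewrite pairR_sum (bigD1 i) //= omP // eqxx.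
by rewrite big1 ?addr0 // => j /andP[jS /negPf ji]; rewrite omP // eq_sym ji.
Qed.

Lemma rho_pos (h : 'rV[R]_n) : (forall i, i \in Sm -> pairR h (rt i) = 1) ->
  forall i, posroot D i -> 1 <= pairR h (rt i).
Proof.
move=> h1 i /(posrootP HD) pi; have [j jS nz] := simple_coef_nz HD i.
have p1 : 1 <= simple_coef i j by have := pi j jS; move: nz; lia.
rewrite pairR_simple_coef (bigD1 j) //= h1 // mulr1; apply: (@le_trans _ _ (simple_coef i j)%:~R).
  by rewrite (ler_int R 1).
rewrite lerDl sumr_ge0 // => k /andP[kS _]; rewrite h1 // mulr1 ler0z; exact: pi.
Qed.

Definition bf x y : R := \sum_k pairR x (rt k) * pairR y (rt k).

Lemma bf_raut p A x y : raut p A -> bf (x *m toR R A) (y *m toR R A) = bf x y.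
Proof.
move=> h; rewrite /bf (reindex_inj (@perm_inj _ p)).
by apply: eq_bigr => k _; rewrite !(raut_pairR _ _ h).
Qed.

Lemma bfDr x y v : bf x (y + v) = bf x y + bf x v.
Proof. by rewrite -big_split; apply: eq_bigr => k _; rewrite pairRD mulrDr. Qed.
Lemma bfZr x c y : bf x (c *: y) = c * bf x y.
Proof. by rewrite mulr_sumr; apply: eq_bigr => k _; rewrite pairRZ mulrCA. Qed.
Lemma bfC x y : bf x y = bf y x.
Proof. by apply: eq_bigr => k _; rewrite mulrC. Qed.

Lemma bfNr x y : bf x (- y) = - bf x y.
Proof. by rewrite -scaleN1r bfZr mulN1r. Qed.

Lemma bf_cr_gt0 i : 0 < bf (toR R (cr i)) (toR R (cr i)).
Proof.
rewrite /bf (bigD1 i) //= pairR_toR cr_rt // ltr_pwDl //; first by rewrite mulr_gt0 // ltr0z.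
by apply: sumr_ge0 => k _; rewrite -expr2 sqr_ge0.
Qed.

Lemma bf_cr x i : 2 * bf x (toR R (cr i)) = pairR x (rt i) * bf (toR R (cr i)) (toR R (cr i)).
Proof.
have := bf_raut x (toR R (cr i)) (raut_sref HD i).
rewrite -toRM; have [_ -> _] := raut_sref HD i; rewrite -/(ropp i) cr_opp toRN toR_sref.
rewrite bfNr bfC bfDr bfNr bfZr (bfC _ x); lra.
Qed.

Lemma bf_cr_pos (h : 'rV[R]_n) i : (forall i, i \in Sm -> pairR h (rt i) = 1) -> posroot D i ->
  0 < bf h (toR R (cr i)).
Proof.
move=> h1 pi; have := rho_pos h1 pi; have := bf_cr h i; have := bf_cr_gt0 i; nra.
Qed.

Definition domJ (J : {set I}) x := forall j, j \in J -> 0 <= pairR x (rt j).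

(** Reflecting in a simple root of [J] that is negative on [x] strictly lowers the number of
    positive roots negative on [x]. *)
Lemma dom_ex (J : {set I}) x : J \subset Sm -> exists w, inWJ J w /\ domJ J (x *m toR R w).
Proof.
move=> /subsetP JS.
pose pb i := [forall j in Sm, 0 <= simple_coef i j].
have pbP i : reflect (posroot D i) (pb i).
  by apply: (iffP forall_inP) => h; apply/(posrootP HD).
have [N] := ubnP #|[set i | pb i && (pairR x (rt i) < 0)]|.
elim: N x => // N IH x; rewrite ltnS => hN.
case: (boolP [forall j in J, 0 <= pairR x (rt j)]) => [/forall_inP h|].
  by exists 1%:M; split; [exact: inWJ1|rewrite toR1 mulmx1].
case/forall_inPn => j jJ; rewrite -ltNge => neg.
pose x' := x *m toR R (sref j).
have ex' i : pairR x' (rt (srp j i)) = pairR x (rt i) by apply: raut_pairR; exact: raut_sref.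
have [|w [hw dw]] := IH x'.
  apply: leq_trans hN; apply: (@leq_ltn_trans #|srp j @: [set i | pb i && (pairR x' (rt i) < 0)]|).
    by rewrite card_imset //; exact: perm_inj.
  apply: proper_card; apply/properP; split.
    apply/subsetP => _ /imsetP[i + ->]; rewrite !inE => /andP[/pbP pi lt].
    rewrite -ex' srpK lt andbT; apply/pbP; apply: pos_srp => //; first exact: JS.
    move=> ij; move: lt; rewrite ij; have := ex' (srp j j); rewrite srpK -/(ropp j) pairR_opp => ->.
    by rewrite oppr_lt0 => h; move: neg; rewrite ltNge ltW.
  exists j; first by rewrite inE neg andbT; apply/pbP; apply: pos_simple => //; exact: JS.
  apply/negP => /imsetP[i]; rewrite inE => /andP[/pbP pi _] e.
  move: pi; rewrite -(srpK HD j i) -e -/(ropp j) => /(pos_opp HD) h; apply: h.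
  by apply: pos_simple => //; exact: JS.
exists (sref j *m w); split; last by rewrite toRM mulmxA.
by apply: inWJ_mul => //; exact: inWJ_sref.
Qed.

(** Each letter of a reduced word subtracts a nonnegative multiple of a positive coroot, and [h]
    plays the role of the half sum of positive coroots: its product with every positive coroot is
    positive. Equality forces all multiples to vanish. *)
Lemma stab_word (J : {set I}) (h : 'rV[R]_n) s x : J \subset Sm -> (forall i, i \in Sm -> pairR h (rt i) = 1) ->
  reduced_word D J (wordmx s) s -> domJ J x ->
  bf h (x *m toR R (wordmx s)) <= bf h x /\
  (bf h (x *m toR R (wordmx s)) = bf h x -> all (fun i => pairR x (rt i) == 0) s).
Proof.
move=> JS h1; elim/last_ind: s x => [|s i IH] x rs dx; first by rewrite toR1 mulmx1.
have [pi rs'] := reduced_rcons HD JS rs.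
have [le eq] := IH x rs' dx.
have iJ : i \in J by case: rs; rewrite all_rcons => /andP[].
have e : x *m toR R (wordmx (rcons s i)) =
    x *m toR R (wordmx s) + (- pairR x (rt i)) *: toR R (cr (word_perm HD s i)).
  rewrite word_rcons toRM mulmxA toR_sref mulmxBl -scalemxAl -toRM scaleNr.
  by have [_ -> _] := raut_word HD s.
have c0 := dx i iJ; have b0 := bf_cr_pos h1 pi.
rewrite e bfDr bfZr; split; first by nra.
move=> e2; have z : pairR x (rt i) = 0.
  apply/eqP; rewrite eq_le c0 andbT leNgt; apply/negP => c1.
  have : 0 < pairR x (rt i) * bf h (toR R (cr (word_perm HD s i))) by rewrite mulr_gt0.
  by move: le e2; lra.
by rewrite all_rcons z eqxx eq // -e2 z oppr0 mul0r addr0.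
Qed.

(** [stab_word] is applied to [w] and to its inverse; the two inequalities give equality, so all
    letters are orthogonal to [x]. *)
Lemma dom_uniq (J : {set I}) x w s : J \subset Sm -> reduced_word D J w s ->
  domJ J x -> domJ J (x *m toR R w) ->
  all (fun i => pairR x (rt i) == 0) s /\ x *m toR R w = x.
Proof.
move=> JS rs dx dxw; have [h h1] := rho_ex.
have ws : w = wordmx s by case: rs.
have rs' : reduced_word D J (wordmx s) s by rewrite -ws.
have [le1 eq1] := stab_word JS h1 rs' dx.
have iw : inWJ J w by case: rs => a b _; exists s.
have [t rt'] := reduced_ex (inWJ_inv HD iw).
have wt : invmx w = wordmx t by case: rt'.
have rt2 : reduced_word D J (wordmx t) t by rewrite -wt.
have [le2 _] := stab_word JS h1 rt2 dxw.
have uw : w \in unitmx by have [p []] := inWJ_raut HD iw.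
move: le2; rewrite -wt -mulmxA -toRM mulmxV // toR1 mulmx1 ws => le2.
have al : all (fun i => pairR x (rt i) == 0) s by apply: eq1; apply/eqP; rewrite eq_le le1 le2.
split=> //; move: al; clear; elim/last_ind: s => [|s i IH]; first by rewrite toR1 mulmx1.
rewrite all_rcons => /andP[/eqP z al].
by rewrite word_rcons toRM mulmxA toR_sref z scale0r subr0 IH.
Qed.

End RealRoots.

(** * Weakly elliptic elements *)
Section WeaklyElliptic.
Variables (R : realFieldType) (n : nat) (I : finType) (D : RD n I).
Hypothesis HD : is_based_root_datum D.
Local Notation rt := (root D).
Local Notation cr := (coroot D).
Local Notation Sm := (simple D).
Local Notation sref := (sref D).
Local Notation wordmx := (wordmx D).
Local Notation inWJ := (inWJ D).
Local Notation srp := (srp HD).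
Local Notation ropp := (root_opp HD).
Local Notation raut := (raut D).
Local Notation simple_coef := (simple_coef HD).

(* Condition (2) in terms of the Newton point and the finite part alone, hence computable over any field *)
Definition root_dichotomy (nu : 'rV[R]_n) (z : 'M[int]_n) := forall i, pairR nu (rt i) = 0 ->
  (forall u : 'rV[R]_n, u *m toR R z = u -> pairR u (rt i) = 0) \/
  (forall u : 'rV[R]_n, pairR (u *m toR R z) (rt i) = pairR u (rt i)).

Lemma root_dichotomy_conj nu z z' q u : raut q u -> z' *m u = u *m z -> root_dichotomy (nu *m toR R u) z -> root_dichotomy nu z'.
Proof.
move=> ru e c i nui.
have eR (v : 'rV[R]_n) : v *m toR R z' *m toR R u = v *m toR R u *m toR R z.
  by rewrite -!mulmxA -!toRM e.
have [|h|h] := c (q i); first by rewrite (raut_pairR _ _ ru).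
  left=> v vz; rewrite -(raut_pairR _ _ ru); apply: h.
  by rewrite -eR vz.
by right=> v; rewrite -(raut_pairR _ _ ru) eR h (raut_pairR _ _ ru).
Qed.

Lemma raut_pow p A m : raut p A -> raut (p ^+ m)%g (A ^+ m).
Proof.
move=> h; elim: m => [|m IH]; first exact: raut1.
by rewrite expgSr exprSr; exact: raut_mul.
Qed.

Variables (sigma : 'M[int]_n) (ps : {perm I}) (N : nat).
Hypothesis rsig : raut ps sigma.
Hypothesis ps_simple : forall i, (ps i \in Sm) = (i \in Sm).
Hypothesis N_gt0 : (0 < N)%N.
Hypothesis sigN : sigma ^+ N = 1%:M.

Variable nu : 'rV[R]_n.
Hypothesis nu_dom : domJ D Sm nu.
Let J := [set i in Sm | pairR nu (rt i) == 0].
Hypothesis nu_sig : nu *m toR R sigma = nu.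

Lemma J_sub : J \subset Sm.
Proof. by apply/subsetP => i; rewrite inE => /andP[]. Qed.

Lemma pow_J m i : ((ps ^+ m)%g i \in J) = (i \in J).
Proof.
elim: m i => [|m IH] i; first by rewrite expg0 perm1.
rewrite expgSr permM -[RHS]IH !inE ps_simple; congr (_ && (_ == 0)).
by rewrite -{1}nu_sig (raut_pairR _ _ rsig).
Qed.

Lemma pow_period m : (sigma ^+ m) ^+ N = 1%:M.
Proof. by rewrite -exprM mulnC exprM sigN expr1n. Qed.

Lemma perm_period m : (ps ^+ m ^+ N)%g = 1%g.
Proof.
apply: (raut_uniq HD (A := 1%:M)); last exact: raut1.
by rewrite -(pow_period m); apply: raut_pow; exact: raut_pow.
Qed.

Lemma nu_WJ w : inWJ J w -> nu *m toR R w = nu.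
Proof.
move=> [s [hs ->]]; elim/last_ind: s hs => [|s i IH]; first by rewrite toR1 mulmx1.
rewrite all_rcons inE => /andP[/andP[_ /eqP z] hs].
by rewrite word_rcons toRM mulmxA toR_sref z scale0r subr0 IH.
Qed.

Lemma cartan_le0 i j : i \in Sm -> j \in Sm -> i != j -> ipair (cr i) (rt j) <= 0.
Proof.
move=> iS jS ij; have pj : posroot D j by exact: pos_simple.
have /(posrootP HD)/(_ i iS) : posroot D (srp i j).
  by apply: pos_srp => // /eqP; rewrite eq_sym (negPf ij).
by rewrite (simple_coef_srp HD) // (simple_coef_simple HD) // (eq_sym j) (negPf ij) eqxx mulr1 sub0r oppr_ge0.
Qed.

(** The support read off one factorisation [w sigma^m]. The exponent and the factor are not
    determined by the element, and [gsupp] is the union over all factorisations. *)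
Definition ksupp w m i := exists e j, suppW D J w j /\ cr j *m (sigma ^+ m) ^+ e = cr i.

Lemma cr_pow m e j : cr j *m (sigma ^+ m) ^+ e = cr ((ps ^+ m ^+ e)%g j).
Proof. by have [_ -> _] := raut_pow e (raut_pow m rsig). Qed.

Lemma ksuppE w m i : ksupp w m i <-> exists e j, suppW D J w j /\ i = (ps ^+ m ^+ e)%g j.
Proof.
split=> [[e [j [sj h]]]|[e [j [sj ->]]]]; exists e, j; split=> //.
  by apply: (cr_inj HD); rewrite -h cr_pow.
by rewrite cr_pow.
Qed.

Lemma ksupp_back w m i : ksupp w m ((ps ^+ m)%g i) -> ksupp w m i.
Proof.
move/ksuppE => [e [j [sj h]]]; apply/ksuppE; exists (e + N.-1)%N, j; split=> //.
apply: (@perm_inj _ (ps ^+ m)%g); rewrite h -[RHS]permM -expgSr -addnS prednK //.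
by rewrite expgD perm_period mulg1.
Qed.

Lemma pairR_pow m e (x : 'rV[R]_n) i :
  pairR (x *m toR R ((sigma ^+ m) ^+ e)) (rt ((ps ^+ m ^+ e)%g i)) = pairR x (rt i).
Proof. exact: raut_pairR (raut_pow e (raut_pow m rsig)). Qed.

(* If [j] is not in the support of [z], the orbit sum of a fundamental coweight is fixed by [z] but
   not killed by the root [j]. *)
Lemma outside_support w m z j : inWJ J w -> z = fmul w (sigma ^+ m) -> root_dichotomy nu z ->
  j \in J -> ~ ksupp w m j ->
  fmul (sref j) z = fmul z (sref j) /\ forall i, ksupp w m i -> ~ adjacent D i j.
Proof.
move=> iw ez c jJ nk.
have jS := subsetP J_sub j jJ.
set d := (ps ^+ m)%g; have rd : raut d (sigma ^+ m) by exact: raut_pow.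
have [s rs] := reduced_ex iw.
have [hs ws _] := rs.
have rz : raut (d * word_perm HD s)%g z by rewrite ez ws; apply: raut_mul => //; exact: raut_word.
have lett k : k \in s -> suppW D J w k by move=> ks; exists s.
have lettK k : k \in s -> ksupp w m k.
  by move=> /lett ?; apply/ksuppE; exists 0%N, k; rewrite expg0 perm1.
have [x hx] := coweight_ex R HD jS.
pose v := \sum_(e < N) x *m toR R ((sigma ^+ m) ^+ e).
have dS k e : k \in Sm -> exists2 l, l \in Sm & k = (d ^+ e)%g l.
  move=> kS; exists ((d ^+ e)^-1%g k); last by rewrite permKV.
  have st f i : ((ps ^+ f)%g i \in Sm) = (i \in Sm).
    elim: f i => [|f IH] i; first by rewrite expg0 perm1.
    by rewrite expgSr permM ps_simple IH.
  by rewrite -[_ \in _](st (m * e)%N) expgM permKV.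
have vE k : k \in Sm -> pairR v (rt k) = \sum_(e < N) ((d ^+ e)^-1%g k == j)%:R.
  move=> kS; rewrite pairR_sum; apply: eq_bigr => e _.
  have [l lS ->] := dS k e kS.
  by rewrite pairR_pow permK hx.
have vd : v *m toR R (sigma ^+ m) = v.
  have sE e : toR R ((sigma ^+ m) ^+ e) *m toR R (sigma ^+ m) = toR R ((sigma ^+ m) ^+ e.+1).
    by rewrite -toRM exprSr.
  rewrite /v mulmx_suml; case: (N) N_gt0 sigN pow_period => // N' _ _ pp.
  rewrite big_ord_recr [RHS]big_ord_recl /= addrC; congr (_ + _).
    by rewrite -mulmxA sE pp expr0.
  by apply: eq_bigr => e _; rewrite -mulmxA sE.
have vs k : k \in s -> pairR v (rt k) = 0.
  move=> ks; rewrite vE; last by apply: (subsetP J_sub); exact: (allP hs).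
  apply: big1 => e _; case: eqP => // h; case: nk.
  apply/ksuppE; exists (N - e)%N, k; split; first exact: lett.
  rewrite -h; apply: (@perm_inj _ (d ^+ e)%g); rewrite permKV -permM -expgD subnK; last exact/ltnW.
  by rewrite perm_period perm1.
have vw : v *m toR R w = v.
  rewrite ws; elim/last_ind: (s) vs => [|t i IH] h; first by rewrite toR1 mulmx1.
  rewrite word_rcons toRM mulmxA toR_sref h ?mem_rcons ?inE ?eqxx // scale0r subr0 IH // => k kt.
  by rewrite h // mem_rcons inE kt orbT.
have vz : v *m toR R z = v by rewrite ez /fmul toRM mulmxA vd vw.
have vj : pairR v (rt j) != 0.
  rewrite vE //; case: (N) N_gt0 => // N' _; rewrite big_ord_recl expg0 invg1 perm1 eqxx.
  by rewrite gt_eqF // ltr_pwDl // sumr_ge0.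
have [|h|h] := c j; first by move: jJ; rewrite inE => /andP[_ /eqP].
  by move: vj; rewrite (h _ vz) eqxx.
set pz := (d * word_perm HD s)%g in rz.
have uz : z \in unitmx by case: rz.
have pzj : pz j = j.
  apply: (rt_inj HD); apply/eqP; rewrite -subr_eq0; apply/eqP; apply: (@pairR0_eq0 R) => u.
  rewrite pairR_Dr pairR_Nr.
  have -> : u = u *m toR R (invmx z) *m toR R z by rewrite -mulmxA -toRM mulVmx // toR1 mulmx1.
  by rewrite (raut_pairR _ _ rz) h subrr.
split; first by rewrite /fmul -{1}pzj (raut_conj_sref _ rz).
pose K := [set k | k \in s].
have KJ : K \subset J by apply/subsetP => k; rewrite inE => /(allP hs).
have KS := subset_trans KJ J_sub.
have rsK : reduced_word D K w s.
  case: rs => _ _ mn; split=> //; first by apply/allP => k ks; rewrite inE.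
  move=> t ht; apply: mn; apply/allP => k /(allP ht); exact: (subsetP KJ).
(* Distinct simple roots pair nonpositively, so the negated coroots of [d j] and [j], both outside
   the support, are dominant for the letters of [w]. As [w] carries the first to the second,
   [dom_uniq] makes them equal and orthogonal to the letters. *)
pose xx : 'rV[R]_n := - toR R (cr (d j)).
have dje : cr (d j) *m w = cr j.
  by rewrite -[in RHS]pzj permM ws; have [_ -> _] := raut_word HD s.
have domneg l : l \in J -> ~ ksupp w m l -> domJ D K (- toR R (cr l)).
  move=> lJ nl k kK; rewrite pairRN oppr_ge0 pairR_toR lerz0; apply: cartan_le0.
  - exact: (subsetP J_sub).
  - exact: (subsetP KS).
  - by apply: contra_notN nl => /eqP ->; apply: lettK; rewrite inE in kK.
have djJ : d j \in J by rewrite pow_J.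
have ndj : ~ ksupp w m (d j) by move/ksupp_back.
have xw : xx *m toR R w = - toR R (cr j) by rewrite /xx mulNmx -toRM dje.
have [] := dom_uniq HD KS rsK (domneg _ djJ ndj); first by rewrite -/xx xw; exact: domneg.
rewrite -/xx xw => al e.
have dj : d j = j.
  by apply: (cr_inj HD); apply: (@toR_inj R); apply: oppr_inj; rewrite -/xx -e.
move=> i /ksuppE[e' [k [[t [rt' kt]] ->]]] [_ /negP]; apply; apply/eqP.
have ks : pairR (toR R (cr j)) (rt k) = 0.
  have [_ _ mn] := rsK.
  (* every reduced word of [w] has its letters orthogonal to [j] *)
  pose K' := [set k | k \in t].
  have [ht wt mt] := rt'.
  have KJ' : K' \subset J by apply/subsetP => l; rewrite inE => /(allP ht).
  have KS' := subset_trans KJ' J_sub.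
  have rsK' : reduced_word D K' w t.
    split=> //; first by apply/allP => l lt; rewrite inE.
    by move=> r hr; apply: mt; apply/allP => l /(allP hr); exact: (subsetP KJ').
  have dn l : l \in J -> ~ ksupp w m l -> domJ D K' (- toR R (cr l)).
    move=> lJ nl b bK; rewrite pairRN oppr_ge0 pairR_toR lerz0; apply: cartan_le0.
    - exact: (subsetP J_sub).
    - exact: (subsetP KS').
    - apply: contra_notN nl => /eqP ->; apply/ksuppE; exists 0%N, b; rewrite expg0 perm1.
      by split=> //; exists t; rewrite inE in bK.
  have [] := dom_uniq HD KS' rsK' (dn _ djJ ndj); first by rewrite -/xx xw; exact: dn.
  by rewrite dj => /allP/(_ k kt); rewrite pairRN oppr_eq0 => /eqP.
have z0 : ipair (cr j) (rt ((d ^+ e')%g k)) = 0.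
  have djk : (d ^+ e')%g j = j.
    by elim: (e') => [|f IH]; rewrite ?expg0 ?perm1 // expgSr permM IH.
  rewrite -{1}djk; have [_ <- _] := raut_pow e' rd.
  rewrite (raut_pair _ _ (raut_pow e' rd)).
  by apply/eqP; rewrite -(intr_eq0 R) -pairR_toR ks.
have := pair_sym HD j ((d ^+ e')%g k); rewrite z0 mul0r => /eqP.
by rewrite mulf_eq0 (gt_eqF (bi_cr_gt0 HD _)) orbF => /eqP.
Qed.

(** Comparing the rank one matrices behind two equal reflections shows that the roots are
    proportional, and reducedness leaves only a sign. *)
Lemma sref_eq i k : sref k = sref i -> k = i \/ k = ropp i.
Proof.
move=> e; have e2 : (rt k)^T *m cr k = (rt i)^T *m cr i.
  by move: e; rewrite /Defs.sref => /addrI /oppr_inj.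
set a := ipair (cr k) (rt i).
have e3 : a *: rt k = 2 *: rt i.
  have := congr1 (fun M => (M *m (rt i)^T)^T) e2.
  by rewrite -!mulmxA !mulmx_tr_ipair !mul_mx_scalar cr_rt // !linearZ /= !trmxK.
have a0 : a != 0.
  apply/eqP => z; move: e3; rewrite z => /(congr1 (ipair (cr i))).
  by rewrite !ipairZr cr_rt // mul0r.
have [lt|gt|/eqP] := ltrgtP a 0; last by rewrite (negPf a0).
  right; apply: (rt_par HD (c := - a) (d := 2)); rewrite ?oppr_gt0 //.
  by rewrite scaleNr e3 rt_opp scalerN.
by left; apply: (rt_par HD (c := a) (d := 2)).
Qed.

Lemma conj_word p A s : raut p A -> invmx A *m wordmx s *m A = wordmx (map p s).
Proof.
move=> h; have [uA _ _] := h; elim: s => [|i s IH]; first by rewrite /= mulmx1 mulVmx.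
by rewrite /= /fmul -IH -!mulmxA (raut_conj_sref _ h).
Qed.

Lemma weakly_ellipticP z w : inW0 D w -> z = fmul w sigma -> nu *m toR R z = nu ->
  weakly_elliptic D J sigma z <-> root_dichotomy nu z.
Proof.
move=> iw ez nuz.
(* Both [z] and [sigma] fix the dominant vector [nu], so [w] does too and its reduced words use only
   letters orthogonal to [nu]. *)
have wJ : inWJ J w.
  have [s rs] := reduced_ex (iw : inWJ Sm w).
  have e : nu *m toR R w = nu by rewrite -{1}nu_sig -mulmxA -toRM -[sigma *m w]/(fmul w sigma) -ez.
  have [|al _] := dom_uniq HD (subxx _) rs nu_dom; first by rewrite e.
  case: rs => hs -> _; exists s; split=> //; apply/allP => i ids.
  by rewrite inE (allP hs i ids) (allP al i ids).
(* [sigma] normalises the parabolic subgroup of [J], so a conjugate of [z] under that subgroup keeps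
   the shape [w' sigma]. *)
have rep u z' : inWJ J u -> fmul u z' = fmul z u ->
    exists w', inWJ J w' /\ z' = fmul w' (sigma ^+ 1).
  move=> iu; rewrite /fmul ez /fmul expr1 => e.
  have uu : u \in unitmx by have [p []] := inWJ_raut HD iu.
  have us : sigma \in unitmx by case: rsig.
  exists (invmx sigma *m u *m sigma *m w *m invmx u); split.
    apply: inWJ_mul; last exact: inWJ_inv.
    apply: inWJ_mul => //; case: iu => s [hs ->]; rewrite (conj_word _ rsig).
    exists (map ps s); split=> //; rewrite all_map; apply/allP => i /(allP hs) /=.
    by rewrite -[ps](expg1 ps) pow_J.
  by rewrite !mulmxA mulmxV // mul1mx -(mulmxA u) -e mulmxK.
split.
- move=> [_ we] i nui.
  case: (excluded_middle_informative (forall u : 'rV[R]_n, u *m toR R z = u -> pairR u (rt i) = 0)) => [h|]; first by left.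
  move=> no; right.
  have [v [vz vi]] : exists v : 'rV[R]_n, v *m toR R z = v /\ pairR v (rt i) <> 0.
    apply: NNPP => h; apply: no => u uz; apply: NNPP => h2; apply: h; by exists u.
  (* Conjugating by [u] replaces the fixed vector [v] by a [J]-dominant one; [nu] is unaffected,
     since [u] fixes it. *)
  have [u [iu du]] := dom_ex HD v J_sub.
  have [q rq] := inWJ_raut HD iu; have uu : u \in unitmx by case: rq.
  pose z' := invmx u *m z *m u.
  have iu' := inWJ_inv HD iu.
  have ez' : fmul (invmx u) z' = fmul z (invmx u) by rewrite /fmul /z' mulmxK.
  have [wa wb] := we z' (ex_intro _ _ (conj iu' ez')).
  have [w' [iw' rz']] := rep _ _ iu' ez'.
  set v' := v *m toR R u in du.
  have vz' : v' *m toR R z' = v'.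
    by rewrite /v' /z' !toRM !mulmxA -(mulmxA v) -toRM mulmxV // toR1 mulmx1 vz.
  pose i' := q i.
  have vi' : pairR v' (rt i') <> 0 by rewrite /v' /i' (raut_pairR _ _ rq).
  have nui' : pairR nu (rt i') = 0 by rewrite -(nu_WJ iu) /i' (raut_pairR _ _ rq).
  pose G j := gsupp D J sigma z' j.
  (* For any factorisation of [z'], the power of [sigma] keeps [v'] dominant and the Weyl part
     brings it back to [v']. By [dom_uniq] the letters of the Weyl part are orthogonal to [v'], and
     the power of [sigma] fixes [v']. *)
  have Gv j : G j -> pairR v' (rt j) = 0.
    move=> [w2 [m2 [iw2 e2 [e [k [[s [rs ks]] hk]]]]]].
    have rd := raut_pow m2 rsig.
    have dd : domJ D J (v' *m toR R (sigma ^+ m2)).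
      move=> l lJ; rewrite -[l](permKV (ps ^+ m2)%g) (raut_pairR _ _ rd); apply: du.
      by rewrite -(pow_J m2) permKV.
    have e3 : v' *m toR R (sigma ^+ m2) *m toR R w2 = v'.
      by rewrite -mulmxA -toRM -[_ *m w2]/(fmul w2 _) -e2.
    have [|al e4] := dom_uniq HD J_sub rs dd; first by rewrite e3.
    have e5 : v' *m toR R (sigma ^+ m2) = v' by rewrite -e4 e3.
    have z0 : pairR v' (rt k) = 0 by rewrite -e5; apply/eqP; exact: (allP al).
    have -> : j = (ps ^+ m2 ^+ e)%g k by apply: (cr_inj HD); rewrite -hk cr_pow.
    have e6 : v' *m toR R ((sigma ^+ m2) ^+ e) = v'.
      elim: (e) => [|f IH]; first by rewrite expr0 toR1 mulmx1.
      by rewrite exprSr toRM mulmxA IH e5.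
    by rewrite -e6 pairR_pow.
  (* The support and its complement in [J] are orthogonal, so a root of [J] is carried by one of the
     two; this propagates along [root_ind]. *)
  pose P k := (forall j, j \in Sm -> j \notin J -> simple_coef k j = 0) /\
     ((forall j, j \in J -> G j -> simple_coef k j = 0) \/ (forall j, j \in J -> ~ G j -> simple_coef k j = 0)).
  have nadj k l : k \in J -> l \in J -> G k -> ~ G l -> ipair (cr k) (rt l) = 0 /\ ipair (cr l) (rt k) = 0.
    move=> kJ lJ Gk nGl.
    have kl : k != l by apply/eqP => e; apply: nGl; rewrite -e.
    have z1 : ipair (cr k) (rt l) = 0.
      apply/eqP/negPn/negP => nz; apply: nGl; exact: (wa k l).
    split=> //; have := pair_sym HD l k; rewrite z1 mul0r => /esym/eqP.
    by rewrite mulf_eq0 (gt_eqF (bi_cr_gt0 HD _)) orbF => /eqP.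
  have Proot k : posroot D k -> (forall j, j \in Sm -> j \notin J -> simple_coef k j = 0) -> P k.
    move: k; refine (@root_ind _ _ _ HD J P J_sub _ _) => [j jJ|k i0 kJ [h0 h1]].
      have jS := subsetP J_sub j jJ; split=> [l lS lJ|].
        by rewrite (simple_coef_simple HD) //; case: eqP lJ => // <-; rewrite jJ.
      case: (excluded_middle_informative (G j)) => Gj; [right|left] => l lJ Gl.
        by rewrite (simple_coef_simple HD) ?(subsetP J_sub l) //; case: eqP => // e; case: Gl; rewrite -e.
      by rewrite (simple_coef_simple HD) ?(subsetP J_sub l) //; case: eqP => // e; case: Gj; rewrite e.
    have kS := subsetP J_sub k kJ.
    have pk : ipair (cr k) (rt i0) = \sum_(l in Sm) simple_coef i0 l * ipair (cr k) (rt l).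
      by rewrite {1}(zcE HD i0) ipair_sumr; apply: eq_bigr => l _; rewrite ipairZr.
    have zk l : l \in Sm -> simple_coef (srp k i0) l = simple_coef i0 l - ipair (cr k) (rt i0) * (l == k)%:Z.
      by move=> lS; rewrite (simple_coef_srp HD).
    split=> [l lS lJ|].
      rewrite zk // h0 // (_ : l == k = false) ?mulr0 //.
      by apply: contraNF lJ => /eqP ->.
    case: h1 => h1; [left|right] => l lJ Gl; rewrite zk ?(subsetP J_sub l) // h1 // sub0r.
      case: eqP => [e|]; last by rewrite mulr0.
      rewrite pk big1 ?mul0r ?oppr0 // => b bS.
      case: (boolP (b \in J)) => bJ; last by rewrite h0 // mul0r.
      case: (excluded_middle_informative (G b)) => Gb; first by rewrite h1 // mul0r.
      by rewrite -e; have [-> _] := nadj l b lJ bJ Gl Gb; rewrite mulr0.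
    case: eqP => [e|]; last by rewrite mulr0.
    rewrite pk big1 ?mul0r ?oppr0 // => b bS.
    case: (boolP (b \in J)) => bJ; last by rewrite h0 // mul0r.
    case: (excluded_middle_informative (G b)) => Gb; last by rewrite h1 // mul0r.
    by rewrite -e; have [_ ->] := nadj b l bJ lJ Gb Gl; rewrite mulr0.
  have suppJ k : pairR nu (rt k) = 0 -> posroot D k -> forall j, j \in Sm -> j \notin J -> simple_coef k j = 0.
    move=> nuk /(posrootP HD) pk j jS jJ.
    have nuj : 0 < pairR nu (rt j).
      rewrite lt_neqAle nu_dom // andbT eq_sym; move: jJ; rewrite inE jS /=; exact.
    move: nuk; rewrite (pairR_simple_coef HD) => /psumr_eq0P h.
    have : (simple_coef k j)%:~R * pairR nu (rt j) = 0.
      by apply: h => // l lS; rewrite mulr_ge0 ?ler0z ?pk // nu_dom.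
    by move/eqP; rewrite mulf_eq0 intr_eq0 (gt_eqF nuj) orbF => /eqP.
  have Pi' : P i'.
    case: (pos_dec HD i') => pi'; first exact: Proot pi' (suppJ _ nui' pi').
    have nuo : pairR nu (rt (ropp i')) = 0 by rewrite pairR_opp nui' oppr0.
    have [h0 h1] := Proot _ pi' (suppJ _ nuo pi').
    have zo l : l \in Sm -> simple_coef (ropp i') l = 0 -> simple_coef i' l = 0.
      by move=> lS; rewrite (simple_coef_opp HD) // => /eqP; rewrite oppr_eq0 => /eqP.
    split=> [l lS lJ|]; first by apply: zo => //; exact: h0.
    by case: h1 => h1; [left|right] => l lJ Gl; apply: zo; rewrite ?(subsetP J_sub l) //; exact: h1.
  have {Pi'} [h0 h1] := Pi'.
  have hG : forall j, j \in J -> G j -> simple_coef i' j = 0.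
    case: h1 => // h1; case: vi'; rewrite (pairR_simple_coef HD); apply: big1 => l lS.
    case: (boolP (l \in J)) => lJ; last by rewrite h0 // mul0r.
    case: (excluded_middle_informative (G l)) => Gl; first by rewrite Gv // mulr0.
    by rewrite h1 // mul0r.
  have [s rs] := reduced_ex iw'; have [hs ws _] := rs.
  have rz : raut (ps * word_perm HD s)%g z'.
    by rewrite rz' ws expr1; apply: raut_mul => //; exact: raut_word.
  have fixj j : j \in J -> ~ G j -> (ps * word_perm HD s)%g j = j.
    move=> jJ nG; have jS := subsetP J_sub j jJ.
    have := wb j jJ nG; rewrite /fmul -(raut_conj_sref _ rz).
    have uz' : z' \in unitmx by case: rz.
    move/(can_inj (mulKmx uz')) => /esym/sref_eq[] //; rewrite permM => e; exfalso.
    (* To exclude that [j] is sent to its opposite: the word of [w'] does not contain [j], so it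
       preserves the coefficient at [j], and the simple root [ps j] has no negative coefficient. *)
    have js : j \notin s.
      apply/negP => js; apply: nG; exists w', 1%N; split=> //.
      by exists 0%N, j; split; [exists s|rewrite expr0 mulmx1].
    have zz k : k \in Sm -> simple_coef (word_perm HD s k) j = simple_coef k j.
      move=> kS; elim: (s) js hs => [|b t IH] /=; first by rewrite perm1.
      rewrite inE negb_or => /andP[jb jt] /andP[bJ ht].
      by rewrite permM (simple_coef_srp HD) ?(subsetP J_sub b) // (negPf jb) mulr0 subr0 IH.
    have := zz (ps j); rewrite ps_simple jS e (simple_coef_opp HD) // !(simple_coef_simple HD) ?ps_simple // eqxx.
    by move=> /(_ isT); case: eqP.
  have fin (x : 'rV[R]_n) : pairR (x *m toR R z') (rt i') = pairR x (rt i').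
    rewrite !(pairR_simple_coef HD _ i'); apply: eq_bigr => l lS.
    case: (boolP (l \in J)) => lJ; last by rewrite h0 // !mul0r.
    case: (excluded_middle_informative (G l)) => Gl; first by rewrite hG // !mul0r.
    by congr (_ * _); rewrite -{1}(fixj l lJ Gl) (raut_pairR _ _ rz).
  move=> x; have e : x *m toR R z *m toR R u = x *m toR R u *m toR R z'.
    by rewrite /z' !toRM !mulmxA -(mulmxA x (toR R u)) -toRM mulmxV // toR1 mulmx1.
  by rewrite -(raut_pairR _ _ rq) e fin (raut_pairR _ _ rq).
- move=> c; split.
    by exists w, 1%N; rewrite expr1.
  move=> z' [u [iu eu]].
  have cz' : root_dichotomy nu z'.
    have [q rq] := inWJ_raut HD iu.
    by apply: (root_dichotomy_conj rq eu); rewrite nu_WJ.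
  split.
    move=> i j [w2 [m2 [iw2 e2 k2]]] jJ aij; apply: NNPP => nG.
    have nk : ~ ksupp w2 m2 j by move=> k3; apply: nG; exists w2, m2.
    by have [_ /(_ i k2)] := outside_support iw2 e2 cz' jJ nk.
  move=> j jJ nG; have [w' [iw' e']] := rep _ _ iu eu.
  have nk : ~ ksupp w' 1 j by move=> k3; apply: nG; exists w', 1%N.
  by have [] := outside_support iw' e' cz' jJ nk.
Qed.

End WeaklyElliptic.

(** * Arrangements of linear forms *)
Section Forms.
Variables (F : realFieldType) (n : nat) (I : finType) (phi : I -> 'cV[F]_n).

Definition eval_form i (x : 'rV[F]_n) : F := (x *m phi i) 0 0.

Lemma evD i x y : eval_form i (x + y) = eval_form i x + eval_form i y.
Proof. by rewrite /eval_form mulmxDl mxE. Qed.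
Lemma evZ i c x : eval_form i (c *: x) = c * eval_form i x.
Proof. by rewrite /eval_form -scalemxAl mxE. Qed.
Lemma evN i x : eval_form i (- x) = - eval_form i x.
Proof. by rewrite /eval_form mulNmx mxE. Qed.
Lemma evB i x y : eval_form i (x - y) = eval_form i x - eval_form i y.
Proof. by rewrite evD evN. Qed.
Lemma ev0 i : eval_form i 0 = 0.
Proof. by rewrite /eval_form mul0mx mxE. Qed.
Definition evE := (evD, evZ, evN, ev0).

(** A step along [w] too short to change the sign of any form nonzero at [v]. Forms vanishing at [v]
    add 0 to the sum because division by 0 gives 0. [nudge] thus realises the product of faces:
    signs of [v], with ties broken by [w]. *)
Definition nstep v w : F := (1 + \sum_i `|eval_form i w| / `|eval_form i v|)^-1.
Definition nudge v w := v + nstep v w *: w.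

Lemma nstep_gt0 v w : 0 < nstep v w.
Proof.
rewrite invr_gt0 ltr_pwDl ?ltr01 // sumr_ge0 // => i _.
by rewrite divr_ge0.
Qed.

Lemma sgr_small (a b e : F) : 0 < e -> e * `|b| < `|a| -> Num.sg (a + e * b) = Num.sg a.
Proof.
move=> e0 h.
have h2 : `|e * b| < `|a| by rewrite normrM (gtr0_norm e0).
have [a0|a0|a0] := ltrgtP a 0.
- rewrite [in RHS]ltr0_sg //; apply: ltr0_sg.
  move: h2; rewrite (ltr0_norm a0) ltr_norml; lra.
- rewrite [in RHS]gtr0_sg //; apply: gtr0_sg.
  move: h2; rewrite (gtr0_norm a0) ltr_norml; lra.
- by move: h2; rewrite a0 normr0 normr_lt0.
Qed.

Lemma sg_small v w e i : 0 < e -> e <= nstep v w ->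
  Num.sg (eval_form i (v + e *: w)) =
  if eval_form i v == 0 then Num.sg (eval_form i w) else Num.sg (eval_form i v).
Proof.
move=> e0 he; rewrite !evE; case: eqP => [->|/eqP nz].
  by rewrite add0r sgrM gtr0_sg // mul1r.
apply: sgr_small => //.
have nv : 0 < `|eval_form i v| by rewrite normr_gt0.
apply: (@le_lt_trans _ _ (nstep v w * `|eval_form i w| )).
  by rewrite ler_wpM2r.
rewrite /nstep mulrC ltr_pdivrMr; last first.
  by rewrite -invr_gt0; exact: nstep_gt0.
rewrite (bigD1 i) //= mulrDr mulr1 mulrDr mulrCA divff ?gt_eqF // mulr1.
have : 0 <= \sum_(j | j != i) `|eval_form j w| / `|eval_form j v|.
  by rewrite sumr_ge0 // => j _; rewrite divr_ge0.
nra.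
Qed.

Lemma sg_nudge v w i :
  Num.sg (eval_form i (nudge v w)) =
  if eval_form i v == 0 then Num.sg (eval_form i w) else Num.sg (eval_form i v).
Proof. by apply: sg_small => //; exact: nstep_gt0. Qed.

Lemma nudge_eq0 v w i : (eval_form i (nudge v w) == 0) = (eval_form i v == 0) && (eval_form i w == 0).
Proof.
rewrite -sgr_eq0 sg_nudge; by case: ifP => h; rewrite sgr_eq0 ?h.
Qed.

(** A subspace is not a finite union of proper hyperplane sections: nudging towards a vector on
    which one more form is nonzero keeps the earlier forms nonzero. *)
Lemma avoid (U : 'rV[F]_n -> Prop) (A : {set I}) :
  U 0 -> (forall x y c, U x -> U y -> U (x + c *: y)) ->
  (forall i, i \in A -> exists2 x, U x & eval_form i x != 0) ->
  exists2 x, U x & forall i, i \in A -> eval_form i x != 0.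
Proof.
move=> U0 UD; have [k] := ubnP #|A|; elim: k A => // k IH A; rewrite ltnS => hk h.
case: (set_0Vmem A) => [->|[j jA]]; first by exists 0 => // i; rewrite inE.
have [|i /setD1P[_ iA]|x Ux hx] := IH (A :\ j); [by rewrite (cardsD1 j) jA in hk| exact: h|].
have [w Uw jw] := h j jA.
exists (nudge x w); first exact: UD.
move=> i iA; rewrite nudge_eq0 negb_and.
have [->|ij] := eqVneq i j; first by rewrite jw orbT.
by rewrite hx // !inE ij.
Qed.

End Forms.

(** * Compactness of slices of the unit sphere *)

Lemma continuous_bigsum (F : realType) N (T : Type) (r : seq T) (P : pred T)
    (g : T -> 'rV[F]_N -> F) :
  (forall t, continuous (g t)) -> continuous (fun y => \sum_(t <- r | P t) g t y).
Proof.
move=> gc; elim: r => [|t r IH].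
  have -> : (fun y => \sum_(t <- [::] | P t) g t y) = fun=> 0.
    by apply/funext => y; rewrite big_nil.
  by move=> y; apply: cst_continuous.
have -> : (fun y => \sum_(t <- t :: r | P t) g t y) =
    fun y => (if P t then g t y else 0) + \sum_(t <- r | P t) g t y.
  by apply/funext => y; rewrite big_cons; case: ifP => // _; rewrite add0r.
move=> y; apply: continuousD; last exact: IH.
by case: (P t); [exact: gc|exact: cst_continuous].
Qed.

Lemma closed_zero (F : realType) N (g : 'rV[F]_N -> F) (c : F) :
  continuous g -> topology_structure.closed [set y | g y = c]%classic.
Proof. by move=> /continuous_closedP h; apply: (h [set x | x = c]%classic); exact: closed_eq. Qed.

Lemma closed_nonneg (F : realType) N (g : 'rV[F]_N -> F) :
  continuous g -> topology_structure.closed [set y | 0 <= g y]%classic.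
Proof. by move=> /continuous_closedP h; apply: (h [set x | 0 <= x]%classic); exact: closed_ge. Qed.

Lemma closed_all (F : realType) N (J : Type) (P : J -> 'rV[F]_N -> Prop) :
  (forall j, topology_structure.closed [set y | P j y]%classic) -> topology_structure.closed [set y | forall j, P j y]%classic.
Proof.
move=> h.
have -> : [set y | forall j, P j y]%classic = (\bigcap_(j in [set: J]) [set y | P j y])%classic.
  by apply/seteqP; split=> y /= Py; [move=> j _; exact: Py|move=> j; exact: Py].
by apply: closed_bigI => j _; exact: h.
Qed.

(** [C] cuts out a linear subspace and [c] a closed cone of sign conditions; with the unit sphere
    they give a closed subset of the cube of side 2, hence a compact set. *)
Lemma sphere_max (F : realType) N (g : 'rV[F]_N -> F) (C : 'M[F]_N) (c : 'I_N -> F)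
   (K := fun y : 'rV[F]_N => [/\ y *m C = 0, forall j, 0 <= y 0 j * c j
           & \sum_j y 0 j ^+ 2 = 1]) :
  continuous g -> (exists y, K y) ->
  exists2 y, K y & forall y', K y' -> g y' <= g y.
Proof.
move=> gc [y0 Ky0].
have cc j : continuous (fun y : 'rV[F]_N => y 0 j) by exact: coord_continuous.
have clK : topology_structure.closed [set y | K y]%classic.
  have -> : [set y | K y]%classic = ([set y | forall j, (y *m C) 0 j = 0] `&`
      ([set y : 'rV[F]_N | forall j, 0 <= y 0 j * c j] `&` [set y : 'rV[F]_N | \sum_j y 0 j ^+ 2 = 1%R]))%classic.
    apply/seteqP; split=> y /=.
      by case=> e h s; split=> // j; rewrite e mxE.
    by case=> e [h s]; split=> //; apply/rowP => j; rewrite e mxE.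
  apply: closedI; [|apply: closedI].
  - apply: closed_all => j; apply: closed_zero.
    have -> : (fun y : 'rV[F]_N => (y *m C) 0 j) = fun y => \sum_k y 0 k * C k j.
      by apply/funext => y; rewrite mxE.
    apply: continuous_bigsum => k y; apply: continuousM; [exact: cc|exact: cst_continuous].
  - apply: closed_all => j; apply: closed_nonneg => y.
    by apply: continuousM; [exact: cc|exact: cst_continuous].
  - apply: closed_zero; apply: continuous_bigsum => k y.
    by under eq_fun do rewrite expr2; apply: continuousM; exact: cc.
have cpK : compact [set y | K y]%classic.
  have box := @rV_compact F N (fun=> `[(-1 : F), (1 : F)]%classic)
    (fun=> @segment_compact _ _ _).
  apply: (subclosed_compact clK box) => y [_ _ s] i /=.
  have : y 0 i ^+ 2 <= 1.
    by rewrite -s (bigD1 i) //= lerDl sumr_ge0 // => j _; exact: sqr_ge0.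
  by rewrite in_itv /= expr2 => ?; apply/andP; split; nra.
have [||c0 + h] := @EVT_max_rV F N g [set y | K y]%classic _ cpK.
- by exists y0.
- by apply: continuous_subspaceT.
move=> /set_mem Kc; exists c0 => // y' Ky'; apply: h; exact: mem_set.
Qed.

(** * Minimal chambers of an elliptic linear map *)
Section Elliptic.
Variables (F : realType) (n : nat) (I : finType) (phi : I -> 'cV[F]_n).
Local Notation ev := (eval_form phi).
Local Notation nudge := (nudge phi).

Variables (z zi : 'M[F]_n) (pi : {perm I}).
Implicit Types (A : {set I}) (x y v w p q : 'rV[F]_n).

Definition sg i x : F := Num.sg (ev i x).

Lemma sgE i x : Num.sg (ev i x) = sg i x. Proof. by []. Qed.

Definition gen A x := forall i, i \in A -> ev i x != 0.
Definition sepn A x y := (\sum_(i in A) (sg i x != sg i y))%N.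
Definition btw A x y w := forall i, i \in A -> sg i x != sg i y -> sg i y = sg i w.
Definition Min A x := gen A x /\
  forall y, gen A y -> (sepn A x (x *m z) <= sepn A y (y *m z))%N.
(** More than adjacency: [y] may be any minimal chamber on a shortest gallery from [x] towards its
    image or its preimage. *)
Definition step A x y :=
  [/\ Min A x, Min A y & btw A x y (x *m z) \/ btw A x y (x *m zi)].
Definition conn A := clos_refl_sym_trans _ (step A).
(* [v] lies in the closure of the chamber of [x] *)
Definition cl A v x := forall i, i \in A -> ev i v != 0 -> sg i v = sg i x.
Definition stable A := forall i, (pi i \in A) = (i \in A).

Lemma sg_nudgeE v w i : sg i (nudge v w) = if ev i v == 0 then sg i w else sg i v.
Proof. exact: sg_nudge. Qed.

Lemma gen_nudge A v w : gen A w -> gen A (nudge v w).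
Proof. by move=> h i iA; rewrite nudge_eq0 negb_and h ?orbT. Qed.

Lemma perm_stable (s : {perm I}) A :
  (forall i, i \in A -> s i \in A) -> forall i, (s i \in A) = (i \in A).
Proof.
move=> h i; apply/idP/idP; last exact: h.
have sub : [set s j | j in A] \subset A by apply/subsetP => _ /imsetP[j jA ->]; exact: h.
have /eqP e : [set s j | j in A] == A.
  by rewrite eqEcard sub card_imset ?leqnn //; exact: perm_inj.
by rewrite -{1}e mem_imset //; exact: perm_inj.
Qed.

Lemma stable_sub A : (forall i, i \in A -> pi i \in A) -> stable A.
Proof. exact: perm_stable. Qed.

Lemma stable_subV A : (forall i, i \in A -> (pi^-1)%g i \in A) -> stable A.
Proof. by move=> /perm_stable h i; rewrite -[in RHS](permK pi i) h. Qed.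

Lemma sepnC A x y : sepn A x y = sepn A y x.
Proof. by apply: eq_bigr => i _; rewrite eq_sym. Qed.

Lemma sepn_btw A x y w : btw A x y w -> (sepn A x y + sepn A y w = sepn A x w)%N.
Proof.
move=> h; rewrite -big_split; apply: eq_bigr => i iA /=.
have := h i iA; case: (eqVneq (sg i x) (sg i y)) => [->|ne] e; first by [].
by rewrite -(e isT) eqxx (negPf ne).
Qed.

Lemma sepn_tri A x y w : (sepn A x w <= sepn A x y + sepn A y w)%N.
Proof.
rewrite -big_split; apply: leq_sum => i _ /=.
by case: (eqVneq (sg i x) (sg i y)) => [->|_] //; case: eqP.
Qed.

Hypothesis zK : z *m zi = 1%:M.
Hypothesis ziK : zi *m z = 1%:M.
Hypothesis phi_pi : forall i, z *m phi (pi i) = phi i.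

Lemma ev_z i x : ev (pi i) (x *m z) = ev i x.
Proof. by rewrite /ev -mulmxA phi_pi. Qed.
Lemma ev_zi i x : ev i (x *m zi) = ev (pi i) x.
Proof. by rewrite -ev_z -mulmxA ziK mulmx1. Qed.
Lemma ev_zV i x : ev i (x *m z) = ev (pi^-1 i)%g x.
Proof. by rewrite -[i in LHS](permKV pi) ev_z. Qed.

Lemma sg_z i x : sg (pi i) (x *m z) = sg i x. Proof. by rewrite /sg ev_z. Qed.
Lemma sg_zi i x : sg i (x *m zi) = sg (pi i) x. Proof. by rewrite /sg ev_zi. Qed.
Lemma sg_zV i x : sg i (x *m z) = sg (pi^-1 i)%g x. Proof. by rewrite /sg ev_zV. Qed.

Lemma reindex_pi (T : Type) (idx : T) (op : Monoid.com_law idx) A (G : I -> T) :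
  stable A -> \big[op/idx]_(i in A) G i = \big[op/idx]_(i in A) G (pi i).
Proof.
by move=> st; rewrite (reindex_inj (@perm_inj _ pi)); apply: eq_bigl => i; rewrite st.
Qed.

Lemma stableV A : stable A -> forall i, ((pi^-1)%g i \in A) = (i \in A).
Proof. by move=> st i; rewrite -[in RHS](permKV pi i) st. Qed.

Lemma sepn_z A x y : stable A -> sepn A (x *m z) (y *m z) = sepn A x y.
Proof.
by move=> st; rewrite /sepn reindex_pi //; apply: eq_bigr => i _; rewrite !sg_z.
Qed.
Lemma sepn_zi A x y : stable A -> sepn A (x *m zi) (y *m zi) = sepn A x y.
Proof. by move=> st; rewrite -sepn_z // -!mulmxA ziK !mulmx1. Qed.

(** If [y] lies between [x] and [x z], going from [y] to [x z] and on to [y z] costs what going from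
    [x] through [y] to [x z] costs, since [z] preserves distances. *)
Lemma pursuit_le A x y : stable A ->
  btw A x y (x *m z) \/ btw A x y (x *m zi) ->
  (sepn A y (y *m z) <= sepn A x (x *m z))%N.
Proof.
move=> st [] /sepn_btw e.
  apply: (leq_trans (sepn_tri _ _ (x *m z) _)).
  by rewrite sepn_z // addnC e.
have flip u : sepn A u (u *m z) = sepn A u (u *m zi).
  by rewrite -sepn_zi // -mulmxA zK mulmx1 sepnC.
rewrite !flip; apply: (leq_trans (sepn_tri _ _ (x *m zi) _)).
by rewrite sepn_zi // addnC e.
Qed.

Lemma step_btw A x y : stable A -> Min A x -> gen A y ->
  btw A x y (x *m z) \/ btw A x y (x *m zi) -> step A x y.
Proof.
move=> st Mx gy b; split=> //; split=> // u gu.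
by apply: leq_trans (Mx.2 u gu); exact: pursuit_le.
Qed.

Lemma connE A x y : conn A x y -> Min A x -> Min A y.
Proof.
move=> c; suff: Min A x <-> Min A y by case.
by elim: c => [? ? []|?|? ? _ [] |? ? ? _ [h1 h2] _ [h3 h4]] //; split; auto.
Qed.

(** Twice the midpoint of [x] and its image; chambers are cones, so the factor does not change the
    chamber. *)
Definition T x := x + x *m z.
Definition nrm A x : F := \sum_(i in A) ev i x ^+ 2.
Definition dot A x y : F := \sum_(i in A) ev i x * ev i y.

Lemma nrm_ge0 A x : 0 <= nrm A x.
Proof. by apply: sumr_ge0 => i _; exact: sqr_ge0. Qed.
Lemma nrmE A x : nrm A x = dot A x x.
Proof. by apply: eq_bigr => i _; rewrite expr2. Qed.
Lemma dotC A x y : dot A x y = dot A y x.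
Proof. by apply: eq_bigr => i _; rewrite mulrC. Qed.
Lemma dotD A x y w : dot A x (y + w) = dot A x y + dot A x w.
Proof. by rewrite -big_split; apply: eq_bigr => i _; rewrite evD mulrDr. Qed.
Lemma dotZ A x c y : dot A x (c *: y) = c * dot A x y.
Proof. by rewrite mulr_sumr; apply: eq_bigr => i _; rewrite evZ mulrCA. Qed.
Lemma dotDl A x y w : dot A (y + w) x = dot A y x + dot A w x.
Proof. by rewrite dotC dotD !(dotC A x). Qed.
Lemma dotZl A x c y : dot A (c *: y) x = c * dot A y x.
Proof. by rewrite dotC dotZ dotC. Qed.
Lemma nrm_eq0 A x : nrm A x = 0 -> forall i, i \in A -> ev i x = 0.
Proof.
move=> h i iA; have /psumr_eq0P/(_ h)/(_ i iA)/eqP : forall i, i \in A -> 0 <= ev i x ^+ 2.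
  by move=> j _; exact: sqr_ge0.
by rewrite sqrf_eq0 => /eqP.
Qed.
Lemma nrm_gt0 A x i : i \in A -> ev i x != 0 -> 0 < nrm A x.
Proof.
move=> iA nz; rewrite lt_neqAle nrm_ge0 andbT eq_sym.
by apply: contraNneq nz => /nrm_eq0 ->.
Qed.
Lemma dot_z A x y : stable A -> dot A (x *m z) (y *m z) = dot A x y.
Proof. by move=> st; rewrite /dot reindex_pi //; apply: eq_bigr => i _; rewrite !ev_z. Qed.
Lemma dot_zzi A x y : stable A -> dot A (x *m z) y = dot A x (y *m zi).
Proof. by move=> st; rewrite -(dot_z x) // -mulmxA ziK mulmx1. Qed.
Lemma nrm_z A x : stable A -> nrm A (x *m z) = nrm A x.
Proof. by move=> st; rewrite !nrmE dot_z. Qed.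

Lemma TD x y : T (x + y) = T x + T y.
Proof. by rewrite /T mulmxDl addrACA. Qed.
Lemma TZ c x : T (c *: x) = c *: T x.
Proof. by rewrite /T -scalemxAl scalerDr. Qed.
Lemma iterTD k x y : iter k T (x + y) = iter k T x + iter k T y.
Proof. by elim: k => //= k ->; rewrite TD. Qed.
Lemma iterTZ k c x : iter k T (c *: x) = c *: iter k T x.
Proof. by elim: k => //= k ->; rewrite TZ. Qed.

Lemma dot_T A x y : stable A -> dot A (T x) (T y) = dot A x (y *m zi + y *m z + 2 *: y).
Proof.
move=> st; rewrite /T dotDl !dotD dot_z // dot_zzi // dotZ; ring.
Qed.

(** With [u = T^* T x] one has [|u| = |T T x|] and [<x, u> = |T x|^2], so expanding
    [|u - q x|^2 >= 0] shows that the growth ratio of the iterates of [T] never decreases. *)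
Lemma nrm_step A x (q : F) : stable A -> 0 <= q -> q * nrm A x <= nrm A (T x) ->
  q * nrm A (T x) <= nrm A (T (T x)).
Proof.
move=> st q0 e.
pose u := T x + T x *m zi.
have uE : nrm A u = nrm A (T (T x)).
  rewrite -(nrm_z u) //; congr nrm.
  by rewrite /u mulmxDl -(mulmxA (T x) zi z) ziK mulmx1 addrC.
have ud : dot A x u = nrm A (T x).
  by rewrite /u dotD -dot_zzi // -dotDl nrmE.
clearbody u; have := nrm_ge0 A (u - q *: x).
rewrite -scaleNr nrmE dotDl !dotD !dotZ !dotZl (dotC A u x) ud -!nrmE uE.
nra.
Qed.

(** Bernoulli's inequality for [q / r] and the archimedean property. *)
Lemma geometric_unbounded (q r c C : F) : 0 <= r -> r < q -> 0 < c ->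
  ~ forall k : nat, c * q ^+ k <= C * r ^+ k.
Proof.
move=> r0 rq c0 h.
have [r_eq0|rn0] := eqVneq r 0.
  by have := h 1; rewrite r_eq0 !expr1 mulr0 leNgt mulr_gt0 // -r_eq0.
have {rn0}r0 : 0 < r by rewrite lt_neqAle eq_sym rn0.
pose e := q / r - 1.
have e0 : 0 < e by rewrite subr_gt0 ltr_pdivlMr // mul1r.
have bern k : 1 + k%:R * e <= (q / r) ^+ k.
  elim: k => [|k IH]; first by rewrite mul0r addr0 expr0.
  rewrite exprS -natr1.
  have -> : q / r = 1 + e by rewrite /e addrC subrK.
  move: IH; have -> : q / r = 1 + e by rewrite /e addrC subrK.
  have : 0 <= k%:R :> F by exact: ler0n.
  nra.
have hk k : c * (1 + k%:R * e) <= C.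
  apply: (@le_trans _ _ (c * (q / r) ^+ k)); first by rewrite ler_pM2l.
  by rewrite expr_div_n mulrA ler_pdivrMr ?exprn_gt0.
pose k := Num.bound (`|C| / (c * e)).
have := hk k; have : `|C| / (c * e) < k%:R by apply: archi_boundP; rewrite divr_ge0 // mulr_ge0 // ltW.
rewrite ltr_pdivrMr ?mulr_gt0 //.
have := ler_norm C; nra.
Qed.

(** Since the growth ratio never decreases, a first ratio above [r] would force growth faster than
    any multiple of [r^k]. *)
Lemma growth A x (r C : F) : stable A -> 0 <= r ->
  (forall k, nrm A (iter k T x) <= C * r ^+ k) -> nrm A (T x) <= r * nrm A x.
Proof.
move=> st r0 hC; rewrite leNgt; apply/negP => lt.
have x0 : 0 < nrm A x.
  rewrite lt_neqAle nrm_ge0 andbT eq_sym; apply/negP => /eqP x0.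
  move: lt; rewrite x0 mulr0 /nrm big1 ?ltxx // => i iA.
  have h := nrm_eq0 x0; rewrite /T evD ev_zV !h ?stableV // addr0 expr2; ring.
set q := nrm A (T x) / nrm A x.
have rq : r < q by rewrite ltr_pdivlMr.
have q0 : 0 <= q by apply: ltW; exact: le_lt_trans rq.
have inc k : q * nrm A (iter k T x) <= nrm A (iter k.+1 T x).
  elim: k => [|k IH]; first by rewrite /q /= divfK // gt_eqF.
  exact: nrm_step.
have low k : nrm A x * q ^+ k <= nrm A (iter k T x).
  elim: k => [|k IH]; first by rewrite expr0 mulr1.
  by rewrite exprS mulrCA; apply: le_trans (inc k); rewrite ler_wpM2l.
by apply: (@geometric_unbounded q r _ C r0 rq x0) => k; exact: le_trans (low k) (hC k).
Qed.

(** The chamber around [v] that points towards [v z], with ties broken by [p]. A wall crossed from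
    [p] contains [v] but not [v z], and there [p z] has the sign of [v z], so the move goes towards
    [p z]. *)
Lemma pursuit_cl A v p : stable A -> Min A p -> cl A v p ->
  [/\ step A p (nudge v (nudge (v *m z) p)), cl A v (nudge v (nudge (v *m z) p))
   & cl A (nudge v (v *m z)) (nudge v (nudge (v *m z) p))].
Proof.
move=> st Mp cv; split.
- apply: step_btw => //; first by apply: gen_nudge; apply: gen_nudge; exact: Mp.1.
  left=> i iA; rewrite !sg_nudgeE; case: ifP => [v0|/negbT v0]; last by rewrite (cv i iA v0) eqxx.
  case: ifP => [_|/negbT vz0 _]; first by rewrite eqxx.
  rewrite !sg_zV; apply: cv; first by rewrite stableV.
  by rewrite -ev_zV.
- by move=> i iA v0; rewrite sg_nudgeE (negPf v0).
- move=> i iA; rewrite nudge_eq0 !sg_nudgeE; case: ifP => //= _ vz0.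
  by rewrite (negPf vz0).
Qed.

Definition conn_all A := forall p q, Min A p -> Min A q -> conn A p q.

(* For [v] with stable vanishing set [Av], chambers of [A] around [v] are chambers of [Av]. *)
Lemma star_sepn A Av v p : stable A -> stable Av ->
  (forall i, i \in Av = (i \in A) && (ev i v == 0)) -> cl A v p ->
  sepn A p (p *m z) = (sepn Av p (p *m z) + sepn (A :\: Av) v (v *m z))%N.
Proof.
move=> st stv AvE cv; rewrite /sepn (big_setID Av) /=.
have -> : A :&: Av = Av by apply/setP => i; rewrite inE AvE andbA andbb.
congr addn; apply: eq_bigr => i /setDP[iA iAv].
have nz : ev i v != 0 by move: iAv; rewrite AvE iA.
have nz' : ev (pi^-1 i)%g v != 0.
  by move: iAv; rewrite -(stableV stv) AvE stableV // iA.
by rewrite !sg_zV -!cv // stableV.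
Qed.

(** By [star_sepn] the displacement of a chamber around [v] exceeds its displacement in [Av] by a
    constant depending on [v] alone, so minimality can be tested in [Av]. Chambers of [Av] are
    refined to chambers of [A] by nudging towards [p]. *)
Lemma star_Min A Av v p : stable A -> stable Av ->
  (forall i, i \in Av = (i \in A) && (ev i v == 0)) -> cl A v p -> Min A p ->
  Min Av p /\ forall q, gen A q -> Min Av q -> Min A (nudge v q).
Proof.
move=> st stv AvE cv Mp.
have cn q : cl A v (nudge v q) by move=> i iA v0; rewrite sg_nudgeE (negPf v0).
have sub i : i \in Av -> i \in A by rewrite AvE => /andP[].
have sgn q i : i \in Av -> sg i (nudge v q) = sg i q.
  by rewrite AvE sg_nudgeE => /andP[_ ->].
have sn q : sepn Av (nudge v q) (nudge v q *m z) = sepn Av q (q *m z).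
  by apply: eq_bigr => i iAv; rewrite !sg_zV !sgn ?stableV.
have gp q : gen Av q -> exists2 q', gen A q' & forall i, i \in Av -> sg i q' = sg i q.
  move=> gq; exists (nudge q p); first by apply: gen_nudge; exact: Mp.1.
  by move=> i iAv; rewrite sg_nudgeE (negPf (gq i iAv)).
have MinAv : Min Av p.
  split=> [i /sub|q gq]; first exact: Mp.1.
  have [q' gq' e] := gp q gq.
  have := Mp.2 _ (gen_nudge v gq').
  rewrite !(star_sepn st stv AvE) // leq_add2r sn.
  by congr leq; apply: eq_bigr => i iAv; rewrite !sg_zV !e ?stableV.
split=> // q gq [_ mq]; split; first exact: gen_nudge.
move=> y gy; apply: leq_trans (Mp.2 y gy).
rewrite !(star_sepn st stv AvE) // leq_add2r sn; apply: mq.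
exact: MinAv.1.
Qed.

Lemma Min_sg A x y : stable A -> (forall i, i \in A -> sg i x = sg i y) -> Min A x -> Min A y.
Proof.
move=> st e [gx mx]; split=> [i iA|w gw].
  by rewrite -sgr_eq0 sgE -e // sgr_eq0 gx.
suff <- : sepn A x (x *m z) = sepn A y (y *m z) by exact: mx.
by apply: eq_bigr => i iA; rewrite !sg_zV !e ?stableV.
Qed.

Lemma conn_sg A x y : stable A -> (forall i, i \in A -> sg i x = sg i y) -> Min A x -> conn A x y.
Proof.
move=> st e Mx; apply: rst_step; split=> //; first exact: Min_sg Mx.
by left=> i iA; rewrite e // eqxx.
Qed.

(** Induction on the number of walls through [v]. If one of them misses [v z], pursuit moves both
    chambers next to a point on fewer walls. Otherwise the walls through [v] form a stable proper
    subset, whose connecting steps lift to [A]. *)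
Lemma star_conn A v p q : stable A ->
  (forall A', A' \proper A -> stable A' -> conn_all A') ->
  Min A p -> Min A q -> cl A v p -> cl A v q ->
  (exists2 i, i \in A & ev i v != 0) -> conn A p q.
Proof.
move=> st IHA; have [k] := ubnP #|[set i in A | ev i v == 0]|.
elim: k v p q => // k IH v p q; rewrite ltnS => hk Mp Mq cp cq [i0 i0A i0v].
case: (boolP [exists i in A, (ev i v == 0) && (ev i (v *m z) != 0)]).
  case/exists_inP => i iA /andP[v0 vz0].
  have [sp _ cp'] := pursuit_cl st Mp cp.
  have [sq _ cq'] := pursuit_cl st Mq cq.
  apply: rst_trans (rst_step _ _ _ _ sp) _.
  apply: rst_trans (rst_sym _ _ _ _ (rst_step _ _ _ _ sq)).
  apply: IH cp' cq' _; [|by case: sp|by case: sq|]; last first.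
    by exists i0; rewrite ?nudge_eq0 ?(negPf i0v).
  apply: leq_trans hk; apply: proper_card; apply/properP; split.
    by apply/subsetP => j; rewrite !inE nudge_eq0 => /and3P[-> ->].
  by exists i; rewrite !inE ?nudge_eq0 iA v0 // (negPf vz0).
move=> /exists_inPn h.
pose Av := [set i in A | ev i v == 0].
have AvE i : (i \in Av) = (i \in A) && (ev i v == 0) by rewrite inE.
have stv : stable Av.
  apply: stable_subV => i; rewrite !AvE stableV // => /andP[iA v0]; rewrite iA -ev_zV.
  by have := h i iA; rewrite v0 /= negbK.
have prop : Av \proper A.
  apply/properP; split; first by apply/subsetP => i; rewrite AvE => /andP[].
  by exists i0; rewrite // AvE (negPf i0v) andbF.
have [Mvp lift] := star_Min st stv AvE cp Mp.
have [Mvq _] := star_Min st stv AvE cq Mq.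
(* Signs of [x] on the walls through [v] and of [v] elsewhere; the inner nudge makes [x], generic
   only for [Av], generic for [A]. *)
pose L x := nudge v (nudge x p).
have sgL x i : Min Av x -> i \in Av -> sg i (L x) = sg i x.
  by move=> Mx iAv; rewrite !sg_nudgeE (negPf (Mx.1 i iAv)); move: iAv; rewrite AvE => /andP[_ ->].
have ML x : Min Av x -> Min A (L x).
  move=> Mx; apply: lift; first by apply: gen_nudge; exact: Mp.1.
  apply: Min_sg (Mx) => // i iAv.
  by rewrite sg_nudgeE (negPf (Mx.1 i iAv)).
have bL x y w w' : Min Av x -> Min Av y -> (forall i, i \in Av -> sg i w' = sg i w) ->
    btw Av x y w -> btw A (L x) (L y) w'.
  move=> Mx My e b i iA; case: (boolP (i \in Av)) => iAv.
    by rewrite !sgL // e //; exact: b.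
  by move: iAv; rewrite AvE iA /= !sg_nudgeE => /negPf ->; rewrite eqxx.
have cL x y : conn Av x y -> Min Av x -> Min Av y -> conn A (L x) (L y).
  (* The equivalence closure also relates points that are not minimal to themselves, hence the
     second alternative, which [connE] keeps consistent along chains. *)
  move=> c; suff : conn A (L x) (L y) \/ (~ Min Av x /\ ~ Min Av y) by tauto.
  elim: c => {x y} [x y [Mx My b]|x|x y c [? | ] |x y w c1 h1 c2 h2].
  - left; apply: rst_step; split; try exact: ML.
    case: b => b; [left|right]; apply: bL b => // i iAv.
      by rewrite !sg_zV sgL // stableV.
    by rewrite !sg_zi sgL // stv.
  - by left; exact: rst_refl.
  - by left; exact: rst_sym.
  - by tauto.
  - case: h1 => h1; case: h2 => h2; [left; exact: rst_trans h1 h2| | |tauto].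
      have Mx : ~ Min Av x by move=> Mx; apply: h2.1; exact: connE c1 Mx.
      by tauto.
    have Mw : ~ Min Av w by move=> Mw; apply: h1.2; apply: connE Mw; exact: rst_sym c2.
    by tauto.
have cc := cL _ _ (IHA _ prop stv p q Mvp Mvq) Mvp Mvq.
have same x : Min A x -> Min Av x -> cl A v x -> conn A x (L x).
  move=> Mx Mvx cx; apply: conn_sg => // i iA; case: (boolP (i \in Av)) => iAv; first by rewrite sgL.
  move: iAv; rewrite AvE iA /= => nz; rewrite sg_nudgeE (negPf nz); exact/esym/cx.
apply: rst_trans (same p Mp Mvp cp) _; apply: rst_trans cc _.
by apply: rst_sym; exact: same.
Qed.

Definition comp A p0 v := exists p, [/\ conn A p0 p, Min A p & cl A v p].

Lemma sgr_add (a b : F) : Num.sg (a + b) != Num.sg a -> a != 0 -> a + b != 0 ->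
  b != 0 /\ Num.sg (a + b) = Num.sg b.
Proof.
move=> h a0 ab0; split.
  by apply: contraNneq h => ->; rewrite addr0.
move: h; case: (sgrP a) a0 => //; case: (sgrP b); case: (sgrP (a + b)) ab0 => //; lra.
Qed.

(** Where the sign of [v + v z] differs from that of [v], it is the sign of [v z]; so the chamber
    obtained by turning [p] towards [T v] lies between [p] and [p z]. *)
Lemma comp_T A p0 v : stable A -> comp A p0 v -> comp A p0 (T v).
Proof.
move=> st [p [cp Mp cv]].
have sp : step A p (nudge (T v) p).
  apply: step_btw => //; first by apply: gen_nudge; exact: Mp.1.
  left=> i iA; rewrite sg_nudgeE; case: ifP => [_|/negbT]; first by rewrite eqxx.
  rewrite /sg /T evD => ab0 ne.
  have vz : ev i (v *m z) != 0 -> Num.sg (ev i (v *m z)) = Num.sg (ev i (p *m z)).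
    by rewrite !ev_zV => nz; apply: cv; rewrite ?stableV.
  have [a0|a0] := eqVneq (ev i v) 0.
    by move: ab0; rewrite a0 add0r => /vz.
  rewrite (_ : Num.sg (ev i p) = Num.sg (ev i v)) in ne; last by apply/esym; exact: cv.
  by rewrite eq_sym in ne; have [/vz <- ->] := sgr_add ne a0 ab0.
exists (nudge (T v) p); split; [|by case: sp|].
- by apply: rst_trans cp _; exact: rst_step.
- by move=> i iA nz; rewrite sg_nudgeE (negPf nz).
Qed.

Lemma comp_z A p0 v : stable A -> comp A p0 v -> comp A p0 (v *m z).
Proof.
move=> st [p [cp Mp cv]].
have sp : step A p (p *m z).
  apply: step_btw => //; last by left.
  by move=> i iA; rewrite ev_zV; apply: Mp.1; rewrite stableV.
exists (p *m z); split; [|by case: sp|].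
- by apply: rst_trans cp _; exact: rst_step.
- by move=> i iA; rewrite ev_zV !sg_zV; apply: cv; rewrite stableV.
Qed.

(** A point is replaced by its vector of values on [A], with zeros elsewhere: the seminorm becomes
    Euclidean, the closed chamber becomes a set of sign conditions, and compactness applies to the
    quotient [|T u|^2 / |u|^2]. *)
Lemma cone_max A p : stable A -> gen A p -> A != set0 ->
  exists v, [/\ cl A v p, 0 < nrm A v &
    forall u, cl A u p -> nrm A (T u) * nrm A v <= nrm A (T v) * nrm A u].
Proof.
move=> st gp /set0Pn[i0 i0A].
pose N := #|I|.
pose Phi : 'M[F]_(n, N) := \matrix_(k, j) (if enum_val j \in A then phi (enum_val j) k 0 else 0).
have PhiE x j : (x *m Phi) 0 j = if enum_val j \in A then ev (enum_val j) x else 0.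
  rewrite mxE; case: ifP => jA; last by apply: big1 => k _; rewrite mxE jA mulr0.
  by rewrite /ev /eval_form mxE; apply: eq_bigr => k _; rewrite mxE jA.
pose crd (y : 'rV[F]_N) i : F := y 0 (enum_rank i).
have crdE x i : i \in A -> crd (x *m Phi) i = ev i x.
  by move=> iA; rewrite /crd PhiE enum_rankK iA.
pose g (y : 'rV[F]_N) : F := \sum_(i in A) (crd y i + crd y (pi^-1 i)%g) * (crd y i + crd y (pi^-1 i)%g).
have gE x : g (x *m Phi) = nrm A (T x).
  by apply: eq_bigr => i iA; rewrite !crdE ?stableV // /T evD ev_zV expr2.
have nE x : \sum_j (x *m Phi) 0 j ^+ 2 = nrm A x.
  rewrite /nrm (reindex_onto enum_rank enum_val) => [|j _]; last exact: enum_valK.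
  rewrite big_mkcond [RHS]big_mkcond; apply: eq_bigr => i _.
  by rewrite PhiE enum_rankK eqxx; case: ifP => //; rewrite expr0n.
pose c (j : 'I_N) : F := sg (enum_val j) p.
have clc x : (forall j, 0 <= (x *m Phi) 0 j * c j) <-> cl A x p.
  split=> [h i iA nz|h j].
    have := h (enum_rank i); rewrite PhiE /c enum_rankK iA /sg.
    have := gp i iA; case: (sgrP (ev i p)) => // ? _; case: (sgrP (ev i x)) nz => //; lra.
  rewrite PhiE; case: ifP => jA; last by rewrite mul0r.
  have [->|nz] := eqVneq (ev (enum_val j) x) 0; first by rewrite mul0r.
  by rewrite /c -(h _ jA nz) /sg mulrC -normrEsg.
have gcont : continuous g.
  apply: continuous_bigsum => i y.
  have cc : {for y, continuous (fun y : 'rV[F]_N => crd y i + crd y (pi^-1 i)%g)}.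
    by apply: continuousD; exact: coord_continuous.
  exact: (continuousM cc cc).
have scal x : 0 < nrm A x -> exists2 t, 0 < t & nrm A (t *: x) = 1.
  move=> x0; exists (Num.sqrt (nrm A x))^-1; first by rewrite invr_gt0 sqrtr_gt0.
  rewrite nrmE dotZ dotZl -nrmE mulrA -expr2 exprVn sqr_sqrtr ?(ltW x0) //.
  by rewrite mulVf // gt_eqF.
have nZ t x : nrm A (t *: x) = t ^+ 2 * nrm A x by rewrite !nrmE dotZ dotZl mulrA expr2.
have clZ t x : 0 < t -> cl A x p -> cl A (t *: x) p.
  move=> t0 h i iA; rewrite /sg evZ mulf_eq0 gt_eqF //= => nz.
  by rewrite sgrM gtr0_sg // mul1r; exact: h.
have clpp : cl A p p by move=> i.
(* The value vectors form the row space of [Phi], which is the kernel of [cokermx Phi]. *)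
have [|y [yC ys yn] ymax] := @sphere_max F N g (cokermx Phi) c gcont.
  have [t t0 nt] := scal p (nrm_gt0 i0A (gp _ i0A)).
  exists (t *: p *m Phi); split; [by rewrite -mulmxA mulmx_coker mulmx0| |by rewrite nE].
  by apply/clc; exact: clZ.
have : (y <= Phi)%MS by rewrite submxE yC.
case/submxP => v yE; subst y.
have nv : nrm A v = 1 by rewrite -nE.
exists v; split; [exact/clc|by rewrite nv ltr01|move=> u cu].
rewrite nv mulr1.
have [u0|u0] := eqVneq (nrm A u) 0.
  rewrite u0 mulr0 /nrm big1 // => i iA.
  by have h := nrm_eq0 u0; rewrite /T evD ev_zV !h ?stableV // addr0 expr2 mulr0.
have {}u0 : 0 < nrm A u by rewrite lt_neqAle eq_sym u0 nrm_ge0.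
have [t t0 nt] := scal u u0.
have := ymax (t *: u *m Phi); rewrite !gE TZ nZ => h.
have : t ^+ 2 * nrm A (T u) <= nrm A (T v).
  apply: h; split; [by rewrite -mulmxA mulmx_coker mulmx0|by apply/clc; exact: clZ|by rewrite nE].
move: nt; rewrite nZ => nt.
have t2 : 0 < t ^+ 2 by rewrite exprn_gt0.
move=> h2; rewrite -(ler_pM2l t2); apply: (le_trans h2).
by rewrite mulrCA nt mulr1.
Qed.

Lemma fin_argmax (S : finType) (P : S -> Prop) (g : S -> F) :
  (exists s, P s) -> exists2 s, P s & forall t, P t -> g t <= g s.
Proof.
move=> [s0 /asboolP s0P].
exists [arg max_(s > s0 | `[< P s >]) g s]%O.
  by case: arg_maxP => // s /asboolP.
by move=> t /asboolP; case: arg_maxP => // s _ h tP; exact: h.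
Qed.

(** The maximum over one closed chamber depends only on the sign pattern of the chamber, and there
    are finitely many patterns in the component. *)
Lemma comp_max A p0 : stable A -> Min A p0 -> A != set0 ->
  exists v r, [/\ comp A p0 v, 0 < nrm A v, 0 <= r, nrm A (T v) = r * nrm A v &
    forall u, comp A p0 u -> nrm A (T u) <= r * nrm A u].
Proof.
move=> st M0 A0.
pose pat p : {ffun I -> bool} := [ffun i => 0 < ev i p].
have patE p q : Min A p -> Min A q -> pat p = pat q -> forall i, i \in A -> sg i p = sg i q.
  move=> Mp Mq e i iA; have := congr1 (fun f : {ffun I -> bool} => f i) e; rewrite !ffunE /sg.
  by have := Mp.1 i iA; have := Mq.1 i iA; case: sgrP; case: sgrP.
pose Q s vr := [/\ comp A p0 vr.1, 0 < nrm A vr.1, nrm A (T vr.1) = vr.2 * nrm A vr.1 &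
   forall u p, conn A p0 p -> Min A p -> pat p = s -> cl A u p -> nrm A (T u) <= vr.2 * nrm A u].
pose P s := exists vr, Q s vr.
have PP p : conn A p0 p -> Min A p -> P (pat p).
  move=> cp Mp; have [v [cv v0 h]] := cone_max st Mp.1 A0.
  exists (v, nrm A (T v) / nrm A v); split=> //=; first by exists p.
    by rewrite divfK // gt_eqF.
  move=> u q cq Mq e cu; rewrite mulrAC ler_pdivlMr //; apply: h.
  by move=> i iA nz; rewrite (cu i iA nz); exact: patE.
have /boolp.choice [fr frP] : forall s, exists r, P s -> exists v, Q s (v, r).
  move=> s; have [[[v r] h]|h] := pselect (P s); last by exists 0.
  by exists r => _; exists v.
have [|s /frP [v [/= cv v0 e _]] smax] := @fin_argmax _ P fr.
  by exists (pat p0); apply: PP => //; exact: rst_refl.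
exists v, (fr s); split=> //.
  by rewrite -(pmulr_lge0 _ v0) -e nrm_ge0.
move=> u [p [cp Mp cu]].
have Pp := PP p cp Mp.
have [w [/= _ _ _ h]] := frP _ Pp.
apply: le_trans (h u p cp Mp erefl cu) _.
by rewrite ler_wpM2r ?nrm_ge0 // smax.
Qed.

(** The closure of a component is stable under [T], so its points grow at most like [r^k]. Any [x]
    is, up to scale, the difference of two points of the closed chamber of [p0], and [growth] turns
    the growth bound into a bound on the first step. *)
Lemma comp_bound A p0 r : stable A -> Min A p0 -> 0 <= r ->
  (forall u, comp A p0 u -> nrm A (T u) <= r * nrm A u) ->
  forall x, nrm A (T x) <= r * nrm A x.
Proof.
move=> st M0 r0 h x.
have cT k u : comp A p0 u -> comp A p0 (iter k T u) /\ nrm A (iter k T u) <= r ^+ k * nrm A u.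
  move=> cu; elim: k => [|k [c1 b1]]; first by rewrite expr0 mul1r.
  split; first exact: comp_T.
  by rewrite exprS -mulrA /=; apply: le_trans (h _ c1) _; rewrite ler_wpM2l.
have c0 : comp A p0 p0 by exists p0; split=> //; exact: rst_refl.
pose e := nstep phi p0 x.
have e0 : 0 < e by exact: nstep_gt0.
have c1 : comp A p0 (p0 + e *: x).
  exists p0; split=> //; first exact: rst_refl.
  by move=> i iA _; rewrite /sg sg_nudge (negPf (M0.1 i iA)).
(* The constant comes from [|a - b|^2 <= 2 (|a|^2 + |b|^2)], divided by [e^2] to undo the scaling of
   [x]. *)
apply: (@growth A x r (2 * (nrm A p0 + nrm A (p0 + e *: x)) / e ^+ 2)) => // k.
have [_ b0] := cT k _ c0; have [_ b1] := cT k _ c1.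
have xE : e *: iter k T x = iter k T (p0 + e *: x) - iter k T p0.
  by rewrite iterTD iterTZ addrAC subrr add0r.
have : nrm A (e *: iter k T x) <= 2 * (nrm A (iter k T (p0 + e *: x)) + nrm A (iter k T p0)).
  rewrite xE /nrm -big_split mulr_sumr; apply: ler_sum => i _ /=; rewrite evB.
  have := sqr_ge0 (ev i (iter k T (p0 + e *: x)) + ev i (iter k T p0)); lra.
have -> : nrm A (e *: iter k T x) = e ^+ 2 * nrm A (iter k T x).
  by rewrite !nrmE dotZ dotZl mulrA expr2.
move=> b2; rewrite mulrAC ler_pdivlMr ?exprn_gt0 // mulrC.
apply: le_trans b2 _; rewrite -mulrA ler_pM2l //; nra.
Qed.

(** Eigenvectors of [T^* T = z + z^-1 + 2] with eigenvalue [r], modulo vectors killed by all forms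
    of [A]. *)
Definition isE A (r : F) v := forall i, i \in A -> ev i (v *m z) + ev i (v *m zi) = (r - 2) * ev i v.

Lemma isE_comb A r v w a b : isE A r v -> isE A r w -> isE A r (a *: v + b *: w).
Proof.
move=> hv hw i iA; rewrite !mulmxDl -!scalemxAl !evE.
by have := hv i iA; have := hw i iA; nra.
Qed.

Lemma isE_z A r v : stable A -> isE A r v -> isE A r (v *m z).
Proof.
move=> st h i iA; have := h (pi^-1 i)%g; rewrite stableV // => /(_ iA).
by rewrite -!ev_zV -!mulmxA zK ziK.
Qed.

Lemma quad_ge0 (b c : F) : (forall e, 0 <= e * b + e ^+ 2 * c) -> b = 0.
Proof.
move=> h; apply/eqP/negPn/negP => b0.
have c0 : 0 <= c by have := h 1; have := h (-1); lra.
have cn : c + 1 != 0 by rewrite gt_eqF // ltr_wpDl.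
(* The quadratic takes the value [-(b / (c + 1))^2] here; [c + 1] replaces [c], which may be 0. *)
have := h (- b / (c + 1)).
have -> : - b / (c + 1) * b + (- b / (c + 1)) ^+ 2 * c = - (b / (c + 1)) ^+ 2.
  by field.
have : b / (c + 1) != 0 by rewrite mulf_neq0 // invr_eq0.
rewrite -sqrf_eq0 => nz; have := sqr_ge0 (b / (c + 1)).
by move=> h1 h2; move: nz; rewrite eq_le h1 andbT -oppr_ge0 h2.
Qed.

(** First variation at a maximiser of the Rayleigh quotient, in the direction of the residual
    [w = r v - T^* T v]. *)
Lemma isE_max A r v : stable A -> (forall x, nrm A (T x) <= r * nrm A x) ->
  nrm A (T v) = r * nrm A v -> isE A r v.
Proof.
move=> st h e.
pose w := r *: v - (v *m zi + v *m z + 2 *: v).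
have dw : r * dot A w v - dot A (T w) (T v) = dot A w w.
  have wE : w = r *: v + (-1) *: (v *m zi + v *m z + 2 *: v) by rewrite scaleN1r.
  by rewrite dot_T // [dot A w w](congr1 (dot A w) wE) !dotD !dotZ !dotD !dotZ; ring.
have /nrm_eq0 w0 : nrm A w = 0.
  rewrite nrmE -dw; apply: (@mulfI _ 2); rewrite ?pnatr_eq0 // mulr0.
  apply: (@quad_ge0 _ (r * nrm A w - nrm A (T w))) => t.
  have := h (v + t *: w); rewrite TD TZ.
  clear dw; move: (T v) (T w) e; clearbody w => Tv Tw e.
  rewrite !nrmE !dotDl !dotD !dotZl !dotZ -!nrmE e (dotC A v w) (dotC A Tv).
  by rewrite expr2; nra.
move=> i iA; have := w0 i iA; rewrite /w evB evZ !evD evZ; lra.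
Qed.

Definition bound A (r : F) := forall x, nrm A (T x) <= r * nrm A x.

(** Both sides shrink when walls are dropped, so the inequality cannot be restricted directly; but
    the growth of the iterates can, and [growth] recovers the bound. *)
Lemma bound_sub A A' r : stable A -> stable A' -> A' \subset A -> 0 <= r ->
  bound A r -> bound A' r.
Proof.
move=> st st' /subsetP sub r0 b x; apply: (@growth A' x r (nrm A x)) => // k.
apply: (@le_trans _ _ (nrm A (iter k T x))).
  rewrite /nrm [leRHS](big_setID A') /= (setIidPr _); last exact/subsetP.
  by rewrite lerDl sumr_ge0 // => i _; exact: sqr_ge0.
elim: k => [|k IH]; first by rewrite expr0 mulr1.
by apply: le_trans (b _) _; rewrite exprS mulrCA ler_wpM2l.
Qed.

(* Eigenvectors of [z + z^-1] for the largest eigenvalue [r - 2]. *)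
Definition eig_cl A := forall r e, 0 <= r -> isE A r e -> bound A r ->
  exists2 p, Min A p & cl A e p.

(** Inside the eigenspace the closure of a component is open away from 0. The chamber is first
    turned towards [v z], then moved around that flag by induction on the walls through [v] and
    [v z], and last turned back by a step towards the preimage. *)
Lemma open_E A r p0 p v u : stable A ->
  (forall A', A' \proper A -> stable A' -> conn_all A' /\ eig_cl A') ->
  0 <= r -> bound A r -> isE A r v -> isE A r u -> (exists2 i, i \in A & ev i v != 0) ->
  conn A p0 p -> Min A p -> cl A v p ->
  exists q, [/\ conn A p0 q, Min A q & cl A (nudge v u) q].
Proof.
move=> st IH r0 bA Ev Eu [i0 i0A i0v] cp Mp cv.
have [sp cp' cp''] := pursuit_cl st Mp cv.
set p' := nudge v (nudge (v *m z) p) in sp cp' cp''.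
have Mp' : Min A p' by case: sp.
pose v' := nudge v (v *m z).
pose A' := [set i in A | ev i v' == 0].
have AE i : (i \in A') = (i \in A) && (ev i v' == 0) by rewrite inE.
have AE2 i : (i \in A') = [&& i \in A, ev i v == 0 & ev i (v *m z) == 0].
  by rewrite AE nudge_eq0.
have sub : A' \subset A by apply/subsetP => i; rewrite AE => /andP[].
(* If the form [i] vanishes on [v] and [v z], the eigenvalue equation makes it vanish on [v z^-1],
   so [pi i] is again a wall through both. *)
have st' : stable A'.
  apply: stable_sub => i; rewrite !AE2 st -!ev_zi -!mulmxA zK mulmx1 => /and3P[iA /eqP v0 /eqP vz0].
  by have := Ev i iA; rewrite v0 vz0 iA eqxx add0r mulr0 => ->; rewrite eqxx.
have prop : A' \proper A.
  by apply/properP; split=> //; exists i0; rewrite // AE2 (negPf i0v) andbF.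
have [_ /(_ r u r0)] := IH A' prop st'.
case=> [i /(subsetP sub)||rho0 Mrho0 crho0]; [exact: Eu|exact: bound_sub bA|].
pose rho := nudge rho0 p.
have grho : gen A rho by apply: gen_nudge; exact: Mp.1.
have srho i : i \in A' -> sg i rho = sg i rho0.
  by move=> iA; rewrite sg_nudgeE (negPf (Mrho0.1 i iA)).
have Mrho : Min A' rho by apply: Min_sg Mrho0 => // i iA; rewrite srho.
have crho : cl A' u rho by move=> i iA nz; rewrite srho //; exact: crho0.
have [_ lift] := star_Min st st' AE cp'' Mp'.
pose q1 := nudge v' rho.
have Mq1 : Min A q1 by exact: lift.
have c1 : conn A p' q1.
  apply: (@star_conn A v') => //.
  - by move=> B pB sB; case: (IH B pB sB).
  - by move=> i iA nz; rewrite (sg_nudgeE v' rho) (negPf nz).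
  - by exists i0; rewrite // nudge_eq0 (negPf i0v).
pose q := nudge v (nudge u rho).
(* On a wall through [v] but not [v z], the chamber [q1] has the sign of [v z] and its preimage the
   opposite sign, so a change of sign there always goes towards the preimage. On the remaining walls
   through [v], [rho] already has [u] in its closure. *)
have sq : step A q1 q.
  apply: step_btw => //; first by apply: gen_nudge; apply: gen_nudge.
  right=> i iA.
  have sq1 j : sg j q1 = if ev j v' == 0 then sg j rho else sg j v' by exact: sg_nudgeE.
  have -> : sg i q = if ev i v == 0 then if ev i u == 0 then sg i rho else sg i u else sg i v.
    by rewrite (sg_nudgeE v (nudge u rho)) (sg_nudgeE u rho).
  have sv j : sg j v' = if ev j v == 0 then sg j (v *m z) else sg j v by exact: sg_nudgeE.
  have ve j : (ev j v' == 0) = (ev j v == 0) && (ev j (v *m z) == 0) by exact: nudge_eq0.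
  rewrite sg_zi !sq1 !ve !sv.
  case v0 : (ev i v == 0) => /=; last by rewrite eqxx.
  case vz0 : (ev i (v *m z) == 0) => /=.
    case: ifP => u0; first by rewrite eqxx.
    by rewrite (crho i) ?AE2 ?iA ?v0 ?vz0 ?eqxx // u0.
  move=> ne.
  have vzi : ev i (v *m zi) = - ev i (v *m z).
    by apply/eqP; rewrite -addr_eq0 addrC (Ev i iA) (eqP v0) mulr0.
  have nz : ev (pi i) v != 0 by rewrite -ev_zi vzi oppr_eq0 vz0.
  rewrite (negPf nz) /= -sg_zi.
  have -> : sg i (v *m zi) = - sg i (v *m z) by rewrite /sg vzi sgrN.
  move: ne.
  have g := gen_nudge u grho iA; rewrite -sgr_eq0 -/(sg i _) (sg_nudgeE u rho) in g.
  have : (if ev i u == 0 then sg i rho else sg i u) = 1 \/ (if ev i u == 0 then sg i rho else sg i u) = -1.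
    by move: g; case: ifP => _; rewrite /sg; case: sgrP => _; rewrite ?eqxx; auto.
  have : sg i (v *m z) = 1 \/ sg i (v *m z) = -1.
    by move: vz0; rewrite /sg -sgr_eq0; case: sgrP => _; rewrite ?eqxx; auto.
  by case=> ->; case=> ->; rewrite ?eqxx ?opprK.
exists q; split; [|by case: sq|].
- apply: rst_trans cp _; apply: rst_trans (rst_step _ _ _ _ sp) _.
  by apply: rst_trans c1 _; exact: rst_step.
- move=> i iA; rewrite nudge_eq0 !sg_nudgeE; case: ifP => //= _ u0.
  by rewrite (negPf u0).
Qed.

Lemma sgr_same (a b : F) : a != 0 -> b != 0 -> 0 <= a * b -> Num.sg a = Num.sg b.
Proof. by case: (sgrP a) => // ? _; case: (sgrP b) => // ? _; nra. Qed.

(** Induction on the walls strictly separating [v] and [w]. [open_E] turns the chamber towards [w],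
    which then contains the segment in its closure up to the first separating wall; the hypothesis
    on the segment is what [open_E] needs at each new base point. *)
Lemma walk A r p0 v w : stable A ->
  (forall A', A' \proper A -> stable A' -> conn_all A' /\ eig_cl A') ->
  0 <= r -> bound A r -> isE A r v -> isE A r w -> comp A p0 v ->
  (forall s, 0 <= s <= 1 -> exists2 i, i \in A & ev i ((1 - s) *: v + s *: w) != 0) ->
  comp A p0 w.
Proof.
move=> st IH r0 bA + Ew; have [k] := ubnP #|[set i in A | ev i v * ev i w < 0]|.
elim: k v => // k IHk v; rewrite ltnS => hk Ev [p [cp Mp cv]] seg.
have Eu : isE A r (w - v) by rewrite -[w]scale1r -scaleN1r; exact: isE_comb.
have nzv : exists2 i, i \in A & ev i v != 0.
  by have := seg 0; rewrite lexx ler01 subr0 scale1r scale0r addr0; apply.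
have [q [cq Mq cqv]] := open_E st IH r0 bA Ev Eu nzv cp Mp cv.
have q1 i : i \in A -> ev i v != 0 -> sg i q = sg i v.
  by move=> iA v0; rewrite -(cqv i iA) ?sg_nudgeE ?nudge_eq0 (negPf v0).
have q2 i : i \in A -> ev i v = 0 -> ev i w != 0 -> sg i q = sg i w.
  move=> iA v0 w0; have uE : ev i (w - v) = ev i w by rewrite evB v0 subr0.
  by rewrite -(cqv i iA) ?sg_nudgeE ?nudge_eq0 v0 eqxx /= /sg uE.
case: (set_0Vmem [set i in A | ev i v * ev i w < 0]) => [S0|[i1]].
  exists q; split=> // i iA w0; have [v0|v0] := eqVneq (ev i v) 0; first by rewrite (q2 i).
  rewrite q1 //; apply/esym; apply: sgr_same => //.
  rewrite leNgt; apply/negP => lt.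
  by have := in_set0 i; rewrite -S0 inE iA lt.
(* The parameter at which the segment meets the wall [i]; the smallest one over the strictly
   separating walls gives the next base point. *)
pose tm i := ev i v / (ev i v - ev i w).
move=> i1S; case: (@arg_minP _ _ _ i1 (fun i => i \in [set i in A | ev i v * ev i w < 0]) tm i1S) => i2.
rewrite !inE => /andP[i2A i2n] i2min.
have tmE i : ev i v * ev i w < 0 -> [/\ 0 < tm i, tm i < 1 & tm i * (ev i v - ev i w) = ev i v].
  move=> h; have nz : ev i v - ev i w != 0.
    by apply/negP => /eqP e; move: h; nra.
  have e : tm i * (ev i v - ev i w) = ev i v by rewrite /tm divfK.
  by split=> //; move: h e; move: (tm i) (ev i v) (ev i w) nz => t a b nz h e; nra.
have [t0 t1 te] := tmE _ i2n.
set t := tm i2 in t0 t1 te i2min.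
pose v' := (1 - t) *: v + t *: w.
have ev' i : ev i v' = (1 - t) * ev i v + t * ev i w by rewrite !evE.
have sv' i : i \in A -> ev i v != 0 -> ev i v' != 0 -> sg i v' = sg i v.
  move=> iA v0 v'0; apply: sgr_same => //; rewrite ev'.
  case: (ltP (ev i v * ev i w) 0) => h; last by nra.
  have [_ _ e] := tmE i h.
  have le : t <= tm i by apply: i2min; rewrite inE iA.
  move: h le e; move: (tm i) (ev i v) (ev i w) => s a b h le e.
  have ab0 : 0 <= a * (a - b) by rewrite mulrBr -expr2; have := sqr_ge0 a; lra.
  have aa : a * a = s * (a * (a - b)) by rewrite mulrCA e.
  have -> : ((1 - t) * a + t * b) * a = a * a - t * (a * (a - b)) by ring.
  by rewrite aa -mulrBl mulr_ge0 // subr_ge0.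
have cv' : cl A v' q.
  move=> i iA v'0; have [v0|v0] := eqVneq (ev i v) 0; last by rewrite q1 // sv'.
  have w0 : ev i w != 0 by apply: contraNneq v'0 => w0; rewrite ev' v0 w0 !mulr0 addr0.
  by rewrite q2 // /sg ev' v0 mulr0 add0r sgrM gtr0_sg // mul1r.
apply: (IHk v').
- apply: leq_trans hk; apply: proper_card; apply/properP; split.
    apply/subsetP => i; rewrite !inE => /andP[-> ]; rewrite ev'; apply: contraTT; rewrite -!leNgt.
    move=> h; nra.
  by exists i2; rewrite !inE i2A //= ev' (_ : _ + _ = 0) ?mul0r ?ltxx //; move: te; lra.
- exact: isE_comb.
- by exists q.
- move=> s /andP[s0 s1].
  have -> : (1 - s) *: v' + s *: w = (1 - (s + (1 - s) * t)) *: v + (s + (1 - s) * t) *: w.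
    rewrite /v' scalerDr !scalerA -addrA -scalerDl; congr (_ *: _ + _ *: _); ring.
  by apply: seg; apply/andP; split; nra.
Qed.

(** * Ellipticity and connectedness of the minimal chambers *)

Section Main.
Variable m : nat.
Hypothesis m_gt0 : (0 < m)%N.

(** Absence of fixed vectors modulo the common kernel, stated form by form so that it passes to
    subsets of walls at once. *)
Definition elliptic A := forall i x, i \in A -> \sum_(k < m) ev ((pi ^+ k)%g i) x = 0.

Lemma elliptic_fix A v : stable A -> elliptic A ->
  (forall i, i \in A -> ev i (v *m z) = ev i v) -> forall i, i \in A -> ev i v = 0.
Proof.
move=> st el fx i iA; have := el i v iA.
have e k : (pi ^+ k)%g i \in A /\ ev ((pi ^+ k)%g i) v = ev i v.
  elim: k => [|k [kA ke]]; first by rewrite expg0 perm1.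
  rewrite expgSr permM st; split=> //.
  by rewrite -fx ?st // ev_z.
rewrite (eq_bigr (fun=> ev i v)) => [|k _]; last by case: (e k).
rewrite sumr_const card_ord => /eqP; rewrite mulrn_eq0 => /orP[|/eqP //].
by rewrite eqn0Ngt m_gt0.
Qed.

(** A segment from [v] to [w] meets the common kernel only if [w] is a negative multiple of [v] on
    [A]. Then [v z] is tried instead; if that fails too, [v z] is a positive multiple of [v], hence
    equal to it on [A] by invariance of the norm, against ellipticity. *)
Lemma walk_any A r p0 v w : stable A -> elliptic A ->
  (forall A', A' \proper A -> stable A' -> conn_all A' /\ eig_cl A') ->
  0 <= r -> bound A r -> isE A r v -> isE A r w -> comp A p0 v ->
  (exists2 i, i \in A & ev i v != 0) -> (exists2 i, i \in A & ev i w != 0) ->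
  comp A p0 w.
Proof.
move=> st el IH r0 bA Ev Ew cv [i iA nv] [j jA nw].
have dec x y : (forall s, 0 <= s <= 1 -> exists2 i, i \in A & ev i ((1 - s) *: x + s *: y) != 0) \/
   exists s, 0 <= s <= 1 /\ forall i, i \in A -> (1 - s) * ev i x + s * ev i y = 0.
  have [h|h] := pselect (exists s, 0 <= s <= 1 /\ forall i, i \in A -> (1 - s) * ev i x + s * ev i y = 0); [by right|left=> s s01].
  case: (boolP [exists i in A, ev i ((1 - s) *: x + s *: y) != 0]) => [/exists_inP//|/exists_inPn h'].
  by case: h; exists s; split=> // k kA; have := h' k kA; rewrite negbK !evE => /eqP.
case: (dec v w) => [seg|[s [/andP[s0 s1] hs]]]; first exact: (walk st IH r0 bA Ev Ew cv seg).
have cvz : comp A p0 (v *m z) by exact: comp_z.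
have Evz : isE A r (v *m z) by exact: isE_z.
case: (dec (v *m z) w) => [seg|[t [/andP[t0 t1] ht]]]; first exact: (walk st IH r0 bA Evz Ew cvz seg).
have s0' : 0 < s.
  rewrite lt_neqAle s0 andbT; apply: contraNneq nv => e.
  by have := hs i iA; rewrite -e => <-; apply/eqP; ring.
have s1' : s < 1.
  rewrite lt_neqAle s1 andbT; apply: contraNneq nw => e.
  by have := hs j jA; rewrite e => <-; apply/eqP; ring.
have t1' : t < 1.
  rewrite lt_neqAle t1 andbT; apply: contraNneq nw => e.
  by have := ht j jA; rewrite e => <-; apply/eqP; ring.
(* The factor with [v z = c v] on [A], from eliminating [w] between the two vanishing
   combinations. *)
pose c := (t / (1 - t)) * ((1 - s) / s).
have c0 : 0 <= c by rewrite mulr_ge0 // divr_ge0 // subr_ge0.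
have ce k : k \in A -> ev k (v *m z) = c * ev k v.
  move=> kA; have h1 := hs k kA; have h2 := ht k kA.
  have -> : ev k (v *m z) = - (t / (1 - t)) * ev k w.
    apply: (@mulfI _ (1 - t)); first by rewrite subr_eq0 gt_eqF.
    have -> : (1 - t) * (- (t / (1 - t)) * ev k w) = - (t * ev k w).
      by field; rewrite subr_eq0 gt_eqF.
    by apply/eqP; rewrite -addr_eq0 h2.
  have -> : ev k w = - ((1 - s) / s) * ev k v.
    apply: (@mulfI _ s); first by rewrite gt_eqF.
    have -> : s * (- ((1 - s) / s) * ev k v) = - ((1 - s) * ev k v) by field; rewrite gt_eqF.
    by apply/eqP; rewrite -addr_eq0 addrC h1.
  by rewrite /c; ring.
have n0 := nrm_gt0 iA nv.
have c1 : c = 1.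
  have : nrm A (v *m z) = c ^+ 2 * nrm A v.
    by rewrite /nrm mulr_sumr; apply: eq_bigr => k kA; rewrite ce // exprMn.
  rewrite nrm_z // => e.
  have /eqP : (c ^+ 2 - 1) * nrm A v = 0 by rewrite mulrBl -e mul1r subrr.
  rewrite mulf_eq0 (gt_eqF n0) orbF subr_eq0 sqrf_eq1 => /orP[/eqP//|/eqP ec].
  by move: c0; rewrite ec oppr_ge0 ler10.
have := elliptic_fix (v := v) st el _ iA; rewrite (_ : ev i v = 0 <-> False).
  by move=> h; exfalso; apply: h => k kA; rewrite ce // c1 mul1r.
by split=> // e; move: nv; rewrite e eqxx.
Qed.

Lemma exists_Min A x : gen A x -> exists p, Min A p.
Proof.
move=> gx; have [k] := ubnP (sepn A x (x *m z)); elim: k x gx => // k IH x gx; rewrite ltnS => hk.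
have [[y [gy lt]]|no] := pselect (exists y, gen A y /\ (sepn A y (y *m z) < sepn A x (x *m z))%N).
  by apply: (IH y gy); exact: leq_trans lt hk.
exists x; split=> // y gy; rewrite leqNgt; apply/negP => lt; apply: no; by exists y.
Qed.

Hypothesis phi_neq0 : forall i, phi i != 0.

Lemma ev_neq0 i : exists x, ev i x != 0.
Proof.
have := phi_neq0 i; rewrite -subr_eq0 subr0 => nz.
have [k kn] : exists k, phi i k 0 != 0.
  case: (boolP [exists k, phi i k 0 != 0]) => [/existsP//|/existsPn h].
  by case/eqP: nz; apply/colP => k; rewrite mxE; have := h k; rewrite negbK => /eqP.
exists (delta_mx 0 k); rewrite /ev /eval_form -rowE mxE //.
Qed.

Lemma exists_gen A : exists x, gen A x.
Proof.
have [||i iA|x _ h] := @avoid F n I phi (fun=> True) A => //; last by exists x.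
by have [x nx] := ev_neq0 i; exists x.
Qed.

(* Induction on the number of walls. Minimal chambers around a nonzero point are joined by induction, the
   walls through that point being fewer; a component of minimal chambers reaches a top eigenvector
   of [z + z^-1], because otherwise a maximiser of [|(1 + z) x|^2 / |x|^2] on its closure could be improved. *)
Lemma elliptic_conn A : stable A -> elliptic A -> conn_all A /\ eig_cl A.
Proof.
have [k] := ubnP #|A|; elim: k A => // k IHk A; rewrite ltnS => hk st el.
have IH A' : A' \proper A -> stable A' -> conn_all A' /\ eig_cl A'.
  move=> pA sA; apply: IHk => //; first exact: leq_trans (proper_card pA) hk.
  by move=> i x iA; apply: el; move/proper_sub/subsetP: pA; apply.
have [x gx] := exists_gen A; have [p Mp] := exists_Min gx.
have [A0|An] := eqVneq A set0.
  split=> [p1 p2 M1 M2|r e _ _ _].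
    by apply: conn_sg => // i; rewrite A0 inE.
  by exists p => // i; rewrite A0 inE.
have top p0 (M0 : Min A p0) : exists v r, [/\ comp A p0 v, exists2 i, i \in A & ev i v != 0,
     0 <= r, nrm A (T v) = r * nrm A v & bound A r /\ isE A r v].
  have [v [r [cv v0 r0 e h]]] := comp_max st M0 An.
  have b : bound A r by exact: comp_bound h.
  exists v, r; split=> //; last by split=> //; exact: isE_max.
  case: (boolP [exists i in A, ev i v != 0]) => [/exists_inP//|/exists_inPn h'].
  by move: v0; rewrite /nrm big1 ?ltxx // => i /h'; rewrite negbK => /eqP ->; rewrite expr2 mulr0.
(* Each eigenvalue is a global bound that is attained at a vector of nonzero norm, so all components
   share it. *)
have uniq r r' v v' : nrm A (T v) = r * nrm A v -> (exists2 i, i \in A & ev i v != 0) ->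
    bound A r' -> nrm A (T v') = r' * nrm A v' -> (exists2 i, i \in A & ev i v' != 0) ->
    bound A r -> r = r'.
  move=> e [i iA nv] b' e' [j jA nv'] b.
  apply/eqP; rewrite eq_le; apply/andP; split.
    by rewrite -(ler_pM2r (nrm_gt0 iA nv)) -e.
  by rewrite -(ler_pM2r (nrm_gt0 jA nv')) -e'.
split.
  move=> p1 p2 M1 M2.
  have [v1 [r1 [c1 n1 r10 e1 [b1 E1]]]] := top p1 M1.
  have [v2 [r2 [c2 n2 r20 e2 [b2 E2]]]] := top p2 M2.
  have e12 : r1 = r2 by exact: uniq e1 n1 b2 e2 n2 b1.
  rewrite -{}e12 in E2.
  have [q [cq Mq clq]] := walk_any st el IH r10 b1 E1 E2 c1 n1 n2.
  have [q' [cq' Mq' clq']] := c2.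
  apply: rst_trans cq _; apply: rst_trans (rst_sym _ _ _ _ cq').
  by apply: (@star_conn A v2) => // A' pA sA; case: (IH A' pA sA).
move=> r e r0 Ee b.
case: (boolP [exists i in A, ev i e != 0]) => [/exists_inP ne|/exists_inPn h]; last first.
  by exists p => // i iA; rewrite (negPf (h i iA)).
have [v1 [r1 [c1 n1 r10 e1 [b1 E1]]]] := top p Mp.
have ee : nrm A (T e) = r * nrm A e.
  rewrite nrmE dot_T // nrmE -dotZ; apply: eq_bigr => i iA; congr (_ * _).
  rewrite !evE addrC; have := Ee i iA; lra.
have e12 : r1 = r by exact: uniq e1 n1 b ee ne b1.
rewrite -{}e12 in Ee.
have [q [cq Mq clq]] := walk_any st el IH r10 b1 E1 Ee c1 n1 ne.
by exists q.
Qed.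

End Main.

End Elliptic.

Lemma no_int_between (p q : int) : p < q -> q < p + 1 -> False.
Proof. lia. Qed.

(** * Alcoves *)
Section Alcoves.
Variables (F : archiRealFieldType) (n : nat) (I : finType) (D : RD n I).
Hypothesis HD : is_based_root_datum D.
Local Notation rt := (root D).
Local Notation cr := (coroot D).
Local Notation ropp := (root_opp HD).
Implicit Types (x y h w r s : 'rV[F]_n).

Definition root_val i x : F := pairR x (rt i).
Local Notation a := root_val.
Definition root_floor i x : int := Num.floor (a i x).
Local Notation fl := root_floor.
Definition agen x := forall i, a i x \isn't a Num.int.
(** For generic points, the signed number of hyperplanes of the root [i] between [x] and [y]. *)
Definition floor_jump i x y : int := fl i y - fl i x.
Local Notation K := floor_jump.
Definition floor_dist x y : nat := (\sum_i `|K i x y|)%N.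
Local Notation dist := floor_dist.
Definition abtw x y w := forall i, 0 <= K i x y * K i y w.
(** At most one hyperplane separates the points; a root and its opposite describe the same
    hyperplanes. Points of one alcove are included. *)
Definition adj x y := (forall i j, K i x y != 0 -> K j x y != 0 -> j = i \/ j = ropp i) /\
  forall i, (`|K i x y| <= 1)%N.

Lemma aD i x y : a i (x + y) = a i x + a i y. Proof. exact: pairRD. Qed.
Lemma aZ i c x : a i (c *: x) = c * a i x. Proof. exact: pairRZ. Qed.
Lemma aN i x : a i (- x) = - a i x. Proof. exact: pairRN. Qed.
Lemma aB i x y : a i (x - y) = a i x - a i y. Proof. exact: pairRB. Qed.
Lemma a_opp i x : a (ropp i) x = - a i x. Proof. exact: pairR_opp. Qed.
Lemma a_toR i l : a i (toR F l) = (ipair l (rt i))%:~R. Proof. exact: pairR_toR. Qed.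

Lemma flP i x : (fl i x)%:~R <= a i x < (fl i x + 1)%:~R. Proof. exact: floor_itv. Qed.
Lemma fl_gen i x : a i x \isn't a Num.int -> (fl i x)%:~R < a i x < (fl i x + 1)%:~R.
Proof.
move=> g; have /andP[h1 ->] := flP i x; rewrite andbT lt_neqAle h1 andbT.
by apply: contraNneq g => <-; exact: intr_int.
Qed.
Lemma fl_opp i x : a i x \isn't a Num.int -> fl (ropp i) x = - fl i x - 1.
Proof.
move=> /fl_gen /andP[h1 h2]; apply: floor_def; rewrite a_opp.
move: h1 h2; rewrite !rmorphD !rmorphN /= => h1 h2; apply/andP; split; lra.
Qed.
Lemma agen_opp i x : (a (ropp i) x \is a Num.int) = (a i x \is a Num.int).
Proof. by rewrite a_opp rpredN. Qed.
Lemma K_opp i x y : agen x -> agen y -> K (ropp i) x y = - K i x y.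
Proof. by move=> gx gy; rewrite /K !fl_opp //; lia. Qed.
Lemma K_tri i x y w : K i x y + K i y w = K i x w.
Proof. rewrite /K; lia. Qed.
Lemma KC i x y : K i x y = - K i y x.
Proof. rewrite /K; lia. Qed.

Lemma dist_abtw x y w : abtw x y w -> (dist x y + dist y w = dist x w)%N.
Proof.
move=> h; rewrite /dist -big_split; apply: eq_bigr => i _ /=.
by have := h i; rewrite -(K_tri i x y w); move: (K i x y) (K i y w) => u v; nia.
Qed.
Lemma dist_tri x y w : (dist x w <= dist x y + dist y w)%N.
Proof.
rewrite /dist -big_split; apply: leq_sum => i _ /=.
by rewrite -(K_tri i x y w); move: (K i x y) (K i y w) => u v; lia.
Qed.
Lemma abtw_trans x r s y : abtw x r y -> abtw r s y -> abtw x s y.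
Proof.
move=> h1 h2 i; have := h1 i; have := h2 i.
rewrite -(K_tri i r s y) -(K_tri i x r s); move: (K i x r) (K i r s) (K i s y) => u v w; nia.
Qed.
Lemma K0_dist x y : dist x y = 0%N -> forall i, K i x y = 0.
Proof. by move=> /eqP; rewrite sum_nat_eq0 => /forallP h i; have := h i; rewrite /= absz_eq0 => /eqP. Qed.

(* Points infinitesimally close to [h] in the direction [w] *)
Definition gap (u : F) : F :=
  if u \is a Num.int then 1 else Num.min (u - (Num.floor u)%:~R) ((Num.floor u + 1)%:~R - u).
Lemma gap_gt0 u : 0 < gap u.
Proof.
rewrite /gap; case: ifP => // /negbT g; have /andP[h1 h2] := floor_itv u.
rewrite lt_min !subr_gt0 h2 andbT lt_neqAle h1 andbT.
by apply: contraNneq g => <-; exact: intr_int.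
Qed.
Definition astep h w : F := (1 + \sum_i `|a i w| / gap (a i h))^-1.
Lemma astep_gt0 h w : 0 < astep h w.
Proof.
rewrite invr_gt0 ltr_pwDl ?ltr01 // sumr_ge0 // => i _.
by rewrite divr_ge0 // ltW // gap_gt0.
Qed.
Lemma astep_lt h w e i : 0 < e -> e <= astep h w -> e * `|a i w| < gap (a i h).
Proof.
move=> e0 he; have g0 := gap_gt0 (a i h).
apply: (@le_lt_trans _ _ (astep h w * `|a i w|)); first by rewrite ler_wpM2r.
rewrite /astep mulrC ltr_pdivrMr; last by rewrite -invr_gt0; exact: astep_gt0.
rewrite (bigD1 i) //= mulrDr mulr1 mulrDr mulrCA divff ?gt_eqF // mulr1.
have : 0 <= \sum_(j | j != i) `|a j w| / gap (a j h).
  by rewrite sumr_ge0 // => j _; rewrite divr_ge0 // ltW // gap_gt0.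
nra.
Qed.

Lemma fl_step h w e i : 0 < e -> e <= astep h w ->
  fl i (h + e *: w) = if (a i h \is a Num.int) && (a i w < 0) then fl i h - 1 else fl i h.
Proof.
move=> e0 he; have := astep_lt i e0 he; have := flP i h.
rewrite /fl aD aZ /gap => /andP[h1 h2] lt.
have lt2 : `|e * a i w| = e * `|a i w| by rewrite normrM gtr0_norm.
case: ifP lt => hi lt /=; apply: floor_def.
  have hE := floorK hi; rewrite -lt2 ltr_norml in lt; case/andP: lt => l1 l2.
  rewrite -/(a i h) in h1 h2; case: ifP => lt0.
    have : e * a i w < 0 by rewrite pmulr_rlt0.
    by rewrite subrK rmorphB /= hE => ?; apply/andP; split; lra.
  have : 0 <= e * a i w by apply: mulr_ge0; [exact: ltW|rewrite leNgt lt0].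
  by rewrite rmorphD /= hE => ?; apply/andP; split; lra.
rewrite -lt2 lt_min !ltr_norml in lt; case/andP: lt => /andP[l1 l2] /andP[l3 l4].
by apply/andP; split; lra.
Qed.

Lemma int_step h w e i : 0 < e -> e <= astep h w ->
  (a i (h + e *: w) \is a Num.int) = (a i h \is a Num.int) && (a i w == 0).
Proof.
move=> e0 he; have lt := astep_lt i e0 he; have fe := fl_step i e0 he.
have [hi|hi] := boolP (a i h \is a Num.int).
  rewrite /= aD aZ rpredDl //; have [->|nz] := eqVneq (a i w) 0; first by rewrite mulr0 rpred0.
  move: lt; rewrite /gap hi => lt; apply/negP => h2.
  have : 1 <= `|e * a i w| by rewrite norm_intr_ge1 // mulf_neq0 // gt_eqF.
  by rewrite normrM (gtr0_norm e0) leNgt lt.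
rewrite /= (negPf hi) in fe *; rewrite intrEfloor -/(fl i _) fe.
move: lt; rewrite /gap (negPf hi) lt_min => /andP[l1 _].
apply/negP => /eqP; rewrite aD aZ => e1.
move: l1; have : - (e * `|a i w|) <= e * a i w.
  by have := ler_norm (- a i w); rewrite normrN; nra.
rewrite /fl in e1; lra.
Qed.

Definition nearby h w := h + astep h w *: w.

Lemma fl_nearby h w i :
  fl i (nearby h w) = if (a i h \is a Num.int) && (a i w < 0) then fl i h - 1 else fl i h.
Proof. by apply: fl_step => //; exact: astep_gt0. Qed.
Lemma int_nearby h w i :
  (a i (nearby h w) \is a Num.int) = (a i h \is a Num.int) && (a i w == 0).
Proof. by apply: int_step => //; exact: astep_gt0. Qed.
Lemma agen_nearby h w : (forall i, a i h \is a Num.int -> a i w != 0) -> agen (nearby h w).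
Proof. by move=> g i; rewrite int_nearby; case: (boolP (_ \is a _)) => //= /g. Qed.

(* [h] lies in the closure of the alcove of [x] *)
Definition acl h x := forall i, fl i x = fl i h \/ (a i h \is a Num.int /\ fl i x = fl i h - 1).

Lemma acl_nearby h w : acl h (nearby h w).
Proof. by move=> i; rewrite fl_nearby; case: ifP => [/andP[]|_]; auto. Qed.

Lemma acl_fl h x : acl h x -> forall i, fl i x = fl i (nearby h (x - h)).
Proof.
move=> c i; rewrite fl_nearby aB subr_lt0; have := c i.
have /andP[l1 l2] := flP i x; have /andP[l3 l4] := flP i h.
case: (boolP (a i h \is a Num.int)) => hi /=; last by case=> [//|[]].
have hE : (fl i h)%:~R = a i h by rewrite /fl floorK.
case=> [e|[_ e]]; rewrite e in l1 l2 *.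
  by rewrite ltNge -hE l1.
by rewrite -hE; rewrite subrK in l2; rewrite l2.
Qed.

(** After a perturbation of [x] inside its alcove, the segment to [y] leaves the alcove through a
    single wall, and [r] lies just behind that wall. *)
Lemma first_step x y : agen x -> agen y -> (exists i, K i x y != 0) ->
  exists r, [/\ agen r, adj x r, abtw x r y & exists i, K i x r != 0].
Proof.
move=> gx gy [i1 ne1].
(* Every separating hyperplane is described by the root that increases from [x] to [y], whose first
   wall is at [fl i x + 1]. *)
pose S := [set i | 0 < K i x y].
have [i0 i0S] : exists i0, i0 \in S.
  have [|le] := ltP 0 (K i1 x y); first by exists i1; rewrite inE.
  exists (ropp i1); rewrite inE K_opp // oppr_gt0.
  by rewrite lt_neqAle ne1 le.
pose k i : F := (fl i x + 1)%:~R.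
have kx i : a i x < k i by have /andP[] := fl_gen (gx i).
have ky i : i \in S -> 0 < a i y - k i.
  rewrite inE /K => h; have /andP[l _] := fl_gen (gy i); rewrite subr_gt0.
  by apply: le_lt_trans l; rewrite /k ler_int; lia.
pose Y i := a i y - k i.
(* x' in the alcove of x such that the segment from x' to y meets the first walls at distinct times *)
pose psi (ij : I * I) : 'cV[F]_n := Y ij.2 *: (toR F (rt ij.1))^T - Y ij.1 *: (toR F (rt ij.2))^T.
have psiE ij u : eval_form psi ij u = Y ij.2 * a ij.1 u - Y ij.1 * a ij.2 u.
  rewrite /eval_form mulmxBr -!scalemxAr [LHS]mxE [X in _ + X]mxE [X in X - _]mxE.
  by rewrite [X in _ - X]mxE.
pose A := [set ij : I * I | [&& ij.1 \in S, ij.2 \in S & ij.1 != ij.2]].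
have [||[i j]|u _ hu] := @avoid F _ _ psi (fun=> True) A => //=.
  rewrite inE /= => /and3P[iS jS ij].
  case: (excluded_middle_informative (exists2 u : 'rV[F]_n, True & eval_form psi (i, j) u != 0)) => // no.
  (* Otherwise the two roots would be positively proportional, hence equal by [rt_par]. *)
  have z u : Y j * a i u = Y i * a j u.
    apply/eqP; rewrite -subr_eq0 -(psiE (i, j)) /=; apply/negPn/negP => nz; apply: no; by exists u.
  have c1 := z (toR F (cr j)); have c2 := z (toR F (cr i)).
  rewrite !a_toR !cr_rt // in c1 c2.
  have Yi : 0 < Y i by exact: ky.
  have Yj : 0 < Y j by exact: ky.
  have cj : 0 < ipair (cr j) (rt i).
    rewrite -(ltr_int F); have : 0 < Y j * (ipair (cr j) (rt i))%:~R by rewrite c1 mulr_gt0 // ltr0z.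
    by rewrite pmulr_rgt0.
  case/eqP: ij; apply: (rt_par HD (c := 2) (d := ipair (cr j) (rt i))) => //.
  apply/eqP; rewrite -subr_eq0; apply/eqP; apply: (@pairR0_eq0 F) => v.
  rewrite pairR_Dr pairR_Nr !pairR_Zr -!/(a _ _).
  have zv := z v; apply: (@mulfI _ (Y j)); first by rewrite gt_eqF.
  rewrite mulr0 mulrBr mulrCA zv [Y j * (_ * a j v)]mulrA c1; ring.
(* For [v] in the alcove of [x], this vanishes exactly when the segment from [v] to [y] meets the
   first walls of both roots at the same time; [psi] is minus its linear part. *)
pose g (ij : I * I) v := Y ij.2 * (k ij.1 - a ij.1 v) - Y ij.1 * (k ij.2 - a ij.2 v).
pose e1 : F := (1 + \sum_ij `|eval_form psi ij u| / `|g ij x|)^-1.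
have e1_gt0 : 0 < e1.
  by rewrite invr_gt0 ltr_pwDl ?ltr01 // sumr_ge0 // => ij _; rewrite divr_ge0.
pose e := Num.min (astep x u) e1.
have e0 : 0 < e by rewrite lt_min astep_gt0.
have ea : e <= astep x u by rewrite ge_min lexx.
have ee1 : e <= e1 by rewrite ge_min lexx orbT.
pose x' := x + e *: u.
have flx' i : fl i x' = fl i x by rewrite /x' fl_step // (negPf (gx i)).
have gx' : agen x' by move=> i; rewrite /x' int_step // (negPf (gx i)).
have gx'0 ij : ij \in A -> g ij x' != 0.
  move=> ijA.
  have ge : g ij x' = g ij x - e * eval_form psi ij u by rewrite psiE /g /x' !aD !aZ; ring.
  rewrite ge; have [->|gn] := eqVneq (g ij x) 0.
    by rewrite sub0r oppr_eq0; apply: mulf_neq0; [rewrite gt_eqF|exact: hu].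
  apply/negP; rewrite subr_eq0 => /eqP eq.
  have gp : 0 < `|g ij x| by rewrite normr_gt0.
  have : e * `|eval_form psi ij u| < `|g ij x|.
    apply: (@le_lt_trans _ _ (e1 * `|eval_form psi ij u|)); first by rewrite ler_wpM2r.
    rewrite /e1 mulrC ltr_pdivrMr; last by rewrite -invr_gt0.
    rewrite (bigD1 ij) //= mulrDr mulr1 mulrDr mulrCA divff ?gt_eqF // mulr1.
    have : 0 <= \sum_(j | j != ij) `|eval_form psi j u| / `|g j x|.
      by rewrite sumr_ge0 // => j _; rewrite divr_ge0.
    nra.
  by rewrite eq normrM (gtr0_norm e0) ltxx.
have kx' i : a i x' < k i by rewrite /k -flx'; have /andP[] := fl_gen (gx' i).
pose w := y - x'.
pose tm i := (k i - a i x') / a i w.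
have wS i : i \in S -> 0 < a i w.
  by move=> iS; rewrite aB; have := kx' i; have := ky i iS; lra.
have tmE i : i \in S -> tm i * a i w = k i - a i x'.
  by move=> iS; rewrite /tm divfK // gt_eqF // wS.
have tm0 i : i \in S -> 0 < tm i /\ tm i < 1.
  move=> iS; have w0 := wS i iS; split; first by rewrite divr_gt0 // subr_gt0.
  by rewrite ltr_pdivrMr // mul1r aB; have := ky i iS; lra.
case: (@arg_minP _ _ _ i0 (fun i => i \in S) tm i0S) => i2 i2S i2min.
set t := tm i2 in i2min.
have [t0 t1] := tm0 i2 i2S.
pose h := x' + t *: w.
have ah i : a i h = a i x' + t * a i w by rewrite aD aZ.
have hlt i : i != i2 -> a i h < k i.
  move=> ne; have [iS|] := boolP (i \in S).
    have := tmE i iS; have w0 := wS i iS.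
    have : t < tm i.
      rewrite lt_neqAle i2min // andbT; apply/eqP => te.
      have ijA : (i2, i) \in A by rewrite inE /= i2S iS eq_sym.
      have /eqP := gx'0 _ ijA; apply.
      have e2 := tmE i2 i2S; have e3 := tmE i iS; rewrite -te in e3; rewrite -/t in e2.
      have Ye j : t * a j w = k j - a j x' -> Y j = (1 - t) * a j w.
        by move=> e4; rewrite mulrBl e4 mul1r /Y /w aB; ring.
      by rewrite /g /= !Ye // -e2 -e3; ring.
    by rewrite ah; nra.
  rewrite inE -leNgt => Kle; rewrite ah.
  have ylt : a i y < k i.
    have /andP[_ l] := fl_gen (gy i); apply: lt_le_trans l _; rewrite /k ler_int.
    by move: Kle; rewrite /K; lia.
  have p1 : 0 < (1 - t) * (k i - a i x') by rewrite mulr_gt0 // subr_gt0.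
  have p2 : 0 < t * (k i - a i y) by rewrite mulr_gt0 // subr_gt0.
  by rewrite /w aB; lra.
have h2 : a i2 h = k i2 by rewrite ah tmE //; ring.
have hgt i : i != ropp i2 -> (fl i x)%:~R < a i h.
  move=> ne; have : ropp i != i2 by apply: contraNneq ne => <-; rewrite oppK.
  move/hlt; rewrite a_opp /k fl_opp // rmorphD rmorphB rmorphN /=; lra.
have hint i : a i h \is a Num.int -> i = i2 \/ i = ropp i2.
  move=> hi; case: (eqVneq i i2) => [|n1]; first by left.
  case: (eqVneq i (ropp i2)) => [|n2]; first by right.
  have := hlt i n1; have := hgt i n2; rewrite -(floorK hi) /k !ltr_int => h3 h4.
  by case: (no_int_between h3 h4).
have w2 := wS i2 i2S.
pose r := nearby h w.
have gr : agen r.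
  apply: agen_nearby => i /hint[->|->]; first by rewrite gt_eqF.
  by rewrite a_opp oppr_eq0 gt_eqF.
have fr i : i != i2 -> i != ropp i2 -> fl i r = fl i x.
  move=> n1 n2; rewrite fl_nearby.
  have -> : a i h \is a Num.int = false by apply/negP => /hint[] ee; [move: n1|move: n2]; rewrite ee eqxx.
  by apply: floor_def; rewrite (ltW (hgt i n2)) hlt.
have fr2 : fl i2 r = fl i2 x + 1.
  rewrite fl_nearby ltNge (ltW w2) andbF /fl h2 /k; exact: intrKfloor.
have K2 : K i2 x r = 1 by rewrite /K fr2 addrC addKr.
have K3 : K (ropp i2) x r = -1 by rewrite K_opp // K2.
have K0 i : K i x r != 0 -> i = i2 \/ i = ropp i2.
  move=> nz; case: (eqVneq i i2) => [|n1]; first by left.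
  case: (eqVneq i (ropp i2)) => [|n2]; first by right.
  by move: nz; rewrite /K fr // subrr eqxx.
exists r; split=> //.
- split=> [i j /K0 hi /K0 hj|i].
    case: hi => ->; case: hj => ->; rewrite ?oppK; auto.
  case: (eqVneq (K i x r) 0) => [->//|/K0[]->]; by rewrite ?K2 ?K3.
- move=> i; case: (eqVneq (K i x r) 0) => [->|/K0[]->]; rewrite ?mul0r //.
    rewrite K2 mul1r; have := K_tri i2 x r y; move: i2S; rewrite inE K2; lia.
  have := K_tri (ropp i2) x r y; rewrite K3 (K_opp _ gx gy); move: i2S; rewrite inE; lia.
- by exists i2; rewrite K2.
Qed.

Definition astep_rel y r s := [/\ agen r, agen s, adj r s, abtw r s y & exists i, K i r s != 0].

(** Iterates [first_step], each step lowering the distance to [y]; the gallery ends at some point of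
    the alcove of [y]. *)
Lemma gallery x y : agen x -> agen y ->
  exists2 y', agen y' /\ (forall i, fl i y' = fl i y) & clos_refl_trans_1n _ (astep_rel y) x y'.
Proof.
move=> gx gy; have [N] := ubnP (dist x y); elim: N x gx => // N IH x gx; rewrite ltnS => hN.
case: (eqVneq (dist x y) 0%N) => [/K0_dist z|nz].
  exists x; last exact: rt1n_refl.
  by split=> // i; have := z i; rewrite /K; lia.
have [r [gr ad ab ne]] : exists r, [/\ agen r, adj x r, abtw x r y & exists i, K i x r != 0].
  apply: first_step => //; move: nz; rewrite sum_nat_eq0 => /forallPn[i].
  by rewrite /= absz_eq0 => h; exists i.
have [|y' hy c] := IH r gr.
  apply: leq_trans hN; rewrite -(dist_abtw ab) -[X in (X < _)%N]add0n ltn_add2r.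
  by case: ne => i; rewrite lt0n sum_nat_eq0 => ne; apply/forallPn; exists i; rewrite /= absz_eq0.
by exists y' => //; apply: Relation_Operators.rt1n_trans c.
Qed.

End Alcoves.

Lemma int_btw (k1 k2 k3 : int) : 0 <= k1 * k2 -> 0 <= (k1 + k2) * k3 -> 0 <= k1 * (k2 + k3).
Proof.
move=> h1 h2; case: (ltgtP k1 0) => [lt|gt|->]; last by rewrite mul0r.
  have k20 : k2 <= 0 by move: h1; rewrite nmulr_rge0.
  have : k3 <= 0 by move: h2; rewrite nmulr_rge0 //; lia.
  nia.
have k20 : 0 <= k2 by move: h1; rewrite pmulr_rge0.
have : 0 <= k3 by move: h2; rewrite pmulr_rge0 //; lia.
nia.
Qed.

Lemma sgr_neq (F : realDomainType) (u v : F) : u != 0 -> v != 0 ->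
  (Num.sg u != Num.sg v) = ((u < 0) != (v < 0)).
Proof.
have h : (1 : F) == -1 = false by apply/negbTE; rewrite gt_eqF // (lt_trans (ltrN10 _)).
by case: (sgrP u) => // _ _; case: (sgrP v) => // _ _; rewrite ?eqxx ?h // eq_sym h.
Qed.

(** * Alcoves of minimal displacement *)
Section AffineGroup.
Variable n : nat.
Implicit Types (y z w : aff n).

Lemma amulA y z w : amul y (amul z w) = amul (amul y z) w.
Proof. by rewrite /amul /= mulmxDl !mulmxA addrA. Qed.
Lemma amul1 y : amul y (aone n) = y.
Proof. by case: y => l A; rewrite /amul /aone /= mul0mx add0r mul1mx. Qed.
Lemma mul1a y : amul (aone n) y = y.
Proof. by case: y => l A; rewrite /amul /aone /= !mulmx1 addr0. Qed.
Lemma amulV y : y.2 \in unitmx -> amul y (ainv y) = aone n.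
Proof. by move=> u; rewrite /amul /ainv /= mulNmx mulmxKV // addNr mulVmx. Qed.
Lemma amulVx y : y.2 \in unitmx -> amul (ainv y) y = aone n.
Proof. by move=> u; rewrite /amul /ainv /= addrN mulmxV. Qed.
Lemma apowS y m : amul (apow y m) y = apow y m.+1.
Proof. by elim: m => [|m IH] /=; rewrite ?mul1a ?amul1 // -amulA IH. Qed.

Variable R : realFieldType.
Implicit Types (x : 'rV[R]_n).
Lemma act_mul y z x : act (amul y z) x = act y (act z x).
Proof. by rewrite /act /amul /= toRD !toRM mulmxDl !mulmxA addrA. Qed.
Lemma act_one x : act (aone n) x = x.
Proof. by rewrite /act /aone /= toR1 mulmx1 (_ : toR R 0 = 0) ?addr0 //; apply/rowP => k; rewrite !mxE. Qed.
Lemma actD y x u : act y (x + u) = act y x + u *m toR R y.2.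
Proof. by rewrite /act mulmxDl addrAC. Qed.
End AffineGroup.

(** * Displacement of alcoves under an affine map *)

Section Action.
Variables (F : realType) (n : nat) (I : finType) (D : RD n I).
Hypothesis HD : is_based_root_datum D.
Local Notation rt := (root D).
Local Notation ropp := (root_opp HD).
Local Notation raut := (raut D).
Local Notation a := (root_val D).
Local Notation fl := (root_floor D).
Local Notation K := (floor_jump D).
Local Notation agen := (agen D).
Local Notation dist := (floor_dist D).
Local Notation abtw := (abtw D).
Local Notation adj := (adj HD).
Local Notation nearby := (nearby D).
Local Notation acl := (acl D).
Implicit Types (x h w r s u v : 'rV[F]_n).

Section One.
Variables (y : aff n) (p : {perm I}).
Hypothesis ry : raut p y.2.

Lemma a_act i x : a (p i) (act y x) = a i x + (ipair y.1 (rt (p i)))%:~R.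
Proof. by rewrite /act aD a_toR /root_val (raut_pairR _ _ ry). Qed.
Lemma a_z i x : a (p i) (x *m toR F y.2) = a i x.
Proof. exact: raut_pairR. Qed.
Lemma fl_act i x : fl (p i) (act y x) = fl i x + ipair y.1 (rt (p i)).
Proof. by rewrite /root_floor a_act floorDrz ?intr_int // intrKfloor. Qed.
Lemma K_act i x x' : K (p i) (act y x) (act y x') = K i x x'.
Proof. by rewrite /floor_jump !fl_act; lia. Qed.
Lemma int_act i x : (a (p i) (act y x) \is a Num.int) = (a i x \is a Num.int).
Proof. by rewrite a_act rpredDr // intr_int. Qed.
Lemma agen_act x : agen x -> agen (act y x).
Proof. by move=> g i; rewrite -[i](permKV p) int_act. Qed.
Lemma dist_act x x' : dist (act y x) (act y x') = dist x x'.
Proof.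
rewrite /floor_dist (reindex_inj (@perm_inj _ p)).
by apply: eq_bigr => i _; rewrite K_act.
Qed.
End One.

Lemma raut_ainv p (y : aff n) : raut p y.2 -> raut p^-1 (ainv y).2.
Proof. exact: raut_inv. Qed.
Lemma raut_amul p q (y z : aff n) : raut p y.2 -> raut q z.2 -> raut (q * p) (amul y z).2.
Proof. by move=> ry rz; exact: raut_mul. Qed.

Lemma fl_same_abtw x x' w : (forall i, fl i x = fl i x') -> abtw x x' w.
Proof. by move=> e i; rewrite /floor_jump e subrr mul0r. Qed.

Definition disp (y : aff n) x := dist x (act y x).
Definition aMin y x := agen x /\ forall x', agen x' -> (disp y x <= disp y x')%N.
Definition alink y x x' := [/\ aMin y x, aMin y x' & adj x x'].
Definition aconn y := clos_refl_sym_trans _ (alink y).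

Lemma adj_same x x' : (forall i, fl i x = fl i x') -> adj x x'.
Proof. by move=> e; split=> [i j|i]; rewrite /floor_jump e subrr // eqxx. Qed.

Section Pursuit.
Variables (y : aff n) (p : {perm I}).
Hypothesis ry : raut p y.2.

Lemma act_inv x : act (ainv y) (act y x) = x.
Proof. by rewrite -act_mul amulVx ?act_one //; case: ry. Qed.

Lemma disp_le x x' : abtw x x' (act y x) \/ abtw x x' (act (ainv y) x) ->
  (disp y x' <= disp y x)%N.
Proof.
have flip u : disp y u = dist u (act (ainv y) u).
  rewrite /disp -(dist_act (raut_ainv ry)) act_inv /floor_dist.
  by apply: eq_bigr => i _; rewrite /floor_jump; lia.
case=> /dist_abtw e.
  rewrite /disp; apply: (leq_trans (dist_tri _ _ (act y x) _)).
  by rewrite (dist_act ry) addnC e.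
rewrite !flip; apply: (leq_trans (dist_tri _ _ (act (ainv y) x) _)).
by rewrite (dist_act (raut_ainv ry)) addnC e.
Qed.

Lemma aMin_le x x' : aMin y x -> agen x' -> (disp y x' <= disp y x)%N -> aMin y x'.
Proof. by move=> [_ m] g le; split=> // s gs; apply: leq_trans le (m s gs). Qed.

Lemma gallery_conn x x' : agen x -> agen x' ->
  (forall s, agen s -> abtw x s x' -> aMin y s) -> aconn y x x'.
Proof.
move=> gx gx' h; have [x2 [g2 e2] c] := gallery HD gx gx'.
have ends : abtw x x' x' by move=> i; rewrite /floor_jump subrr mulr0.
elim: c gx h ends g2 e2 => [s|s r t [gs gr ad ab _] _ IH] gx h ends g2 e2.
  apply: rst_step; split; [apply: h => // i|exact: h|exact: adj_same].
  by rewrite /floor_jump subrr mul0r.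
have Ms : aMin y s by apply: h => // i; rewrite /floor_jump subrr mul0r.
apply: rst_trans (rst_step _ _ s r _) _; first by split=> //; exact: h.
apply: IH => //.
- by move=> u gu abu; apply: h => //; exact: abtw_trans ab abu.
- by move=> i; rewrite /floor_jump subrr mulr0.
Qed.

(** An alcove between [x] and [x'] is also between [x] and the target, so the same estimate makes
    every alcove of a gallery from [x] to [x'] minimal. *)
Lemma apursuit x x' : aMin y x -> agen x' ->
  abtw x x' (act y x) \/ abtw x x' (act (ainv y) x) -> aMin y x' /\ aconn y x x'.
Proof.
move=> Mx gx' b.
have sub w s : abtw x x' w -> abtw x s x' -> abtw x s w.
  move=> h1 h2 i; have := h1 i; have := h2 i.
  rewrite -(K_tri D i s x' w) -(K_tri D i x s x'); exact: int_btw.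
have M s : agen s -> abtw x s x' -> aMin y s.
  move=> gs h; apply: (aMin_le Mx gs); apply: disp_le.
  by case: b => b; [left|right]; exact: sub b h.
split; last by apply: gallery_conn => //; exact: Mx.1.
by apply: M => // i; rewrite /floor_jump subrr mulr0.
Qed.

Lemma aMin_same x x' : aMin y x -> agen x' -> (forall i, fl i x = fl i x') ->
  aMin y x' /\ aconn y x x'.
Proof. by move=> Mx gx' e; apply: apursuit => //; left; exact: fl_same_abtw. Qed.

End Pursuit.

(** * Minimal alcoves around the fixed affine space *)

Section Minimal.
Variables (y : aff n) (p : {perm I}) (m : nat) (lm : 'rV[int]_n).
Hypothesis ry : raut p y.2.
Hypothesis m_gt0 : (0 < m)%N.
Hypothesis ym : apow y m = (lm, 1%:M).

Let z := toR F y.2.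
Let zi := toR F (invmx y.2).
Definition newton_avg : 'rV[F]_n := m%:R^-1 *: toR F lm.
Local Notation nu := newton_avg.

Lemma zK : z *m zi = 1%:M.
Proof. by rewrite /z /zi -toRM mulmxV ?toR1 //; case: ry. Qed.
Lemma ziK : zi *m z = 1%:M.
Proof. by rewrite /z /zi -toRM mulVmx ?toR1 //; case: ry. Qed.

Let phi i : 'cV[F]_n := (toR F (rt i))^T.
Lemma phi_p i : z *m phi (p i) = phi i.
Proof. by rewrite /z /phi -!toRT -toRM; case: ry => _ _ ->. Qed.

Lemma lm_z : lm *m y.2 = lm.
Proof.
have := apowS y m; rewrite /= ym /amul /= => /(congr1 fst) /=.
by rewrite mulmx1 addrC => /addIr.
Qed.
Lemma nu_z : nu *m z = nu.
Proof. by rewrite /newton_avg -scalemxAl /z -toRM lm_z. Qed.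

Lemma raut_apow k : raut (p ^+ k)%g (apow y k).2.
Proof.
elim: k => [|k IH]; first exact: raut1.
by rewrite expgSr; exact: raut_amul.
Qed.
Lemma p_period : (p ^+ m = 1)%g.
Proof. by apply: (raut_uniq HD (A := 1%:M)); [have := raut_apow m; rewrite ym|exact: raut1]. Qed.

(** [m] times the pairing of the Newton point with the root, kept as an integer. *)
Definition drift i : int := ipair lm (rt i).
Lemma a_nu i : m%:R * a i nu = (drift i)%:~R.
Proof. by rewrite /newton_avg aZ mulrA divff ?mul1r ?a_toR // pnatr_eq0 -lt0n. Qed.
Lemma a_nu0 i : (a i nu == 0) = (drift i == 0).
Proof.
rewrite -(intr_eq0 F (drift i)) -a_nu mulf_eq0 pnatr_eq0 eqn0Ngt m_gt0 //.
Qed.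
Lemma drift_p i : drift (p i) = drift i.
Proof. by rewrite /drift -{1}lm_z (raut_pair _ _ ry). Qed.
Lemma drift_pk k i : drift ((p ^+ k)%g i) = drift i.
Proof. by elim: k => [|k IH]; rewrite ?expg0 ?perm1 // expgSr permM drift_p. Qed.

Lemma act_period x : act (apow y m) x = x + toR F lm.
Proof. by rewrite ym /act /= toR1 mulmx1. Qed.

(** Telescoping along the orbit from [x] to [y^m x = x + lm]: the step number [k] as seen by [i] is
    the first step as seen by the [k]-th preimage of [i]. *)
Lemma sum_K i x : \sum_(k < m) K ((p ^+ k)^-1%g i) x (act y x) = drift i.
Proof.
have -> : drift i = K i x (act (apow y m) x).
  rewrite act_period /floor_jump /root_floor aD a_toR floorDrz ?intr_int // intrKfloor.
  by rewrite addrAC subrr add0r.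
elim: (m) => [|k IH]; first by rewrite big_ord0 act_one /floor_jump subrr.
rewrite big_ord_recr /= IH -[RHS](K_tri D i x (act (apow y k) x)); congr (_ + _).
rewrite -[amul y _]/(apow y k.+1) -apowS act_mul.
by rewrite -[in RHS](permKV (p ^+ k)%g i) (K_act (raut_apow k)).
Qed.

Lemma reindex_pk (B : {set I}) (G : I -> nat) k : stable p B ->
  (\sum_(i in B) G i = \sum_(i in B) G ((p ^+ k)^-1%g i))%N.
Proof.
move=> st; rewrite [RHS](reindex_inj (@perm_inj _ (p ^+ k)%g)); apply: eq_big => [i|i _]; last by rewrite permK.
by elim: k => [|k ->]; rewrite ?expg0 ?perm1 // expgSr permM st.
Qed.

Lemma sum_average (B : {set I}) x : stable p B ->
  (m * \sum_(i in B) `|K i x (act y x)| = \sum_(i in B) \sum_(k < m) `|K ((p ^+ k)^-1%g i) x (act y x)|)%N.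
Proof.
move=> st; rewrite exchange_big /= -[m in LHS]card_ord -sum_nat_const.
by apply: eq_bigr => k _; exact: reindex_pk.
Qed.

Lemma absz_sum (T : Type) (r : seq T) (G : T -> int) :
  (`|(\sum_(i <- r) G i)%R| <= \sum_(i <- r) `|G i|)%N.
Proof.
elim: r => [|i r IH]; first by rewrite !big_nil.
rewrite !big_cons; apply: leq_trans (leq_add (leqnn _) IH).
by move: (G i) (\sum_(j <- r) G j) => u v; lia.
Qed.

(** Averaging over the powers of [p] and the triangle inequality in [sum_K] bound the displacement
    seen by a stable set of roots from below by the drifts. *)
Lemma sum_K_ge (B : {set I}) x : stable p B ->
  (\sum_(i in B) `|drift i| <= m * \sum_(i in B) `|K i x (act y x)|)%N.
Proof.
move=> st; rewrite sum_average //; apply: leq_sum => i _.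
by rewrite -(sum_K i x); exact: absz_sum.
Qed.

Lemma absz_sum_eq (T : Type) (r : seq T) (c : int) (G : T -> int) : (forall k, 0 <= c * G k) ->
  c != 0 -> `|(\sum_(i <- r) G i)%R|%N = (\sum_(i <- r) `|G i|)%N.
Proof.
move=> h c0; suff [e _] : `|(\sum_(i <- r) G i)%R|%N = (\sum_(i <- r) `|G i|)%N /\ 0 <= c * \sum_(i <- r) G i by [].
elim: r => [|k r [e s]]; first by rewrite !big_nil mulr0.
rewrite !big_cons -e; move: s (h k); move: (G k) (\sum_(i <- r) G i) => u w; clear -c0; nia.
Qed.

Definition inVy v := act y v = v + nu.
Definition driftless := [set i | drift i == 0].

(* [perp i] : the root [i] vanishes on the fixed space of [z] *)
Definition perp i := \sum_(k < m) rt ((p ^+ k)%g i) == 0.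

Lemma perp_p i : perp (p i) = perp i.
Proof.
rewrite /perp; congr (_ == 0); case: (m) m_gt0 p_period => // k _ pk.
rewrite big_ord_recr [RHS]big_ord_recl /= addrC; congr (_ + _).
  by rewrite -permM -expgS pk expg0.
by apply: eq_bigr => j _; rewrite -permM -expgS.
Qed.

Lemma perp_fix i u : perp i -> u *m z = u -> a i u = 0.
Proof.
move=> /eqP pe uz.
have e k : a ((p ^+ k)%g i) u = a i u.
  by elim: k => [|k IH]; rewrite ?expg0 ?perm1 // expgSr permM -{1}uz (a_z ry).
have : \sum_(k < m) a ((p ^+ k)%g i) u = 0 by rewrite /root_val -pairR_sumr pe pairRE big1 // => k _; rewrite mxE mulr0.
rewrite (eq_bigr (fun=> a i u)) => [|k _]; last exact: e.
rewrite sumr_const card_ord => /eqP; rewrite mulrn_eq0 => /orP[|/eqP //].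
by rewrite eqn0Ngt m_gt0.
Qed.

Lemma perp_ker i x : perp i -> \sum_(k < m) a ((p ^+ k)%g i) x = 0.
Proof.
by move=> /eqP pe; rewrite /root_val -pairR_sumr pe pairRE big1 // => k _; rewrite mxE mulr0.
Qed.

Definition zpow k := toR F (apow y k).2.
Lemma zpowS k : zpow k *m z = zpow k.+1. Proof. by rewrite /zpow /z -toRM. Qed.
Lemma zpowSr k : z *m zpow k = zpow k.+1. Proof. by rewrite /zpow /z -toRM -apowS. Qed.
Lemma zpow0 : zpow 0 = 1%:M. Proof. exact: toR1. Qed.
Lemma zpowm : zpow m = 1%:M. Proof. by rewrite /zpow ym toR1. Qed.
Lemma a_zpow k i x : a ((p ^+ k)%g i) (x *m zpow k) = a i x.
Proof. exact: raut_pairR (raut_apow k). Qed.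

Definition orbit_sum x : 'rV[F]_n := \sum_(k < m) x *m zpow k.
Lemma orbit_sum_fix x : orbit_sum x *m z = orbit_sum x.
Proof.
rewrite /orbit_sum mulmx_suml; case: (m) m_gt0 zpowm => // k _ zk.
rewrite big_ord_recr [RHS]big_ord_recl /= addrC; congr (_ + _).
  by rewrite -mulmxA zpowS zk zpow0.
by apply: eq_bigr => j _; rewrite -mulmxA zpowS.
Qed.

Lemma sum_period (G : nat -> F) : G m = G 0%N ->
  \sum_(k < m) G (m - k)%N = \sum_(k < m) G k.
Proof.
case: (m) => [|k] e; first by rewrite !big_ord0.
rewrite [LHS]big_ord_recl [RHS]big_ord_recl /= subn0 e; congr (_ + _).
rewrite (reindex_inj rev_ord_inj); apply: eq_bigr => j _ /=; congr G.
by rewrite /bump /=; have := ltn_ord j; lia.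
Qed.

Lemma not_perp i : ~~ perp i -> exists2 u, u *m z = u & a i u != 0.
Proof.
move=> np; have [x nx] : exists x : 'rV[F]_n, pairR x (\sum_(k < m) rt ((p ^+ k)%g i)) != 0.
  apply: contrapT => h; case/eqP: np; apply: (@pairR0_eq0 F) => x; apply/eqP/negPn/negP => nz; apply: h; by exists x.
exists (orbit_sum x); first exact: orbit_sum_fix.
rewrite (_ : a i (orbit_sum x) = pairR x (\sum_(k < m) rt ((p ^+ k)%g i))) // pairR_sumr /orbit_sum /root_val pairR_sum.
rewrite -(@sum_period (fun k => pairR x (rt ((p ^+ k)%g i)))) ?p_period //.
apply: eq_bigr => k _; rewrite -[RHS](a_zpow k) /root_val -permM -expgD subnK ?p_period ?perm1 //.
exact: ltnW.
Qed.

Lemma generic_fix : exists2 u, u *m z = u & forall i, ~~ perp i -> a i u != 0.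
Proof.
have [|u v c hu hv|i|u uz h] := @avoid F n I phi (fun u => u *m z = u) [set i | ~~ perp i].
- by rewrite mul0mx.
- by rewrite mulmxDl -scalemxAl hu hv.
- by rewrite inE => /not_perp.
- by exists u => // i np; apply: h; rewrite inE.
Qed.

Lemma VpD v u : u *m z = u -> inVy v -> inVy (v + u).
Proof. by move=> uz hv; rewrite /inVy actD -/z uz hv addrAC. Qed.
Lemma VpB v v' : inVy v -> inVy v' -> (v' - v) *m z = v' - v.
Proof.
move=> hv hv'; have := hv'; rewrite /inVy -{1}(subrK v v') addrC actD -/z hv.
by rewrite addrAC => /addIr e; apply: (addrI v); rewrite e addrC subrK.
Qed.

(* the barycentre of the orbit of [x] under [v -> y v - nu] *)
Definition drift_orbit k x := act (apow y k) x - k%:R *: nu.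
Definition barycentre x : 'rV[F]_n := m%:R^-1 *: \sum_(k < m) drift_orbit k x.

Lemma drift_orbit_fix k x : act y (drift_orbit k x) = drift_orbit k.+1 x + nu.
Proof.
rewrite /drift_orbit actD -act_mul mulNmx -scalemxAl nu_z.
by rewrite -natr1 scalerDl scale1r opprD addrA subrK.
Qed.
Lemma mR : m%:R != 0 :> F. Proof. by rewrite pnatr_eq0 -lt0n. Qed.
Lemma drift_orbit_m x : drift_orbit m x = drift_orbit 0 x.
Proof.
by rewrite /drift_orbit act_period /= act_one scale0r subr0 /newton_avg scalerA divff ?mR // scale1r addrK.
Qed.

Lemma barycentre_inVy x : inVy (barycentre x).
Proof.
have e : m%:R *: act y (barycentre x) = m%:R *: (barycentre x + nu).
  rewrite /act scalerDr scalemxAl /barycentre scalerA divff ?mR // scale1r.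
  have -> : m%:R *: toR F y.1 = \sum_(k < m) toR F y.1 by rewrite sumr_const card_ord scaler_nat.
  rewrite mulmx_suml -big_split /=.
  rewrite (eq_bigr (fun k : 'I_m => drift_orbit k.+1 x + nu)) => [|k _]; last by rewrite -drift_orbit_fix.
  rewrite big_split /= scalerDr scalerA divff ?mR // scale1r; congr (_ + _).
    case: (m) m_gt0 (drift_orbit_m x) => // k _ ek; rewrite big_ord_recr [RHS]big_ord_recl /= ek addrC.
    by congr (_ + _); apply: eq_bigr => j _.
  by rewrite sumr_const card_ord scaler_nat.
by have := congr1 (fun v => m%:R^-1 *: v) e; rewrite !scalerA mulVf ?mR // !scale1r.
Qed.

Lemma baryD x u : u *m z = u -> barycentre (x + u) = barycentre x + u.
Proof.
move=> uz; have uk k : u *m zpow k = u.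
  by elim: k => [|k IH]; rewrite ?zpow0 ?mulmx1 // -zpowS mulmxA IH.
have e k : drift_orbit k (x + u) = drift_orbit k x + u by rewrite /drift_orbit actD -/(zpow k) uk addrAC.
rewrite /barycentre (eq_bigr (fun k : 'I_m => drift_orbit k x + u)) => [|k _]; last exact: e.
by rewrite big_split /= sumr_const card_ord -[u *+ m]scaler_nat scalerDr scalerA mulVf ?mR // scale1r.
Qed.

Variable v0 : 'rV[F]_n.
Hypothesis Vv0 : inVy v0.

(* the hyperplanes containing the fixed affine space *)
Definition Aset := [set i | perp i && (a i v0 \is a Num.int)].

Lemma Aset_Z i : i \in Aset -> drift i = 0.
Proof.
rewrite inE => /andP[/perp_fix/(_ nu_z) h _].
by apply/eqP; rewrite -a_nu0 h.
Qed.
Lemma Aset_stable : stable p Aset.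
Proof.
apply: stable_sub => i iA; have k0 := Aset_Z iA; move: iA; rewrite !inE => /andP[pe iv].
rewrite perp_p pe /=; have := int_act ry i v0; rewrite iv Vv0 aD.
have /eqP -> : a (p i) nu == 0 by rewrite a_nu0 drift_p k0.
by rewrite addr0.
Qed.
Lemma Aset_elliptic : elliptic phi p m Aset.
Proof. by move=> i x; rewrite inE => /andP[pe _]; exact: perp_ker. Qed.

Lemma Aset_val i v : i \in Aset -> inVy v -> a i v = a i v0.
Proof.
rewrite inE => /andP[pe _] hv; apply/eqP; rewrite -subr_eq0 -aB; apply/eqP.
by apply: perp_fix => //; exact: VpB.
Qed.

(** Points of the fixed affine space lying on no hyperplane except those containing the whole space;
    the alcoves around them are the chambers of [Aset]. *)
Definition reg v := inVy v /\ forall i, i \notin Aset -> a i v \isn't a Num.int.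

Lemma reg_int v i : reg v -> (a i v \is a Num.int) = (i \in Aset).
Proof.
move=> [hv h]; apply/idP/idP; first by apply: contraLR; exact: h.
by move=> iA; rewrite (Aset_val iA hv); move: iA; rewrite inE => /andP[].
Qed.

Lemma reg_step v u e : inVy v -> u *m z = u -> (forall i, ~~ perp i -> a i u != 0) ->
  0 < e -> e <= astep D v u -> reg (v + e *: u).
Proof.
move=> hv uz hu e0 he; have hv' : inVy (v + e *: u) by apply: VpD => //; rewrite -scalemxAl uz.
split=> // i niA; rewrite int_step //; apply/negP => /andP[vi /eqP ui].
move/negP: niA; apply; rewrite inE.
case: (boolP (perp i)) => [pe|/hu]; last by rewrite ui eqxx.
have -> : a i v0 = a i v by apply/eqP; rewrite -subr_eq0 -aB perp_fix //; exact: VpB.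
by [].
Qed.

Lemma reg_ex v : inVy v -> exists u, [/\ u *m z = u, reg (nearby v u) & forall i, ~~ perp i -> a i u != 0].
Proof.
move=> hv; have [u uz hu] := generic_fix; exists u; split=> //.
by apply: reg_step => //; exact: astep_gt0.
Qed.

Local Notation sg := (sg phi).
Local Notation Min := (Min phi z Aset).

Lemma agen_star v r : reg v -> gen phi Aset r -> agen (nearby v r).
Proof. by move=> rv gr; apply: agen_nearby => i; rewrite (reg_int _ rv) => /gr. Qed.

Lemma fl_star v r i : reg v -> fl i (nearby v r) = fl i v - ((i \in Aset) && (a i r < 0))%:Z.
Proof. by move=> rv; rewrite fl_nearby (reg_int _ rv); case: ifP => _; rewrite ?subr0. Qed.

Lemma fl_star_act v r i : reg v ->
  fl i (act y (nearby v r)) = fl i (act y v) - ((i \in Aset) && (a i (r *m z) < 0))%:Z.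
Proof.
move=> rv; rewrite -[i](permKV p) !(fl_act ry) (fl_star _ _ rv) Aset_stable (a_z ry); lia.
Qed.

Lemma fl_act_inVy v i : inVy v -> drift i = 0 -> fl i (act y v) = fl i v.
Proof.
move=> hv k0; have /eqP h : a i nu == 0 by rewrite a_nu0 k0.
by rewrite hv /root_floor aD h addr0.
Qed.

Lemma K_star v r i : reg v -> i \in Aset -> gen phi Aset r ->
  `|K i (nearby v r) (act y (nearby v r))|%N = (sg i r != sg i (r *m z)).
Proof.
move=> rv iA gr; rewrite /floor_jump fl_star_act // fl_star // (fl_act_inVy (proj1 rv) (Aset_Z iA)) iA /=.
have r0 : a i r != 0 by exact: gr.
have rz0 : a i (r *m z) != 0.
  by rewrite -[i](permKV p) (a_z ry); apply: gr; rewrite (stableV Aset_stable).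
rewrite (sgr_neq r0 rz0); case: (a i r < 0); case: (a i (r *m z) < 0) => /=; lia.
Qed.

(** Walls through [v] see the linear part acting on the direction [r]; all others see only [v] and
    its image. *)
Lemma disp_star v r : reg v -> gen phi Aset r ->
  (disp y (nearby v r) = \sum_(i in ~: Aset) `|K i v (act y v)| + sepn phi Aset r (r *m z))%N.
Proof.
move=> rv gr; rewrite /disp /floor_dist (bigID (fun i => i \in Aset)) /= addnC; congr addn.
  apply: eq_big => [i|i niA]; first by rewrite in_setC.
  by rewrite /floor_jump fl_star_act // fl_star // (negPf niA) /= !subr0.
by apply: eq_bigr => i iA; rewrite K_star.
Qed.

Definition outer_disp := (\sum_(i in ~: driftless) `|drift i|)%N.

(** [y] moves a point of the fixed affine space by [nu], so all terms of [sum_K] have the sign of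
    the drift and the triangle inequality is an equality; roots without drift contribute nothing. *)
Lemma outer_reg v : inVy v -> (m * \sum_(i in ~: Aset) `|K i v (act y v)| = outer_disp)%N.
Proof.
move=> hv; have stC : stable p (~: driftless) by move=> i; rewrite !inE drift_p.
have -> : (\sum_(i in ~: Aset) `|K i v (act y v)| = \sum_(i in ~: driftless) `|K i v (act y v)|)%N.
  rewrite [LHS](big_setID (~: driftless)) /= (setIidPr _); last first.
    apply/subsetP => i; rewrite !inE; apply: contra => iA.
    by have /Aset_Z -> : i \in Aset by rewrite inE.
  rewrite [X in (_ + X)%N]big1 ?addn0 // => i; rewrite !inE negbK => /andP[/eqP k0 _].
  by rewrite /floor_jump fl_act_inVy // subrr.
rewrite sum_average //; apply: eq_bigr => i; rewrite !inE => k0.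
rewrite -(sum_K i v) (absz_sum_eq _ (c := drift i)) // => k.
set j := ((p ^+ k)^-1%g i); have -> : drift i = drift j by rewrite -[i](permKV (p ^+ k)%g) drift_pk.
rewrite hv /floor_jump /root_floor aD; have := a_nu j; have m0 : 0 < m%:R :> F by rewrite ltr0n.
case: (ltgtP (drift j) 0) => [lt e|gt e|-> _]; last by rewrite mul0r.
  rewrite nmulr_rge0 // subr_le0; apply: le_floor; rewrite gerDl -(pmulr_rle0 _ m0) e lerz0.
  exact: ltW.
rewrite pmulr_rge0 // subr_ge0; apply: le_floor; rewrite lerDl -(pmulr_rge0 _ m0) e ler0z.
exact: ltW.
Qed.

(** If the hyperplane of [i] through [v] separates the two directions, it separates [x] from its
    image; that pair may be separated by further hyperplanes of [i]. *)
Lemma sepn_le x v : inVy v -> agen x ->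
  gen phi Aset (x - v) /\
  (sepn phi Aset (x - v) ((x - v) *m z) <= \sum_(i in Aset) `|K i x (act y x)|)%N.
Proof.
move=> hv gx.
have vi i : i \in Aset -> a i v \is a Num.int.
  by move=> iA; rewrite (Aset_val iA hv); move: iA; rewrite inE => /andP[].
have g : gen phi Aset (x - v).
  move=> i iA; rewrite -[eval_form _ _ _]/(a i (x - v)) aB subr_eq0; apply: contraTneq (gx i) => ->.
  by rewrite vi.
split=> //; apply: leq_sum => i iA.
have r0 : a i (x - v) != 0 by exact: g.
have rz0 : a i ((x - v) *m z) != 0.
  by rewrite -[i](permKV p) (a_z ry); apply: g; rewrite (stableV Aset_stable).
case: (eqVneq (K i x (act y x)) 0) => [K0|]; last by rewrite -absz_gt0; case: (_ != _).
rewrite K0 absz0 leqn0 eqb0 negbK.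
have e1 : a i x = a i v + a i (x - v) by rewrite aB addrC subrK.
have e2 : a i (act y x) = a i v + a i ((x - v) *m z).
  have /eqP n0 : a i nu == 0 by rewrite a_nu0 Aset_Z.
  by rewrite -{1}(subrK v x) addrC actD aD hv aD n0 addr0.
rewrite -[_ == _]negbK (sgr_neq r0 rz0) negbK.
move: K0; rewrite /floor_jump /root_floor e1 e2 !(floorDzr (vi i iA)) => /eqP.
rewrite subr_eq0 => /eqP /addrI e.
by rewrite -floor_lt0 -e floor_lt0.
Qed.

Lemma phi_neq0 i : phi i != 0.
Proof.
apply/eqP => h; have /eqP := rt_neq0 HD i; apply; apply: (@toR_inj F); apply: trmx_inj.
by rewrite -/(phi i) h; apply/matrixP => b c; rewrite !mxE.
Qed.

Lemma Min_ex : exists r, Min r.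
Proof. by have [x gx] := exists_gen phi_neq0 Aset; exact: exists_Min gx. Qed.

Lemma reg0_ex : exists v, reg v.
Proof. by have [u [_ h _]] := reg_ex Vv0; exists (nearby v0 u). Qed.

(** Both lower bounds are attained at once: [sepn_le] on the roots of [Aset], [sum_K_ge] on the
    roots with drift; the remaining roots see no displacement here. *)
Lemma aMin_star v r : reg v -> Min r -> aMin y (nearby v r).
Proof.
move=> rv [gr mr]; split; first exact: agen_star.
move=> x gx; rewrite disp_star // -(leq_pmul2l m_gt0) mulnDr (outer_reg (proj1 rv)).
have [gv le] := sepn_le Vv0 gx.
rewrite /disp /floor_dist (bigID (fun i => i \in Aset)) /= mulnDr addnC leq_add //.
  by rewrite leq_pmul2l //; apply: leq_trans (mr _ gv) le.
apply: (@leq_trans (m * \sum_(i in ~: driftless) `|K i x (act y x)|)%N).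
  by apply: sum_K_ge => i; rewrite !inE drift_p.
rewrite leq_pmul2l //.
rewrite [leqRHS](bigID (fun i => i \in ~: driftless)) /= (eq_bigl (fun i => (i \notin Aset) && (i \in ~: driftless))) ?leq_addr // => i.
by case: (boolP (i \in Aset)) => //= /Aset_Z; rewrite !inE => ->; rewrite eqxx.
Qed.

(** The equality case of the two bounds behind [aMin_star]. *)
Lemma aMin_char x v : inVy v -> aMin y x ->
  Min (x - v) /\ forall i, i \in driftless -> i \notin Aset -> K i x (act y x) = 0.
Proof.
move=> hv [gx mx].
have [w rw] := reg0_ex; have [r Mr] := Min_ex.
have [gv le] := sepn_le hv gx.
have := mx _ (aMin_star rw Mr).1; rewrite disp_star //; last exact: Mr.1.
rewrite -(leq_pmul2l m_gt0) mulnDr (outer_reg (proj1 rw)).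
rewrite /disp /floor_dist (bigID (fun i => i \in Aset)) /=.
rewrite [X in (_ + X)%N](bigID (fun i => i \in driftless)) /= !mulnDr.
have -> : (\sum_(i | (i \notin Aset) && (i \notin driftless)) `|K i x (act y x)| =
   \sum_(i in ~: driftless) `|K i x (act y x)|)%N.
  apply: eq_bigl => i; rewrite [RHS]inE.
  by case: (boolP (i \in Aset)) => //= /Aset_Z; rewrite inE => ->; rewrite eqxx.
have ge : (outer_disp <= m * \sum_(i in ~: driftless) `|K i x (act y x)|)%N.
  by apply: sum_K_ge => i; rewrite !inE drift_p.
have mr := Mr.2 _ gv.
set S1 := (\sum_(i in Aset) _)%N in le *; set S2 := (\sum_(i | _ && (i \in driftless)) _)%N.
set S3 := (\sum_(i in ~: driftless) _)%N in ge *.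
set s1 := sepn _ _ _ _ in le mr; set s2 := sepn _ _ _ _ in mr *.
move=> h; have hS : (m * S1 + m * S2 <= m * s2)%N by lia.
have hS' : (S1 + S2 <= s2)%N by rewrite -(leq_pmul2l m_gt0) mulnDr.
split; first by split=> // u gu; apply: leq_trans (Mr.2 u gu); rewrite -/s1 -/s2; lia.
move=> i iZ niA; have /eqP : S2 = 0%N by lia.
rewrite /S2 sum_nat_eq0 => /forallP /(_ i); rewrite niA iZ /= absz_eq0 => /eqP //.
Qed.

Lemma link_crossing x x' i : aconn y x x' -> fl i x != fl i x' ->
  exists s s', [/\ aMin y s, aMin y s', adj s s' & K i s s' != 0].
Proof.
elim=> [s s' [Ms Ms' ad] ne|s|s s' _ IH ne|s s' s'' _ IH1 _ IH2 ne].
- by exists s, s'; split=> //; rewrite /floor_jump subr_eq0 eq_sym.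
- by rewrite eqxx.
- by apply: IH; rewrite eq_sym.
- have [e|e] := eqVneq (fl i s) (fl i s'); last exact: IH1.
  by apply: IH2; rewrite -e.
Qed.

Lemma conn_necessary : (forall x x', aMin y x -> aMin y x' -> aconn y x x') ->
  forall i, drift i = 0 -> perp i \/ p i = i.
Proof.
move=> C i k0; case: (boolP (perp i)) => np; [by left|right].
have [u uz ui] := not_perp np.
have [v1 rv1] := reg0_ex.
(* Along this shift the root [i] grows by exactly 1, so the alcoves around the two regular points
   have different floors of [i]. *)
have V2 : inVy (v1 + (a i u)^-1 *: u) by apply: VpD; [rewrite -scalemxAl uz|case: rv1].
have [u2 [u2z rv2 _]] := reg_ex V2.
set v2 := nearby _ u2 in rv2.
have niA : i \notin Aset by rewrite inE (negPf np).
have n1 : a i v1 \isn't a Num.int by apply: (proj2 rv1).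
have ne : fl i v1 != fl i v2.
  have e : a i (v1 + (a i u)^-1 *: u) = a i v1 + 1 by rewrite aD aZ mulVf.
  rewrite /v2 fl_nearby e rpredDr ?int_num1 // (negPf n1) /= /root_floor e.
  by rewrite floorDrz ?int_num1 // floor1 eq_sym -subr_eq0 addrAC subrr add0r.
clearbody v2; have [r Mr] := Min_ex.
have ne' : fl i (nearby v1 r) != fl i (nearby v2 r).
  by rewrite (fl_star _ _ rv1) (fl_star _ _ rv2) (negPf niA) /= !subr0.
have [s [s' [Ms Ms' ad Ks]]] := link_crossing (C _ _ (aMin_star rv1 Mr) (aMin_star rv2 Mr)) ne'.
have iZ : p i \in driftless by rewrite inE drift_p k0.
have piA : p i \notin Aset by rewrite Aset_stable.
have z1 := (aMin_char Vv0 Ms).2 _ iZ piA.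
have z2 := (aMin_char Vv0 Ms').2 _ iZ piA.
(* By [aMin_char] the root [p i] has the same floor on a minimal alcove and on its image, so between
   [s] and [s'] it jumps exactly as [i] does. *)
have Kp : K (p i) s s' = K i s s'.
  by move: z1 z2; rewrite /floor_jump !(fl_act ry); lia.
case: ad => /(_ i (p i) Ks) ad _.
case: ad => [|//|e]; first by rewrite Kp.
exfalso; move: Kp Ks; rewrite e (K_opp HD i (proj1 Ms) (proj1 Ms')); lia.
Qed.

Lemma act_ainv_inVy v : inVy v -> act (ainv y) v = v - nu.
Proof.
move=> hv; have e : act y (v - nu) = v by rewrite actD mulNmx -/z nu_z hv addrK.
by rewrite -{1}e (act_inv ry).
Qed.

Lemma fl_star_inv v r i : reg v ->
  fl i (act (ainv y) (nearby v r)) = fl i (act (ainv y) v) - ((i \in Aset) && (a i (r *m zi) < 0))%:Z.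
Proof.
move=> rv; have ri := raut_ainv ry.
rewrite -[i](permKV p^-1%g) !(fl_act ri) (fl_star _ _ rv) (stableV Aset_stable) (a_z ri); lia.
Qed.

Lemma sg_lt0 i u w : sg i u = sg i w -> (a i u < 0) = (a i w < 0).
Proof. by move=> e; rewrite -[LHS]sgr_lt0 -[RHS]sgr_lt0; congr (_ < _). Qed.

Lemma star_link v r r' : reg v -> Min r -> Min r' -> aconn y (nearby v r) (nearby v r').
Proof.
move=> rv Mr Mr'.
have [C _] := elliptic_conn zK ziK phi_p m_gt0 phi_neq0 Aset_stable Aset_elliptic.
elim: (C r r' Mr Mr') => {r r' Mr Mr'} [r r' [Mr Mr' b]|r|r r' _|r r' r'' _ h1 _ h2].
- have [|_ //] := apursuit ry (aMin_star rv Mr) (agen_star rv Mr'.1).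
  have KN i : K i (nearby v r) (nearby v r') = ((i \in Aset) && (a i r < 0))%:Z - ((i \in Aset) && (a i r' < 0))%:Z.
    by rewrite /floor_jump !fl_star //; lia.
  case: b => b; [left|right] => i; rewrite KN; case: (boolP (i \in Aset)) => iA; rewrite ?mul0r //=.
    have [e|/(b i iA)/sg_lt0 e] := eqVneq (sg i r) (sg i r'); first by rewrite (sg_lt0 e) subrr mul0r.
    rewrite /floor_jump fl_star // fl_star_act // (fl_act_inVy (proj1 rv) (Aset_Z iA)). rewrite iA e subrr mulr0 //.
  have [e|/(b i iA)/sg_lt0 e] := eqVneq (sg i r) (sg i r'); first by rewrite (sg_lt0 e) subrr mul0r.
  rewrite /floor_jump fl_star // fl_star_inv // (act_ainv_inVy (proj1 rv)) iA e.
  have /eqP n0 : a i nu == 0 by rewrite a_nu0 Aset_Z.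
  have -> : fl i (v - nu) = fl i v by rewrite /root_floor aB n0 subr0.
  by rewrite subrr mulr0.
- exact: rst_refl.
- exact: rst_sym.
- exact: rst_trans h1 h2.
Qed.

(** Since [y h = h + nu], a wall through [h] not parallel to [nu] has the image alcove on its [nu]
    side, so turning the alcove towards [nu] is a pursuit of the image. *)
Lemma nu_pursuit h w : inVy h -> (forall i, a i h \is a Num.int -> a i w != 0) ->
  aMin y (nearby h w) ->
  aMin y (nearby h (nudge phi nu w)) /\ aconn y (nearby h w) (nearby h (nudge phi nu w)).
Proof.
move=> hv hw Mh.
have sgn i : Num.sg (a i (nudge phi nu w)) = if a i nu == 0 then Num.sg (a i w) else Num.sg (a i nu).
  exact: sg_nudge.
have lt0 i : (a i (nudge phi nu w) < 0) = if a i nu == 0 then a i w < 0 else a i nu < 0.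
  by rewrite -sgr_lt0 sgn; case: ifP => _; rewrite sgr_lt0.
apply: (apursuit ry Mh).
  apply: agen_nearby => i hi; have := nudge_eq0 phi nu w i => /= e.
  by rewrite -[a i _]/(eval_form phi i _) e negb_and -[eval_form phi i w]/(a i w) (hw i hi) orbT.
left=> i; rewrite /floor_jump !fl_nearby lt0.
case: (boolP (a i h \is a Num.int)) => hi /=; last by rewrite subrr mul0r.
case: (eqVneq (a i nu) 0) => [_|n0]; first by rewrite subrr mul0r.
have -> : fl i (act y (nearby h w)) = fl i (h + nu) - ((a ((p^-1)%g i) h \is a Num.int) && (a (p^-1 i)%g w < 0))%:Z.
  rewrite -hv -[i in LHS](permKV p) -[i in fl i (act y h)](permKV p) !(fl_act ry) fl_nearby.
  by case: ifP => _; lia.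
have hp : (a (p^-1 i)%g h \is a Num.int) = (a i (h + nu) \is a Num.int).
  by rewrite -hv -[i in RHS](permKV p) int_act.
have hE := floorK hi; rewrite -/(fl i h) in hE.
have flhn : fl i (h + nu) = fl i h + Num.floor (a i nu).
  by rewrite /root_floor aD floorDzr.
rewrite flhn hp aD (rpredDl _ hi).
have /andP[f1 f2] := floor_itv (a i nu).
case: (ltgtP (a i nu) 0) n0 => // [lt|gt] _.
  have fneg : Num.floor (a i nu) < 0 by rewrite floor_lt0.
  by case: (a i w < 0); case: (_ && _) => /=; nia.
have fpos : 0 <= Num.floor (a i nu) by rewrite floor_ge0 ltW.
have fint : a i nu \is a Num.int -> 0 < Num.floor (a i nu).
  by move=> ni; rewrite -(ltr_int F) floorK.
case: (a i w < 0) => /=; last by rewrite subrr mul0r.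
by move: (a ((p^-1)%g i) w < 0) => b; case: (boolP (a i nu \is a Num.int)) => [/fint|_] /=; case: b => /=; nia.
Qed.

(** The end points avoid the walls of [i], so the segment crosses a wall through [h] transversally,
    and the sign of the direction fixes the floors on both sides. *)
Lemma floor_cross (i : I) v v' t (h := v + t *: (v' - v)) :
  0 < t -> t <= 1 -> a i v \isn't a Num.int -> a i v' \isn't a Num.int -> (fl i v)%:~R <= a i h <= (fl i v + 1)%:~R ->
  [/\ a i h \is a Num.int -> a i (v' - v) != 0,
      fl i (nearby h (- (v' - v))) = fl i v &
      0 <= (fl i (nearby h (v' - v)) - fl i v) * (fl i v' - fl i (nearby h (v' - v)))].
Proof.
move=> t0 t1 nv nv' /andP[l1 l2].
have ah : a i h = a i v + t * a i (v' - v) by rewrite aD aZ.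
have nz : a i h \is a Num.int -> a i (v' - v) != 0.
  by move=> hi; apply: contraNneq nv => w0; rewrite ah w0 mulr0 addr0 in hi.
have /andP[g1 g2] := fl_gen nv; have /andP[g3 g4] := fl_gen nv'.
split=> //; rewrite fl_nearby; case: (boolP (a i h \is a Num.int)) => hi /=.
- have hE := floorK hi; rewrite -/(fl i h) in hE.
  rewrite -hE !ler_int in l1 l2.
  rewrite aN oppr_lt0; case: (ltgtP (a i (v' - v)) 0) (nz hi) => // [lt|gt] _.
    have : fl i h < fl i v + 1 by rewrite -(ltr_int F) hE; apply: lt_trans g2; rewrite ah; nra.
    by move: l1 l2; move: (fl i h) (fl i v) => A B; clear; lia.
  have : fl i v < fl i h by rewrite -(ltr_int F) hE; apply: lt_trans g1 _; rewrite ah; nra.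
  by move: l1 l2; move: (fl i h) (fl i v) => A B; clear; lia.
- apply: floor_def; rewrite l1 /= lt_neqAle l2 andbT.
  by apply: contraNneq hi => ->; exact: intr_int.
- have hE := floorK hi; rewrite -/(fl i h) in hE.
  rewrite -hE !ler_int in l1 l2.
  have wE : a i v' = a i v + a i (v' - v) by rewrite aB addrC subrK.
  case: (ltgtP (a i (v' - v)) 0) (nz hi) => // [lt|gt] _.
    have e : fl i h < fl i v + 1 by rewrite -(ltr_int F) hE; apply: lt_trans g2; rewrite ah; nra.
    have : fl i v' < fl i h by rewrite -(ltr_int F) hE; apply: lt_le_trans g3 _; rewrite ah wE; nra.
    by move: l1 l2 e; move: (fl i h) (fl i v) (fl i v') => A B C; clear; nia.
  have e : fl i v < fl i h by rewrite -(ltr_int F) hE; apply: lt_trans g1 _; rewrite ah; nra.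
  have : fl i h < fl i v' + 1 by rewrite -(ltr_int F) hE; apply: le_lt_trans g4; rewrite ah wE; nra.
  by move: l1 l2 e; move: (fl i h) (fl i v) (fl i v') => A B C; clear; nia.
- have -> : fl i h = fl i v.
    apply: floor_def; rewrite l1 /= lt_neqAle l2 andbT.
    by apply: contraNneq hi => ->; exact: intr_int.
  by rewrite subrr mul0r.
Qed.

Lemma fl_lex h s r i : inVy h -> (i \in Aset -> a i s = 0) ->
  (i \notin Aset -> a i h \is a Num.int -> a i s != 0) ->
  fl i (nearby h (nudge phi s r)) = fl i (nearby h s) - ((i \in Aset) && (a i r < 0))%:Z.
Proof.
move=> hv h1 h2; have sgn : Num.sg (a i (nudge phi s r)) = if a i s == 0 then Num.sg (a i r) else Num.sg (a i s).
  exact: sg_nudge.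
have lt0 : (a i (nudge phi s r) < 0) = if a i s == 0 then a i r < 0 else a i s < 0.
  by rewrite -sgr_lt0 sgn; case: ifP => _; rewrite sgr_lt0.
rewrite !fl_nearby lt0; case: (boolP (i \in Aset)) => iA /=.
  have -> : a i h \is a Num.int.
    by rewrite (Aset_val iA hv); move: iA; rewrite inE => /andP[].
  by rewrite h1 // eqxx ltxx /=; case: ifP; rewrite ?subr0.
case: (boolP (a i h \is a Num.int)) => hi /=; last by rewrite subr0.
by rewrite (negPf (h2 iA hi)) subr0.
Qed.

Lemma reg_opp v i : reg v -> (ropp i \in Aset) = (i \in Aset).
Proof. by move=> rv; rewrite -!(reg_int _ rv) agen_opp. Qed.

Lemma K_zero i v v' : reg v -> reg v' -> i \in Aset -> K i v v' = 0.
Proof.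
by move=> [hv _] [hv' _] iA; rewrite /floor_jump /root_floor (Aset_val iA hv) (Aset_val iA hv') subrr.
Qed.

(* The first point [h] of the segment from [v] to [v'] on a hyperplane not containing the fixed space *)
Lemma first_wall v v' : reg v -> reg v' -> dist v v' != 0%N ->
  exists t, [/\ 0 < t, t <= 1,
    forall i, i \notin Aset -> (fl i v)%:~R <= a i (v + t *: (v' - v)) <= (fl i v + 1)%:~R &
    exists i, [/\ i \notin Aset, a i (v + t *: (v' - v)) = (fl i v + 1)%:~R & 0 < a i (v' - v)]].
Proof.
move=> rv rv' d0.
have nA i : K i v v' != 0 -> i \notin Aset.
  by apply: contraNN => iA; rewrite K_zero.
pose S := [set i | 0 < K i v v'].
have [i0 i0S] : exists i, i \in S.
  move: d0; rewrite sum_nat_eq0 => /forallPn[i]; rewrite /= absz_eq0 => nz.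
  have [gt|le] := ltP 0 (K i v v'); first by exists i; rewrite inE.
  exists (ropp i); rewrite inE; have iA := nA _ nz.
  have n1 := proj2 rv i iA; have n2 := proj2 rv' i iA.
  by move: nz le; rewrite /floor_jump !fl_opp //; clear; lia.
pose w := v' - v.
pose tm i := ((fl i v + 1)%:~R - a i v) / a i w.
have wE i : a i v' = a i v + a i w by rewrite /w aB addrC subrK.
have SP i : i \in S -> [/\ i \notin Aset, 0 < a i w, 0 < tm i, tm i <= 1 &
    tm i * a i w = (fl i v + 1)%:~R - a i v].
  rewrite inE => Ki; have iA : i \notin Aset by apply: nA; rewrite gt_eqF.
  have /andP[g1 g2] := fl_gen (proj2 rv i iA); have /andP[g3 g4] := fl_gen (proj2 rv' i iA).
  have le : (fl i v + 1)%:~R <= (fl i v')%:~R :> F.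
    by rewrite ler_int; move: Ki; rewrite /floor_jump; clear; lia.
  have w0 : 0 < a i w by have := wE i; lra.
  have e : tm i * a i w = (fl i v + 1)%:~R - a i v by rewrite /tm divfK // gt_eqF.
  split=> //; first by rewrite divr_gt0 // subr_gt0.
  by rewrite ler_pdivrMr // mul1r; have := wE i; lra.
case: (@arg_minP _ _ _ i0 (fun i => i \in S) tm i0S) => i2 i2S i2min.
have [i2A w2 t0 t1 te] := SP i2 i2S.
set t := tm i2 in t0 t1 te i2min.
have ah i : a i (v + t *: w) = a i v + t * a i w by rewrite aD aZ.
have up i : i \notin Aset -> a i (v + t *: w) <= (fl i v + 1)%:~R.
  move=> iA; rewrite ah; case: (boolP (i \in S)) => iS.
    have [_ wi _ _ e] := SP i iS; have := i2min i iS; move: wi e.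
    move: (tm i) (a i w) (a i v) (_%:~R) => b c d e' c0 h1 h2.
    have : t * c <= b * c by rewrite ler_pM2r.
    by rewrite h1; lra.
  have /andP[g1 g2] := fl_gen (proj2 rv i iA); have /andP[g3 g4] := fl_gen (proj2 rv' i iA).
  have le : (fl i v' + 1)%:~R <= (fl i v + 1)%:~R :> F.
    by rewrite ler_int; move: iS; rewrite inE /floor_jump; clear; lia.
  have p1 : 0 <= (1 - t) * ((fl i v + 1)%:~R - a i v) by rewrite mulr_ge0 // subr_ge0 // ltW.
  have p2 : 0 <= t * ((fl i v + 1)%:~R - a i v').
    by apply: mulr_ge0; rewrite ?subr_ge0 ltW //; exact: lt_le_trans le.
  by rewrite wE in p2; lra.
exists t; split=> //.
  move=> i iA; rewrite up // andbT.
  have := up (ropp i); rewrite (reg_opp _ rv) => /(_ iA); rewrite a_opp fl_opp; last exact: (proj2 rv).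
  by rewrite !rmorphD rmorphN /=; lra.
by exists i2; split=> //; rewrite ah te; lra.
Qed.

(** Induction on the hyperplanes between [v] and [v']. At the first wall point [h] the alcoves
    before and behind are both turned towards [nu]; what still separates them are walls of roots
    fixed by [p], and any order of crossing these is allowed. *)
Lemma move_reg v v' r : (forall i, drift i = 0 -> perp i \/ p i = i) -> Min r -> reg v -> reg v' ->
  aconn y (nearby v r) (nearby v' r).
Proof.
move=> C Mr; have [N] := ubnP (dist v v'); elim: N v => // N IH v; rewrite ltnS => hN rv rv'.
case: (eqVneq (dist v v') 0%N) => [/K0_dist z0|nz].
  have [|_ //] := aMin_same ry (aMin_star rv Mr) (agen_star rv' Mr.1).
  move=> i; rewrite (fl_star _ _ rv) (fl_star _ _ rv'); congr (_ - _).
  by have := z0 i; rewrite /floor_jump; lia.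
have [t [t0 t1 bnd [i2 [i2A h2 w2]]]] := first_wall rv rv' nz.
set w := v' - v in bnd h2 w2; set h := v + t *: w in bnd h2.
have wz : w *m z = w by apply: VpB; [case: rv|case: rv'].
have hv : inVy h by apply: VpD; [rewrite -scalemxAl wz|case: rv].
have cross i (iA : i \notin Aset) := floor_cross t0 t1 (proj2 rv i iA) (proj2 rv' i iA) (bnd i iA).
have w0 i : i \in Aset -> a i w = 0.
  by rewrite inE => /andP[pe _]; exact: perp_fix.
have hw i : i \notin Aset -> a i h \is a Num.int -> a i w != 0.
  by move=> iA; case: (cross i iA).
have ah i : i \in Aset -> a i h = a i v.
  by move=> iA; rewrite /h aD aZ w0 // mulr0 addr0.
pose v2 := nearby h w.
have rv2 : reg v2.
  split; first by apply: VpD => //; rewrite -scalemxAl wz.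
  by move=> i iA; rewrite int_nearby; apply/negP => /andP[/(hw i iA)/negP].
apply: rst_trans (IH v2 _ rv2 rv'); last first.
  apply: leq_trans hN; have <- : (dist v v2 + dist v2 v' = dist v v')%N.
    apply: dist_abtw => i; case: (boolP (i \in Aset)) => iA; first by rewrite (K_zero rv rv2 iA) mul0r.
    by have [_ _] := cross i iA.
  rewrite -[X in (X < _)%N]add0n ltn_add2r lt0n sum_nat_eq0; apply/forallPn; exists i2.
  rewrite /= absz_eq0 /floor_jump fl_nearby h2 intr_int (ltNge (a i2 w)) (ltW w2) /= /root_floor h2 intrKfloor.
  by rewrite addrAC subrr add0r.
(* Directions of the alcoves just before and just behind [h], with [r] deciding the walls that
   contain the fixed space. *)
pose w1 := nudge phi (- w) r; pose w2' := nudge phi w r.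
have f1 i : fl i (nearby h w1) = fl i (nearby v r).
  rewrite fl_lex //; [|by move=> iA; rewrite aN w0 ?oppr0|by move=> iA hi; rewrite aN oppr_eq0 hw].
  rewrite (fl_star _ _ rv); congr (_ - _); case: (boolP (i \in Aset)) => iA; last by case: (cross i iA).
  by rewrite fl_nearby aN w0 // oppr0 ltxx andbF /root_floor ah.
have f2 i : fl i (nearby h w2') = fl i (nearby v2 r).
  by rewrite fl_lex //; [rewrite (fl_star _ _ rv2)|exact: w0|exact: hw].
have nz1 i : a i h \is a Num.int -> a i w1 != 0.
  move=> hi; have -> : (a i w1 == 0) = (a i (- w) == 0) && (a i r == 0) by exact: nudge_eq0.
  case: (boolP (i \in Aset)) => iA; first by rewrite negb_and (Mr.1 i iA) orbT.
  by rewrite aN oppr_eq0 (negPf (hw i iA hi)).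
have nz2 i : a i h \is a Num.int -> a i w2' != 0.
  move=> hi; have -> : (a i w2' == 0) = (a i w == 0) && (a i r == 0) by exact: nudge_eq0.
  case: (boolP (i \in Aset)) => iA; first by rewrite negb_and (Mr.1 i iA) orbT.
  by rewrite (negPf (hw i iA hi)).
have [M1 c1] : aMin y (nearby h w1) /\ aconn y (nearby v r) (nearby h w1).
  apply: (aMin_same ry (aMin_star rv Mr)) => [|i]; last by rewrite f1.
  exact: agen_nearby.
have [M2 c2] : aMin y (nearby h w2') /\ aconn y (nearby v2 r) (nearby h w2').
  apply: (aMin_same ry (aMin_star rv2 Mr)) => [|i]; last by rewrite f2.
  exact: agen_nearby.
have [M1' c1'] := nu_pursuit hv nz1 M1.
have [M2' c2'] := nu_pursuit hv nz2 M2.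
set N1 := nearby h (nudge phi nu w1) in M1' c1'; set N2 := nearby h (nudge phi nu w2') in M2' c2'.
apply: rst_trans c1 _; apply: rst_trans c1' _.
apply: (rst_trans _ _ _ N2); last exact: rst_sym (rst_trans _ _ _ _ _ c2 c2').
have lt0 s i : (a i (nudge phi nu s) < 0) = if a i nu == 0 then a i s < 0 else a i nu < 0.
  have sgn : Num.sg (a i (nudge phi nu s)) = if a i nu == 0 then Num.sg (a i s) else Num.sg (a i nu).
    exact: sg_nudge.
  by rewrite -sgr_lt0 sgn; case: ifP => _; rewrite sgr_lt0.
have ltw s i : i \in Aset -> (a i (nudge phi s r) < 0) = if a i s == 0 then a i r < 0 else a i s < 0.
  move=> _; have sgn : Num.sg (a i (nudge phi s r)) = if a i s == 0 then Num.sg (a i r) else Num.sg (a i s).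
    exact: sg_nudge.
  by rewrite -sgr_lt0 sgn; case: ifP => _; rewrite sgr_lt0.
(* After the turn, the alcoves differ only at roots orthogonal to [nu] and nonconstant on the
   segment; [C] makes these fixed by [p]. *)
have E i : fl i N1 != fl i N2 -> p i = i.
  rewrite !fl_nearby !lt0; case: (boolP (a i h \is a Num.int)) => hi /=; last by rewrite eqxx.
  case: (eqVneq (a i nu) 0) => [n0|_]; last by rewrite eqxx.
  case: (boolP (i \in Aset)) => iA.
    by rewrite /w1 /w2' !ltw // aN w0 // oppr0 eqxx eqxx.
  have k0 : drift i = 0 by apply/eqP; rewrite -a_nu0 n0.
  have [pe|//] := C i k0.
  by have := hw i iA hi; rewrite (perp_fix pe wz) eqxx.
apply: (gallery_conn (proj1 M1') (proj1 M2')) => s gs b.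
have fs i : p i != i -> fl i s = fl i N1.
  move=> pi; have := b i; have : fl i N1 = fl i N2 by apply/eqP; apply: contraNT pi => /E ->.
  by rewrite /floor_jump => <-; clear; nia.
(* A root fixed by [p] sees the same displacement at every point, and at the other roots [s] has the
   floors of [N1]. *)
apply: (aMin_le M1' gs); rewrite /disp /floor_dist leq_eqVlt; apply/orP; left; apply/eqP.
apply: eq_bigr => i _; rewrite -[i](permKV p); set j := (p^-1)%g i.
rewrite /floor_jump !(fl_act ry); case: (eqVneq (p j) j) => pj; first by rewrite pj; congr absz; clear; lia.
by rewrite !fs // (inj_eq perm_inj).
Qed.

(** * Retraction of minimal alcoves by iterated midpoints *)

Definition mid h : 'rV[F]_n := 2^-1 *: (h + act y h).
Definition closure_of_comp x0 h := exists x, [/\ aMin y x, aconn y x0 x & acl h x].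

(** One root at a time: [A] and [B] are its values at [h] and its image, [fx] and [fy] its floors on
    alcoves having these points in their closures, and [fq] its floor next to the midpoint [c] on
    the side of [X]. Comparing [A] with [B] places [fq] between [fx] and [fy]. *)
Lemma floor_mid (A B X c : F) (fx fy fq : int) :
  fx = Num.floor X ->
  (fx = Num.floor A \/ (A \is a Num.int /\ fx = Num.floor A - 1)) ->
  (fy = Num.floor B \/ (B \is a Num.int /\ fy = Num.floor B - 1)) ->
  c = 2^-1 * (A + B) ->
  fq = (if (c \is a Num.int) && (X - c < 0) then Num.floor c - 1 else Num.floor c) ->
  0 <= (fq - fx) * (fy - fq).
Proof.
move=> eX hA hB cE fqE.
have /andP[c1 c2] := floor_itv c; have /andP[X1 X2] := floor_itv X.
have lexq : X < c -> c \is a Num.int -> fx < Num.floor c.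
  by move=> lt /floorK ci; rewrite eX -(ltr_int F) ci; apply: le_lt_trans X1 lt.
have qle : fq <= Num.floor c by rewrite fqE; case: ifP => _; rewrite ?gerBl.
have subL (k : int) : k - 1 < k by rewrite ltrBlDr ltrDl.
have [AB|AB|AB] := ltgtP A B.
- have Ac : A < c by rewrite cE; lra.
  have cB : c < B by rewrite cE; lra.
  have l1 : fx <= Num.floor A by case: hA => [->//|[_ ->]]; exact: ltW.
  have l2 : fx <= fq.
    rewrite fqE; case: ifP => [/andP[ci lt]|_].
      by rewrite -ltzD1 subrK; apply: lexq ci; rewrite -subr_lt0.
    by apply: le_trans l1 _; apply: le_floor; exact: ltW.
  have l3 : fq <= fy.
    apply: le_trans qle _; case: hB => [->|[/floorK Bi ->]]; first by apply: le_floor; exact: ltW.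
    by rewrite -ltzD1 subrK -(ltr_int F) Bi; apply: le_lt_trans c1 cB.
  by rewrite mulr_ge0 // subr_ge0.
- have Ac : c < A by rewrite cE; lra.
  have cB : B < c by rewrite cE; lra.
  have l1 : Num.floor c <= fx.
    case: hA => [->|[/floorK Ai ->]]; first by apply: le_floor; exact: ltW.
    by rewrite -ltzD1 subrK -(ltr_int F) Ai; apply: le_lt_trans c1 Ac.
  have l2 : fy <= fq.
    have le0 : Num.floor B <= Num.floor c by apply: le_floor; exact: ltW.
    have le1 : fy <= Num.floor c by case: hB => [->//|[_ ->]]; apply: le_trans le0; exact: ltW.
    rewrite fqE; case: ifP => // /andP[ci lt].
    have := lexq; rewrite -subr_lt0 => /(_ lt ci) h.
    by have := lt_le_trans h l1; rewrite ltxx.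
  by rewrite mulr_le0 // subr_le0 //; apply: le_trans qle l1.
- have cA : c = A by rewrite cE -AB; lra.
  suff -> : fq = fx by rewrite subrr mul0r.
  rewrite fqE; case: ifP => [/andP[ci lt]|h].
    have fl1 : fx < Num.floor c by apply: lexq => //; rewrite -subr_lt0.
    case: hA => [e|[_ ->]]; last by rewrite cA.
    by move: fl1; rewrite e cA ltxx.
  case: hA => [->|[Ai e]]; first by rewrite cA.
  have ci : c \is a Num.int by rewrite cA.
  move: h; rewrite ci /= => /negbT; rewrite subr_lt0 -leNgt => le.
  have : Num.floor c <= fx by rewrite eX; exact: le_floor.
  by rewrite e cA leNgt subL.
Qed.

Lemma acl_act h x : acl h x -> acl (act y h) (act y x).
Proof.
move=> c i; rewrite -[i](permKV p) !(fl_act ry) (int_act ry).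
by case: (c ((p^-1)%g i)) => [->|[hi ->]]; [left|right; split=> //]; rewrite // addrAC.
Qed.

Lemma closure_of_comp_mid x0 h : closure_of_comp x0 h -> closure_of_comp x0 (mid h).
Proof.
move=> [x [Mx cx ac]]; pose q := nearby (mid h) (x - mid h).
have gq : agen q.
  apply: agen_nearby => i hi; rewrite aB subr_eq0.
  by apply: contraTneq (proj1 Mx i) => ->; rewrite hi.
have [|Mq cq] := apursuit ry Mx gq.
  left=> i; rewrite /floor_jump.
  apply: (floor_mid (A := a i h) (B := a i (act y h)) (X := a i x) (c := a i (mid h))) => //.
  - exact: acl_act ac i.
  - by rewrite /mid aZ aD.
  - by rewrite fl_nearby aB.
exists q; split=> //; first exact: rst_trans cx cq.
exact: acl_nearby.
Qed.

Definition half e : 'rV[F]_n := 2^-1 *: (e + e *m z).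

Lemma half_binomial k e : iter k half e = 2^-1 ^+ k *: \sum_(j < k.+1) 'C(k, j)%:R *: (e *m zpow j).
Proof.
elim: k => [|k IH]; first by rewrite big_ord1 bin0 expr0 !scale1r zpow0 mulmx1.
rewrite /= IH /half -scalemxAl -scalerDr scalerA -exprS; congr (_ *: _).
rewrite mulmx_suml.
under [X in _ + X = _]eq_bigr => j _ do rewrite -scalemxAl -mulmxA zpowS.
rewrite [RHS]big_ord_recl bin0 [in RHS]big_ord_recr /= binn.
rewrite [X in X + _ = _]big_ord_recl bin0 -!addrA; congr (_ + _).
rewrite [X in _ + X = _]big_ord_recr /= binn addrA; congr (_ + _).
by rewrite -big_split; apply: eq_bigr => j _; rewrite /bump /= !add1n binS natrD scalerDl.
Qed.

Definition bd e (M : F) := forall i, `|a i e| <= M.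

Lemma bd_zpow e M j : bd e M -> bd (e *m zpow j) M.
Proof. by move=> b i; rewrite -[i](permKV (p ^+ j)%g) a_zpow. Qed.
Lemma bd_half e M : bd e M -> bd (half e) M.
Proof.
move=> b i; rewrite /half aZ aD normrM gtr0_norm ?invr_gt0 //.
have h1 := b i; have h2 := bd_zpow 1 b i; rewrite -zpowS zpow0 mul1mx in h2.
have := ler_normD (a i e) (a i (e *m z)); lra.
Qed.
Lemma bd_iter k e M : bd e M -> bd (iter k half e) M.
Proof. by elim: k => //= k IH b; apply: bd_half; exact: IH. Qed.

Lemma orbit_sum_half e : orbit_sum e = 0 -> orbit_sum (half e) = 0.
Proof.
move=> t0; have -> : orbit_sum (half e) = 2^-1 *: (orbit_sum e + orbit_sum e *m z).
  rewrite /orbit_sum mulmx_suml -big_split scaler_sumr; apply: eq_bigr => k _ /=.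
  by rewrite -scalemxAl mulmxDl -!mulmxA zpowS zpowSr.
by rewrite t0 mul0mx addr0 scaler0.
Qed.
Lemma orbit_sum_iter k e : orbit_sum e = 0 -> orbit_sum (iter k half e) = 0.
Proof. by elim: k => //= k IH t0; apply: orbit_sum_half; exact: IH. Qed.

(** After [m] halvings the coefficient of [e z^j] is a binomial coefficient over [2^m]. Subtracting
    the vanishing orbit sum lowers each of the first [m] coefficients by [1 / 2^m], and the rest add
    up to this number. *)
Definition rate : F := 2^-1 ^+ m * (2 ^+ m - m%:R).
Lemma rate_bounds : 0 <= rate /\ rate < 1.
Proof.
have two : 0 < 2^-1 ^+ m :> F by rewrite exprn_gt0 // invr_gt0.
have e1 : 2^-1 ^+ m * 2 ^+ m = 1 :> F by rewrite -exprMn mulVf ?pnatr_eq0 // expr1n.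
split.
  apply: mulr_ge0; first exact: ltW.
  by rewrite subr_ge0 -natrX ler_nat ltnW // ltn_expl.
by rewrite /rate mulrBr e1 ltrBlDr ltrDl mulr_gt0 // ltr0n.
Qed.

Lemma sum_bin k : (\sum_(j < k.+1) 'C(k, j) = 2 ^ k)%N.
Proof.
rewrite -[2%N]/(1 + 1)%N expnDn; apply: eq_bigr => j _.
by rewrite !exp1n !muln1.
Qed.

Lemma bd_contract e M : orbit_sum e = 0 -> bd e M -> bd (iter m half e) (rate * M).
Proof.
move=> t0 b i; rewrite half_binomial aZ normrM gtr0_norm ?exprn_gt0 ?invr_gt0 //.
rewrite /rate -mulrA ler_pM2l ?exprn_gt0 ?invr_gt0 //.
have z0 : \sum_(j < m) a i (e *m zpow j) = 0.
  by have := congr1 (a i) t0; rewrite /orbit_sum /root_val pairR_sum pairR0.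
have -> : a i (\sum_(j < m.+1) 'C(m, j)%:R *: (e *m zpow j)) =
   \sum_(j < m.+1) ('C(m, j) - (j < m))%N%:R * a i (e *m zpow j).
  rewrite {1}/root_val pairR_sum -[LHS]subr0 -[X in _ - X]z0 [RHS]big_ord_recr [X in X - _ = _]big_ord_recr /= ltnn subn0.
  rewrite addrAC pairRZ -sumrB; congr (_ + _); apply: eq_bigr => j _.
  rewrite ltn_ord pairRZ -[pairR _ _]/(a i _) natrB ?bin_gt0 ?mulrBl ?mul1r //.
  exact: ltnW.
apply: le_trans (ler_norm_sum _ _ _) _.
apply: (@le_trans _ _ (\sum_(j < m.+1) ('C(m, j) - (j < m))%N%:R * M)).
  apply: ler_sum => j _; rewrite normrM ger0_norm ?ler0n //.
  by rewrite ler_wpM2l ?ler0n //; exact: bd_zpow.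
rewrite -mulr_suml -natr_sum sumnB => [|j _]; last first.
  by case: (ltnP j m) => // lt; rewrite bin_gt0 ltnW.
rewrite sum_bin big_ord_recr /= ltnn addn0.
have -> : (\sum_(j < m) (j < m) = m)%N.
  by rewrite (eq_bigr (fun=> 1%N)) => [|j _]; rewrite ?ltn_ord // sum_nat_const card_ord muln1.
rewrite natrB ?natrX //; exact: ltnW (ltn_expl _ _).
Qed.

Lemma bd_power k e M : orbit_sum e = 0 -> bd e M -> bd (iter (m * k) half e) (rate ^+ k * M).
Proof.
move=> t0 b; elim: k => [|k IH]; first by rewrite muln0 expr0 mul1r.
by rewrite mulnS iterD exprS -mulrA; apply: bd_contract => //; exact: orbit_sum_iter.
Qed.

(** The number of halvings is a multiple of [2 m], so that the translation accompanying as many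
    midpoint steps is integral. *)
Lemma bd_small e (d : F) : orbit_sum e = 0 -> 0 < d -> exists k, forall i, `|a i (iter (m * (2 * k)) half e)| < d.
Proof.
move=> t0 d0; pose M := \sum_i `|a i e|.
have b : bd e M.
  by move=> i; rewrite /M (bigD1 i) //= lerDl sumr_ge0.
have [r0 r1] := rate_bounds.
have [k hk] : exists k, rate ^+ k * M < d.
  apply: contrapT => no; apply: (@geometric_unbounded F 1 rate d M r0 r1 d0) => k.
  by rewrite expr1n mulr1 mulrC leNgt; apply/negP => lt; apply: no; exists k.
exists k => i; apply: le_lt_trans hk.
have -> : (m * (2 * k) = m * k + m * k)%N by lia.
by rewrite iterD; apply: bd_iter; exact: bd_power.
Qed.

Lemma mid_barycentre k q e c : inVy q ->
  iter k mid (q + e + c *: nu) = q + iter k half e + (c + k%:R / 2) *: nu.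
Proof.
move=> hq; elim: k => [|k IH]; first by rewrite mul0r addr0.
rewrite /= IH; set e' := iter k half e; set c' := c + _.
rewrite /mid actD actD hq -/z -scalemxAl nu_z /half.
have -> : c + k.+1%:R / 2 = c' + 2^-1 by rewrite /c' -natr1 mulrDl mul1r addrA.
rewrite scalerDl; apply/rowP => j; rewrite !mxE; field; exact: mR.
Qed.

Lemma orbit_sum_barycentre x : orbit_sum (x - barycentre x) = 0.
Proof.
have e k : (x - barycentre x) *m zpow k = drift_orbit k x - barycentre x.
  have qk : act (apow y k) (barycentre x) = barycentre x + k%:R *: nu.
    elim: k => [|k IH]; first by rewrite act_one scale0r addr0.
    by rewrite /= act_mul IH actD barycentre_inVy -/z -scalemxAl nu_z -natr1 scalerDl scale1r -addrA [nu + _]addrC.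
  have := actD (apow y k) (barycentre x) (x - barycentre x); rewrite addrC subrK qk -/(zpow k) => h.
  by rewrite /drift_orbit h -addrA -opprD [X in _ = _ - X]addrC addrAC subrr add0r.
rewrite /orbit_sum (eq_bigr (fun k : 'I_m => drift_orbit k x - barycentre x)) => [|k _]; last exact: e.
rewrite sumrB sumr_const card_ord -scaler_nat /barycentre scalerA divff ?mR // scale1r subrr //.
Qed.

Lemma gap_floor (u b : F) : u \isn't a Num.int -> `|b| < gap u ->
  Num.floor (u + b) = Num.floor u /\ u + b \isn't a Num.int.
Proof.
move=> nu'; rewrite /gap (negPf nu') lt_min !ltr_norml => /andP[/andP[b1 b2] /andP[b3 b4]].
have e : Num.floor (u + b) = Num.floor u by apply: floor_def; apply/andP; split; lra.
split=> //; rewrite intrEfloor e; apply/negP => /eqP h; lra.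
Qed.

(** Up to translation along [nu], midpoints contract [x] to the barycentre of its orbit; once the
    error is below all gaps at a regular barycentre, the alcove has the translated barycentre in its
    closure. *)
Lemma retract x : aMin y x -> exists v r, [/\ reg v, Min r & aconn y x (nearby v r)].
Proof.
move=> Mx0; have [u uz hu] := generic_fix.
(* Small enough to keep [x] in its alcove and to make the barycentre regular; the barycentre moves
   by the same vector as [x]. *)
pose e0 := Num.min (astep D x u) (astep D (barycentre x) u).
have e0p : 0 < e0 by rewrite lt_min !astep_gt0.
have [Mx cx] : aMin y (x + e0 *: u) /\ aconn y x (x + e0 *: u).
  have le : e0 <= astep D x u by rewrite ge_min lexx.
  apply: (aMin_same ry Mx0) => i.
    by rewrite int_step // (negPf (proj1 Mx0 i)).
  by rewrite fl_step // (negPf (proj1 Mx0 i)).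
set x1 := x + e0 *: u in Mx cx; pose q := barycentre x1.
have rq : reg q.
  have -> : q = barycentre x + e0 *: u by apply: baryD; rewrite -scalemxAl uz.
  by apply: reg_step => //; [exact: barycentre_inVy|rewrite ge_min lexx orbT].
have hq := proj1 rq.
(* An explicit positive number below every gap at [q]: an error smaller than [d] can change floors
   only at walls through [q]. *)
pose d : F := (1 + \sum_i (gap (a i q))^-1)^-1.
have d0 : 0 < d.
  by rewrite invr_gt0 ltr_pwDl // sumr_ge0 // => i _; rewrite invr_ge0 ltW // gap_gt0.
have dgap i : d < gap (a i q).
  rewrite -[ltRHS]invrK ltf_pV2 ?posrE ?invr_gt0 ?gap_gt0 //; last first.
    by rewrite ltr_pwDl // sumr_ge0 // => j _; rewrite invr_ge0 ltW // gap_gt0.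
  rewrite (bigD1 i) //= addrCA ltrDl ltr_pwDl // sumr_ge0 // => j _.
  by rewrite invr_ge0 ltW // gap_gt0.
have [k hk] := bd_small (orbit_sum_barycentre x1) d0.
set N := (m * (2 * k))%N in hk; set e := iter N half (x1 - barycentre x1) in hk.
have AN j : closure_of_comp x1 (iter j mid x1).
  elim: j => [|j IH]; last exact: closure_of_comp_mid.
  by exists x1; split=> //; [exact: rst_refl|move=> i; left].
(* [2 m k] midpoint steps translate by [m k nu], which is the integral vector [k lm]; so [v] lies on
   walls of the same roots as [q]. *)
pose v := q + k%:R *: toR F lm.
have mnu : m%:R *: nu = toR F lm by rewrite /newton_avg scalerA divff ?mR // scale1r.
have hN : iter N mid x1 = v + e.
  have := mid_barycentre N (x1 - q) 0 hq; rewrite scale0r addr0 [q + _]addrC subrK => ->.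
  rewrite add0r -/q -/e /v addrAC; congr (_ + _ + _).
  rewrite scalerA; congr (_ *: _); rewrite /N !natrM; field; exact: mR.
have lmz : toR F lm *m z = toR F lm by rewrite /z -toRM lm_z.
have av i : a i v = a i q + (k%:Z * drift i)%:~R.
  by rewrite /v aD [a i (_ *: toR F lm)]aZ a_toR -[k%:R]/(k%:Z%:~R) -rmorphM.
have rv : reg v.
  split; first by apply: VpD => //; rewrite -scalemxAl lmz.
  by move=> i iA; rewrite av rpredDr ?intr_int //; exact: (proj2 rq).
have [x2 [Mx2 cx2 ac]] := AN N; rewrite hN in ac.
have acv : acl v x2.
  move=> i; have ec : `|a i e| < gap (a i q) by apply: lt_trans (hk i) (dgap i).
  case: (boolP (i \in Aset)) => iA; last first.
    have nq := proj2 rq i iA; have nv := proj2 rv i iA.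
    have [f1 f2] := gap_floor nq ec.
    have e1 : a i (v + e) = a i q + a i e + (k%:Z * drift i)%:~R by rewrite aD av addrAC.
    left; case: (ac i) => [->|[hi _]].
      by rewrite /root_floor e1 av floorDrz ?intr_int // f1 floorDrz ?intr_int.
    by move: hi; rewrite e1 rpredDr ?intr_int // (negPf f2).
  have vi : a i v \is a Num.int by rewrite (reg_int _ rv).
  have qi : a i q \is a Num.int by rewrite (reg_int _ rq).
  rewrite /gap qi ltr_norml in ec; case/andP: ec => ec1 ec2.
  have e1 : fl i (v + e) = fl i v + Num.floor (a i e) by rewrite /root_floor aD floorDzr.
  have e2 : (a i (v + e) \is a Num.int) = (a i e \is a Num.int) by rewrite aD rpredDl.
  case: (ltP (a i e) 0) => [lt|ge].
    have fe : Num.floor (a i e) = -1 by apply: floor_def; apply/andP; split; lra.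
    case: (ac i) => [->|[hi _]]; first by right; split=> //; rewrite e1 fe.
    by move: hi; rewrite e2 => /floorK; rewrite fe rmorphN1 => h; move: ec1; rewrite -h ltxx.
  have fe : Num.floor (a i e) = 0 by apply: floor_def; apply/andP; split; lra.
  by case: (ac i) => [->|[hi ->]]; [left|right; split=> //]; rewrite e1 fe addr0.
have [Mr _] := aMin_char (proj1 rv) Mx2.
exists v, (x2 - v); split=> //.
apply: rst_trans cx _; apply: rst_trans cx2 _.
apply: (proj2 (aMin_same ry Mx2 (agen_star rv Mr.1) _)).
exact: acl_fl.
Qed.

Lemma conn_sufficient : (forall i, drift i = 0 -> perp i \/ p i = i) ->
  forall x x', aMin y x -> aMin y x' -> aconn y x x'.
Proof.
move=> C x x' Mx Mx'.
have [v [r [rv Mr c]]] := retract Mx; have [v' [r' [rv' Mr' c']]] := retract Mx'.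
apply: rst_trans c _; apply: rst_trans (move_reg C Mr rv rv') _.
by apply: rst_trans (star_link rv' Mr Mr') _; exact: rst_sym.
Qed.

End Minimal.
End Action.

(** The separating levels are [1, ..., e] for [e >= 0] and [e + 1, ..., 0] for [e < 0]; they are
    numbered from 0, upwards in the first case and downwards in the second. *)
Lemma wall_index_lt (e k : int) : (1 <= k <= e) || (e + 1 <= k <= 0) ->
  (0 <= (if (0 <= e)%R then absz (k - 1)%R else absz k) < absz e)%N.
Proof. case: ifP => h0 h; case/orP: h => /andP[h1 h2].
all: lia.
Qed.
Lemma wall_indexK (e k : int) : (1 <= k <= e) || (e + 1 <= k <= 0) ->
  k = if 0 <= e then (if 0 <= e then absz (k - 1)%R else absz k)%:Z + 1
      else - (if 0 <= e then absz (k - 1)%R else absz k)%:Z.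
Proof. case h0: (0 <= e) => h; case/orP: h => /andP[h1 h2]; lia. Qed.

(** * Length and the affine Weyl group *)
Section Length.
Variables (n : nat) (I : finType) (D : RD n I).
Hypothesis HD : is_based_root_datum D.
Local Notation rt := (root D).
Local Notation Sm := (simple D).
Local Notation ropp := (root_opp HD).
Local Notation raut := (raut D).

Definition pos i := [forall j in Sm, 0 <= simple_coef HD i j].
Lemma posP i : reflect (posroot D i) (pos i).
Proof. by apply: (iffP forall_inP) => /(posrootP HD). Qed.
Lemma pos_ropp i : pos (ropp i) = ~~ pos i.
Proof. by apply/posP/idP => [/(pos_opp HD) h|/posP h]; [apply/posP|apply/(pos_opp HD)]. Qed.

(* the floor of the root [i] on the fundamental alcove *)
Definition base i : int := if pos i then 0 else -1.

(** The closed formula for the length as a sum over positive roots. It involves no field, so lengths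
    agree over all ordered fields. *)
Definition wall_count (p : {perm I}) (y : aff n) : nat :=
  (\sum_(i | pos i) absz (ipair y.1 (rt i) + base ((p^-1)%g i))%R)%N.

Section Field.
Variable R : realFieldType.

Lemma alcove_ex : exists x : 'rV[R]_n, alcove D x.
Proof.
have [h hr] := rho_ex R HD.
pose M : R := 1 + \sum_i `|pairR h (rt i)|.
have M0 : 0 < M by rewrite /M ltr_pwDl // sumr_ge0.
exists (M^-1 *: h) => i pi; have h1 := rho_pos HD hr pi.
have h0 : 0 < pairR h (rt i) by apply: lt_le_trans h1.
rewrite pairRZ mulr_gt0 ?invr_gt0 //= mulrC ltr_pdivrMr // mul1r.
rewrite /M (bigD1 i) //= gtr0_norm // addrCA ltrDl ltr_pwDl // sumr_ge0 //.
Qed.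

Lemma alcove_base (x : 'rV[R]_n) i : alcove D x ->
  (base i)%:~R < pairR x (rt i) < (base i + 1)%:~R.
Proof.
move=> ax; rewrite /base; case: ifP => [/posP/ax//|/negbT].
rewrite -pos_ropp => /posP/ax; rewrite pairR_opp addNr rmorphN1 => /andP[h1 h2].
by apply/andP; split; lra.
Qed.

Lemma alcove_act p (y : aff n) (x : 'rV[R]_n) i : raut p y.2 -> alcove D x ->
  (ipair y.1 (rt i) + base ((p^-1)%g i))%:~R < pairR (act y x) (rt i)
    < (ipair y.1 (rt i) + base ((p^-1)%g i) + 1)%:~R.
Proof.
move=> ry ax; rewrite /act pairRD pairR_toR.
have -> : pairR (x *m toR R y.2) (rt i) = pairR x (rt ((p^-1)%g i)).
  by rewrite -{1}[i](permKV p) (raut_pairR _ _ ry).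
have := alcove_base ((p^-1)%g i) ax; rewrite !rmorphD /= => /andP[h1 h2].
by apply/andP; split; lra.
Qed.

Lemma separatesP p (y : aff n) i k : raut p y.2 ->
  separates D R y (i, k) <->
  pos i /\ let e := ipair y.1 (rt i) + base ((p^-1)%g i) in (1 <= k <= e) || (e + 1 <= k <= 0).
Proof.
move=> ry; set e := ipair _ _ + _; split.
  case=> /= pi h; split; first exact/posP.
  have [x ax] := alcove_ex; have := h x x ax ax.
  have := alcove_act i ry ax; have := ax i pi; rewrite -/e => /andP[h1 h2] /andP[h3 h4].
  case: (ltP 0 k) => k1.
    have k1' : 1 <= k%:~R :> R by rewrite (ler_int R 1).
    rewrite nmulr_rlt0; last by lra.
    rewrite subr_gt0 => h5; have : k%:~R < (e + 1)%:~R :> R by apply: lt_trans h5 h4.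
    by rewrite ltr_int; lia.
  have k1' : k%:~R <= 0 :> R by rewrite (ler_int R _ 0).
  rewrite pmulr_rlt0; last by lra.
  rewrite subr_lt0 => h5; have : e%:~R < k%:~R :> R by apply: lt_trans h3 h5.
  by rewrite ltr_int; lia.
case=> /posP pi /= h; split=> //= x x' ax ax'.
have /andP[h1 h2] := ax i pi; have := alcove_act i ry ax'; rewrite -/e => /andP[h3 h4].
case/orP: h => /andP[k1 k2].
  have k1' : 1 <= k%:~R :> R by rewrite (ler_int R 1).
  have k2' : k%:~R <= e%:~R :> R by rewrite ler_int.
  by rewrite nmulr_rlt0; lra.
have k1' : (e + 1)%:~R <= k%:~R :> R by rewrite ler_int.
have k2' : k%:~R <= 0 :> R by rewrite (ler_int R _ 0).
by rewrite pmulr_rlt0; lra.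
Qed.

(** [ell] chooses the size of a duplicate-free list of the separating pairs. An explicit list shows
    that one exists, and any two such lists have the same size. *)
Lemma ell_wall_count p (y : aff n) : raut p y.2 -> ell D R y = wall_count p y.
Proof.
move=> ry; pose e i : int := ipair y.1 (rt i) + base ((p^-1)%g i).
pose kk i (j : nat) : int := if 0 <= e i then j%:Z + 1 else - j%:Z.
pose s := [seq (i, kk i j) | i <- enum pos, j <- iota 0 `|e i|].
have us : uniq s.
  apply: allpairs_uniq_dep; [exact: enum_uniq|by move=> *; exact: iota_uniq|].
  move=> [i j] [i' j'] /allpairsPdep[i1 [j1 [_ _ [-> ->]]]] /allpairsPdep[i2 [j2 [_ _ [-> ->]]]].
  by rewrite /= => -[e1]; rewrite e1 /kk; case: ifP => _ e2; congr existT; lia.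
have ms (q : I * int) : q \in s <-> separates D R y q.
  case: q => i k; rewrite (separatesP _ _ ry) /= -/(e i); split.
    case/allpairsPdep => [i1 [j1 []]]; rewrite mem_enum mem_iota add0n => pi hj [-> ->].
    by split=> //; rewrite /kk; case: ifP => h; lia.
  case=> pi h; apply/allpairsPdep; exists i.
  exists (if (0 <= e i)%R then absz (k - 1)%R else absz k); rewrite mem_enum mem_iota add0n; split=> //.
    exact: wall_index_lt h.
  by rewrite /kk; congr pair; exact: wall_indexK h.
have ss : size s = wall_count p y.
  rewrite size_allpairs_dep sumnE big_map /wall_count big_enum /=.
  by apply: eq_bigr => i _; rewrite size_iota.
rewrite /ell; set P := (fun m => _).
have : P (epsilon (inhabits 0%N) P) by apply: epsilon_spec; exists (size s), s.
case=> t [ut mt <-]; rewrite -ss; apply: perm_size; apply: uniq_perm => // q.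
by apply/idP/idP => [/mt/ms|/ms/mt].
Qed.
End Field.
End Length.

(** * Affine reflections and adjacent alcoves *)

Section AffineWeyl.
Variables (n : nat) (I : finType) (D : RD n I).
Hypothesis HD : is_based_root_datum D.
Local Notation rt := (root D).
Local Notation cr := (coroot D).
Local Notation Sm := (simple D).
Local Notation ropp := (root_opp HD).
Local Notation raut := (raut D).
Local Notation srp := (srp HD).
Local Notation aref := (aref D).
Local Notation inW := (inW D).

Lemma inQ0 : inQ D 0.
Proof. by exists (fun=> 0); rewrite big1 // => i _; rewrite scale0r. Qed.
Lemma inQD l l' : inQ D l -> inQ D l' -> inQ D (l + l').
Proof.
move=> [c ->] [c' ->]; exists (fun i => c i + c' i); rewrite -big_split.
by apply: eq_bigr => i _; rewrite scalerDl.
Qed.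
Lemma inQN l : inQ D l -> inQ D (- l).
Proof.
move=> [c ->]; exists (fun i => - c i); rewrite -sumrN.
by apply: eq_bigr => i _; rewrite scaleNr.
Qed.
Lemma inQ_raut p A l : raut p A -> inQ D l -> inQ D (l *m A).
Proof.
move=> [_ h _] [c ->]; exists (fun i => c ((p^-1)%g i)); rewrite mulmx_suml.
rewrite [RHS](reindex_inj (@perm_inj _ p)); apply: eq_bigr => i _.
by rewrite permK -scalemxAl h.
Qed.
Lemma inQ_cr k i : inQ D (k *: cr i).
Proof.
exists (fun j => if j == i then k else 0); rewrite (bigD1 i) //= eqxx big1 ?addr0 // => j /negPf ->.
by rewrite scale0r.
Qed.

Lemma inW_raut x : inW x -> exists p, raut p x.2.
Proof. by case=> _ /(inWJ_raut HD). Qed.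
Lemma inW1 : inW (aone n).
Proof. by split; [exact: inQ0|exists [::]]. Qed.
Lemma inW_mul x y : inW x -> inW y -> inW (amul x y).
Proof.
move=> wx wy; have [p rp] := inW_raut wx; case: wx wy => qx wx [qy wy]; split.
  by apply: inQD => //; exact: inQ_raut rp _.
by exact: (@inWJ_mul _ _ D Sm).
Qed.
Lemma inW_inv x : inW x -> inW (ainv x).
Proof.
move=> wx; have [p rp] := inW_raut wx; case: wx => qx wx; split.
  by apply: inQN; apply: inQ_raut qx; exact: raut_inv rp.
exact: (inWJ_inv HD).
Qed.
Lemma inW_aref i k : inW (aref i k).
Proof. by split; [exact: inQ_cr|exact: (inW0_sref HD)]. Qed.

Lemma raut_aref i k : raut (srp i) (aref i k).2.
Proof. exact: raut_sref. Qed.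
Lemma arefK i k : amul (aref i k) (aref i k) = aone n.
Proof.
rewrite /amul /aref /= (srefK HD) -scalemxAl (srefE D) (cr_rt HD); congr pair.
have -> : cr i - 2 *: cr i = - cr i.
  by rewrite -{1}[cr i]scale1r -scalerBl (_ : 1 - 2 = -1) ?scaleN1r.
by rewrite scalerN addNr.
Qed.
Lemma aref_opp i k : aref (ropp i) (- k) = aref i k.
Proof. by rewrite /Defs.aref cr_opp scaleNr scalerN opprK (sref_opp HD). Qed.
Lemma aref_conj p x i k : raut p x.2 ->
  amul x (aref i k) = amul (aref (p i) (k + ipair x.1 (rt (p i)))) x.
Proof.
move=> rx; rewrite /amul /Defs.aref /=; congr pair; last by rewrite (raut_conj_sref _ rx).
rewrite (srefE D) -scalemxAl; have [_ -> _] := rx.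
by rewrite scalerDl; rewrite addrC addrCA subrK addrC.
Qed.

Variables (R : realFieldType) (F : realType) (p0 : 'rV[F]_n).
Hypothesis p0A : alcove D p0.
Local Notation a := (root_val D).
Local Notation fl := (root_floor D).
Local Notation K := (floor_jump D).
Local Notation agen := (agen D).
Local Notation dist := (floor_dist D).
Local Notation adj := (adj HD).
Implicit Types (r s v : 'rV[F]_n).
Notation same r r' := (forall i, fl i r = fl i r').

Lemma fl_p0 i : fl i p0 = base HD i.
Proof. by apply: floor_def; have /andP[/ltW -> ->] := alcove_base HD i p0A. Qed.
Lemma agen_p0 : agen p0.
Proof.
move=> i; rewrite intrEfloor -/(fl i p0) fl_p0 lt_eqF //.
by have /andP[] := alcove_base HD i p0A.
Qed.

Lemma dist_opp r r' : agen r -> agen r' -> dist r r' = (2 * \sum_(i | pos HD i) absz (K i r r'))%N.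
Proof.
move=> gr gr'; rewrite /floor_dist (bigID (pos HD)) /= mul2n -addnn; congr addn.
rewrite (reindex_inj (inv_inj (oppK HD))); apply: eq_big => [i|i _]; first by rewrite pos_ropp negbK.
by rewrite (K_opp HD) // abszN.
Qed.

(* [dist] runs over all roots, so every hyperplane is counted twice. *)
Lemma ell_dist p y : raut p y.2 -> dist p0 (act y p0) = (2 * ell D R y)%N.
Proof.
move=> ry; rewrite dist_opp; [|exact: agen_p0|exact: (agen_act ry agen_p0)].
rewrite (ell_wall_count HD R ry); congr muln; apply: eq_bigr => i pi.
rewrite /floor_jump -{1}[i](permKV p) (fl_act ry) !fl_p0 permKV /base pi subr0 addrC //.
Qed.

Lemma fl_act_same p y r r' : raut p y.2 -> same r r' -> same (act y r) (act y r').
Proof. by move=> ry e i; rewrite -[i](permKV p) !(fl_act ry) e. Qed.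
Lemma dist_same r r' s s' : same r r' -> same s s' -> dist r s = dist r' s'.
Proof. by move=> e e'; apply: eq_bigr => i _; rewrite /floor_jump e e'. Qed.

Lemma fl_aref i k r : agen r -> fl i (act (aref i k) r) = 2 * k - 1 - fl i r.
Proof.
move=> gr; have e : i = srp i (ropp i) by rewrite /root_opp srpK.
rewrite {1}e (fl_act (raut_aref i k)) -e /= ipairZl (cr_rt HD) fl_opp //; ring.
Qed.

Lemma dist_ge_root r s i : agen r -> agen s -> (2 * absz (K i r s) <= dist r s)%N.
Proof.
move=> gr gs; rewrite /floor_dist (bigD1 i) //= (bigD1 (ropp i)) /= ?(opp_neq HD) //.
rewrite (K_opp HD) // abszN; lia.
Qed.
Lemma dist_ge_roots r s i j : agen r -> agen s -> j != i -> j != ropp i ->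
  (2 * absz (K i r s) + absz (K j r s) <= dist r s)%N.
Proof.
move=> gr gs ji jo; rewrite /floor_dist (bigD1 i) //= (bigD1 (ropp i)) /= ?(opp_neq HD) //.
rewrite (bigD1 j) /= ?ji // (K_opp HD) // abszN; lia.
Qed.

(** A separating hyperplane counts 2 in [dist], and the mirror of the reflection always separates,
    so distance 2 leaves the mirror as the only hyperplane crossed. *)
Lemma adj_aref i k r : agen r -> dist r (act (aref i k) r) = 2 ->
  adj r (act (aref i k) r) /\
  forall j l, (fl j r < l) != (fl j (act (aref i k) r) < l) -> aref j l = aref i k.
Proof.
set s := act _ r => gr d2; have gs : agen s by exact: (agen_act (raut_aref i k)).
have e : fl i s = 2 * k - 1 - fl i r by exact: fl_aref.
have Ki : K i r s = 2 * (k - fl i r) - 1 by rewrite /floor_jump e; ring.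
have := dist_ge_root i gr gs; rewrite d2 Ki => le.
have kE : fl i r = k \/ fl i r = k - 1 by lia.
have Ki1 : absz (K i r s) = 1%N by rewrite Ki; lia.
have K0 j : K j r s != 0 -> j = i \/ j = ropp i.
  move=> nz; case: (eqVneq j i) => [|n1]; first by left.
  case: (eqVneq j (ropp i)) => [|n2]; first by right.
  by have := dist_ge_roots gr gs n1 n2; rewrite d2 Ki1; lia.
split.
  split=> [j j' /K0 hj /K0 hj'|j].
    by case: hj => ->; case: hj' => ->; rewrite ?oppK; auto.
  by case: (eqVneq (K j r s) 0) => [->//|/K0[]->]; rewrite ?(K_opp HD) ?abszN ?Ki1.
move=> j l cr'.
have nz : K j r s != 0 by apply: contraNneq cr' => /eqP; rewrite /floor_jump subr_eq0 => /eqP ->.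
case: (K0 j nz) cr' => ->.
  by rewrite e => c; congr aref; lia.
rewrite !fl_opp ?e // => c; rewrite -[RHS]aref_opp; congr aref; lia.
Qed.

(** The line through [r] and [r'] meets the common wall in a point [v] of the segment, fixed by the
    reflection. At all other roots the floors at [r], [v] and [r'] agree, and the fixed point
    carries this over to the reflected alcove. *)
Lemma adj_reflect r r' i : agen r -> agen r' -> adj r r' -> K i r r' != 0 ->
  exists k, same (act (aref i k) r) r' /\ dist r r' = 2.
Proof.
move=> gr gr' [ad1 ad2] nz; pose k : int := Num.max (fl i r) (fl i r'); exists k.
have Ki : absz (K i r r') = 1%N by have := ad2 i; move: nz; rewrite -absz_eq0; case: absz => [|[|]].
have kE : fl i r + fl i r' = 2 * k - 1 by move: Ki; rewrite /k /floor_jump /Num.max; case: ltP => h; lia.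
clearbody k.
have K0 j : j != i -> j != ropp i -> K j r r' = 0.
  move=> n1 n2; apply/eqP/negP => /negP nzj.
  by case: (ad1 i j nz nzj) => e; [move: n1|move: n2]; rewrite e eqxx.
have d2 : dist r r' = 2.
  rewrite /floor_dist (bigD1 i) //= (bigD1 (ropp i)) /= ?(opp_neq HD) //.
  rewrite (K_opp HD) // abszN Ki big1 // => j /andP[n1 n2]; by rewrite K0.
split=> // j.
have ri j0 : j0 = i \/ j0 = ropp i -> fl j0 (act (aref i k) r) = fl j0 r'.
  have e : fl i (act (aref i k) r) = fl i r' by rewrite fl_aref // -kE addrAC subrr add0r.
  case=> -> //; rewrite !fl_opp ?e //; exact: (agen_act (raut_aref i k) gr).
case: (eqVneq j i) => [|n1]; first by auto.
case: (eqVneq j (ropp i)) => [|n2]; first by auto.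
have d0 : a i r' - a i r != 0.
  by rewrite subr_eq0; apply: contraNneq nz => e; rewrite /floor_jump /root_floor e subrr.
pose t := (k%:~R - a i r) / (a i r' - a i r); pose v := r + t *: (r' - r).
have av j0 : a j0 v = a j0 r + t * (a j0 r' - a j0 r) by rewrite /v aD aZ aB.
have avi : a i v = k%:~R by rewrite av /t divfK // addrC subrK.
have t01 : 0 <= t <= 1.
  have /andP[h1 h2] := flP D i r; have /andP[h3 h4] := flP D i r'.
  have [lt|gt] : fl i r = k - 1 /\ fl i r' = k \/ fl i r = k /\ fl i r' = k - 1.
    by move: Ki kE; rewrite /floor_jump; move: (fl i r) (fl i r') => b c; lia.
    case: lt => e1 e2; rewrite e1 e2 in h1 h2 h3 h4; rewrite subrK in h2.
    by rewrite /t divr_ge0 ?ler_pdivrMr ?mul1r //; lra.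
  case: gt => e1 e2; rewrite e1 e2 in h1 h2 h3 h4; rewrite subrK in h4.
  by rewrite /t -mulrNN -invrN divr_ge0 ?ler_pdivrMr ?mul1r //; lra.
have flv j0 : j0 != i -> j0 != ropp i -> fl j0 v = fl j0 r.
  move=> m1 m2; have := K0 j0 m1 m2; rewrite /floor_jump => /eqP; rewrite subr_eq0 => /eqP e.
  have /andP[h1 h2] := flP D j0 r; have /andP[h3 h4] := flP D j0 r'; rewrite e in h3 h4.
  apply: floor_def; rewrite av; move: (a j0 r) (a j0 r') h1 h2 h3 h4 => b c h1 h2 h3 h4.
  case/andP: t01 => t0 t1; have [le|lt] := leP b c.
    have q1 : 0 <= t * (c - b) by rewrite mulr_ge0 // subr_ge0.
    have q2 : 0 <= (1 - t) * (c - b) by rewrite mulr_ge0 // subr_ge0.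
    by apply/andP; split; lra.
  have q1 : 0 <= t * (b - c) by rewrite mulr_ge0 // subr_ge0 ltW.
  have q2 : 0 <= (1 - t) * (b - c) by rewrite mulr_ge0 // subr_ge0 // ltW.
  by apply/andP; split; lra.
have sv : act (aref i k) v = v.
  by rewrite /act /= toRZ toR_sref -/(a i v) avi subrK.
have pn j0 j1 : (srp i j0 != j1) = (j0 != srp i j1).
  by rewrite -(inj_eq (@perm_inj _ (srp i))) srpK.
have h1 := fl_act (raut_aref i k) (srp i j) r; have h2 := fl_act (raut_aref i k) (srp i j) v.
rewrite srpK sv in h1 h2.
have m1 : srp i j != i by rewrite pn.
have m2 : srp i j != ropp i by rewrite pn /root_opp srpK.
rewrite h1 -(flv _ m1 m2) -h2 flv //.
by have := K0 j n1 n2; rewrite /floor_jump => /eqP; rewrite subr_eq0 => /eqP ->.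
Qed.
End AffineWeyl.

(** * Galleries, exchange and niceness *)

Section NiceGalleries.
Variables (n : nat) (I : finType) (D : RD n I).
Hypothesis HD : is_based_root_datum D.
Local Notation rt := (root D).
Local Notation cr := (coroot D).
Local Notation raut := (raut D).
Local Notation aref := (aref D).
Local Notation inW := (inW D).

Variables (R : realFieldType) (F : realType) (p0 : 'rV[F]_n).
Hypothesis p0A : alcove D p0.
Local Notation fl := (root_floor D).
Local Notation K := (floor_jump D).
Local Notation agen := (agen D).
Local Notation dist := (floor_dist D).
Local Notation adj := (adj HD).
Implicit Types (r s v : 'rV[F]_n).
Notation same r r' := (forall i, fl i r = fl i r').

Local Notation aMin := (aMin D).
Local Notation alink := (alink HD).
Local Notation aconn := (aconn HD).
Local Notation inS := (inS D R).
Local Notation prodS := (@prodS n).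
Local Notation agen_p0 := (agen_p0 HD p0A).
Local Notation inW1 := (inW1 D).
Implicit Types (x y w t : aff n).

Definition allS (ss : seq (aff n)) := List.Forall inS ss.

Lemma inS_inW t : inS t -> inW t.
Proof. by case=> i [k [-> _]]; exact: (inW_aref HD). Qed.
Lemma inS_invol t : inS t -> amul t t = aone n.
Proof. by case=> i [k [-> _]]; exact: (arefK HD). Qed.
Lemma inS_ainv t : inS t -> ainv t = t.
Proof.
move=> tS; have [p [u _ _]] := inW_raut HD (inS_inW tS).
by rewrite -[ainv t]amul1 -(inS_invol tS) amulA amulVx // mul1a.
Qed.

Lemma prodS_cat ss ts : prodS (ss ++ ts) = amul (prodS ss) (prodS ts).
Proof. by elim: ss => [|s ss IH] /=; rewrite ?mul1a // IH amulA. Qed.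
Lemma prodS_inW ss : allS ss -> inW (prodS ss).
Proof.
elim=> [|t ss' tS _ IH]; first exact: inW1.
by apply: (inW_mul HD) => //; exact: inS_inW.
Qed.
Lemma prodS_rev ss : allS ss -> amul (prodS ss) (prodS (rev ss)) = aone n.
Proof.
elim=> [|t ss' tS _ IH]; first by rewrite /= mul1a.
rewrite rev_cons -cats1 prodS_cat /= amul1 amulA -[amul (amul t _) _]amulA IH amul1.
exact: inS_invol.
Qed.
Lemma allS_rev ss : allS ss -> allS (rev ss).
Proof. by elim=> [|t ss' tS _ IH] //; rewrite rev_cons -cats1; apply/List.Forall_app; split=> //; constructor. Qed.
Lemma allS_cat ss ts : allS ss -> allS ts -> allS (ss ++ ts).
Proof. by move=> h1 h2; apply/List.Forall_app. Qed.

Lemma agen_actW x r : inW x -> agen r -> agen (act x r).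
Proof. by case/(inW_raut HD) => p rp; exact: (agen_act rp). Qed.
Lemma dist_actW x r r' : inW x -> dist (act x r) (act x r') = dist r r'.
Proof. by case/(inW_raut HD) => p rp; exact: (dist_act rp). Qed.
Lemma fl_actW x r r' : inW x -> same r r' -> same (act x r) (act x r').
Proof. by case/(inW_raut HD) => p rp; exact: (fl_act_same rp). Qed.
Lemma inS_dist t : inS t -> dist p0 (act t p0) = 2.
Proof. by case=> i [k [-> e]]; rewrite (ell_dist HD R p0A (raut_aref HD i k)) e. Qed.

Lemma wall_act x t : inW x -> inS t -> exists i k, amul x t = amul (aref i k) x.
Proof.
move=> /(inW_raut HD)[p rp] [i [k [-> _]]].
by exists (p i), (k + ipair x.1 (rt (p i))); exact: aref_conj.
Qed.

(** The reflection in the common wall, conjugated back by [x], moves the base alcove to distance 2,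
    hence has length 1. *)
Lemma simple_step x r r' : inW x -> same (act x p0) r -> agen r -> agen r' -> adj r r' ->
  (exists i, K i r r' != 0) -> exists t, inS t /\ same (act (amul x t) p0) r'.
Proof.
move=> xW e gr gr' ad [i nz]; have [k [ek d2]] := adj_reflect gr gr' ad nz.
have [p rp] := inW_raut HD xW; pose q := (p^-1)%g.
pose t := aref (q i) (k - ipair x.1 (rt i)).
have xt : amul x t = amul (aref i k) x by rewrite (aref_conj _ _ rp) permKV subrK.
have e2 : same (act (amul x t) p0) r'.
  move=> j; rewrite xt act_mul -ek; apply: fl_actW => //; exact: (inW_aref HD).
exists t; split=> //; exists (q i), (k - ipair x.1 (rt i)); split=> //.
have := ell_dist HD R p0A (raut_aref HD (q i) (k - ipair x.1 (rt i))).
rewrite -(dist_actW _ _ xW) -act_mul -/t (dist_same e e2) d2; lia.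
Qed.

Lemma alcove_word x r : inW x -> agen r ->
  exists ss, allS ss /\ same (act (amul x (prodS ss)) p0) r.
Proof.
move=> xW gr; have gx := agen_actW xW agen_p0.
have [r' [gr' e'] c] := gallery HD gx gr.
suff [ss [sS es]] : exists ss, allS ss /\ same (act (amul x (prodS ss)) p0) r'.
  by exists ss; split=> // i; rewrite es.
have : same (act x p0) (act x p0) by [].
elim: c {-2}x xW => [s|s s1 s2 [gs gs1 ad _ nz] _ IH] x' xW' e.
  by exists [::]; split; [constructor|rewrite /= amul1 => i].
have [t [tS et]] := simple_step xW' (fun i => esym (e i)) gs gs1 ad nz.
have [|ss [sS es]] := IH _ _ (fun i => esym (et i)); first by apply: (inW_mul HD) => //; exact: inS_inW.
by exists (t :: ss); split; [constructor|rewrite /= amulA].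
Qed.

(** At some letter the gallery of the word crosses the given wall. By [adj_aref] that letter,
    conjugated by the prefix before it, is the reflection in this wall, so it cancels. *)
Lemma exchange i k ss : allS ss -> (fl i p0 < k) != (fl i (act (prodS ss) p0) < k) ->
  exists ss', [/\ allS ss', (size ss').+1 = size ss & prodS ss' = amul (aref i k) (prodS ss)].
Proof.
elim/last_ind: ss => [|ss t IH] sS; first by rewrite act_one eqxx.
rewrite -cats1 in sS *; have [sS1 sS2] := proj1 (List.Forall_app _ _ _) sS; have tS := List.Forall_inv sS2.
rewrite prodS_cat /= amul1 size_cat addn1.
have [ne _|/negPn/eqP e] := boolP ((fl i p0 < k) != (fl i (act (prodS ss) p0) < k)).
  have [ss' [sS' sz e']] := IH sS1 ne; exists (ss' ++ [:: t]).
  split; first by apply: allS_cat => //; constructor.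
    by rewrite size_cat addn1 sz.
  by rewrite prodS_cat /= amul1 e' amulA.
have xW := prodS_inW sS1; have [j [l xt]] := wall_act xW tS.
rewrite e xt act_mul => c.
have d2 : dist (act (prodS ss) p0) (act (aref j l) (act (prodS ss) p0)) = 2.
  by rewrite -act_mul -xt act_mul dist_actW // inS_dist.
have [_ h] := adj_aref HD (agen_actW xW agen_p0) d2.
exists ss; split=> //; by rewrite -(h _ _ c) amulA (arefK HD) mul1a.
Qed.

Lemma aref_separates i k : (fl i p0 < k) != (fl i (act (aref i k) p0) < k).
Proof. by rewrite (fl_aref HD) //; [case: ltP; lia|exact: agen_p0]. Qed.

(** The wall of the first letter separates the base alcove from the one reached by the other
    letters, so [exchange] rewrites the word with two letters fewer. *)
Lemma word_free ss : allS ss -> same (act (prodS ss) p0) p0 -> prodS ss = aone n.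
Proof.
have [N] := ubnP (size ss); elim: N ss => // N IH [|t ss] //=; rewrite ltnS => hN sS e.
have tS := List.Forall_inv sS; have sS1 := List.Forall_inv_tail sS.
have [i [k [tE _]]] := tS.
have e2 : same (act (prodS ss) p0) (act t p0).
  move=> j; rewrite -[prodS ss]mul1a -(inS_invol tS) -amulA act_mul.
  by apply: fl_actW => //; exact: inS_inW.
have [|ss' [sS' sz e']] := @exchange i k ss sS1.
  by rewrite e2 tE aref_separates.
rewrite tE -e'; apply: IH => //; first by rewrite -ltnS sz; exact: ltnW.
by move=> j; rewrite e' -tE.
Qed.

(** The mirror of a reflection separates the base alcove from its image, which some word [ss]
    reaches; [exchange] writes the reflection times [ss] as a word, hence the reflection too. Coroot
    translations are products of two reflections. *)
Lemma generated x : inW x -> exists ss, allS ss /\ x = prodS ss.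
Proof.
have gM y z : (exists ss, allS ss /\ y = prodS ss) -> (exists ss, allS ss /\ z = prodS ss) ->
    exists ss, allS ss /\ amul y z = prodS ss.
  by move=> [s1 [h1 ->]] [s2 [h2 ->]]; exists (s1 ++ s2); rewrite prodS_cat; split=> //; exact: allS_cat.
have g1 : exists ss, allS ss /\ aone n = prodS ss by exists [::]; split=> //; constructor.
have gr i k : exists ss, allS ss /\ aref i k = prodS ss.
  have [||ss [sS es]] := @alcove_word (aone n) (act (aref i k) p0).
  - exact: inW1.
  - exact: (agen_act (raut_aref HD i k) agen_p0).
  rewrite mul1a in es; have [|ss' [sS' _ e]] := @exchange i k ss sS; first by rewrite es aref_separates.
  exists (ss' ++ rev ss); split; first by apply: allS_cat => //; exact: allS_rev.
  by rewrite prodS_cat e -amulA prodS_rev // amul1.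
have gt i k : exists ss, allS ss /\ ((k *: cr i, 1%:M) : aff n) = prodS ss.
  have -> : (k *: cr i, 1%:M) = amul (aref i k) (aref i 0).
    by rewrite /amul /Defs.aref /= scale0r mul0mx add0r (srefK HD).
  apply: (gM) => //; exact: gr.
case: x => l A [/= [c lE] [s [_ AE]]].
have -> : (l, A) = amul (l, 1%:M) (0, A) by rewrite /amul /= mul0mx add0r mulmx1.
apply: (gM); last first.
  rewrite AE; elim: s {AE A} => [|i s IH]; first exact: g1.
  have -> : (0, wordmx D (i :: s)) = amul (aref i 0) (0, wordmx D s).
    by rewrite /amul /Defs.aref /= mul0mx scale0r addr0.
  apply: (gM) => //; exact: gr.
rewrite lE; elim/big_rec: _ => [|i l' _ IH]; first exact: g1.
have -> : (c i *: cr i + l', 1%:M) = amul (c i *: cr i, 1%:M) (l', 1%:M).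
  by rewrite /amul /= !mulmx1 addrC.
by apply: (gM).
Qed.

Lemma simply_transitive x y : inW x -> inW y -> same (act x p0) (act y p0) -> x = y.
Proof.
move=> xW yW e; have [p [u _ _]] := inW_raut HD yW.
have [ss [sS es]] := generated (inW_mul HD (inW_inv HD yW) xW).
have : prodS ss = aone n.
  apply: word_free => // i; rewrite -es act_mul.
  have := fl_actW (inW_inv HD yW) e i => ->.
  by rewrite -act_mul amulVx // act_one.
rewrite -es => h; have := congr1 (amul y) h.
by rewrite amulA amulV // mul1a amul1.
Qed.

Lemma aconj1 w : aconj (aone n) w = w.
Proof.
rewrite /aconj; have -> : ainv (aone n) = aone n by rewrite /ainv /aone /= mul0mx oppr0 invmx1.
by rewrite mul1a amul1.
Qed.
Lemma ainvM x y : x.2 \in unitmx -> y.2 \in unitmx -> ainv (amul x y) = amul (ainv y) (ainv x).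
Proof.
move=> ux uy; have u : (amul x y).2 \in unitmx by rewrite unitmx_mul uy.
have e : amul (amul x y) (amul (ainv y) (ainv x)) = aone n.
  by rewrite -amulA [amul y _]amulA amulV // mul1a amulV.
by rewrite -[LHS]amul1 -e amulA amulVx // mul1a.
Qed.
Lemma inW_unit x : inW x -> x.2 \in unitmx.
Proof. by case/(inW_raut HD) => p []. Qed.
Lemma aconjM x y w : inW x -> inW y -> aconj (amul x y) w = aconj y (aconj x w).
Proof. by move=> xW yW; rewrite /aconj ainvM ?inW_unit // !amulA. Qed.

Variables (y0 : aff n) (py : {perm I}).
Hypothesis ry0 : raut py y0.2.
Local Notation inO := (inO D y0).

Lemma inO_self : inO y0.
Proof. by exists (aone n); rewrite aconj1; split=> //; exact: inW1. Qed.
Lemma inO_conj w x : inO w -> inW x -> inO (aconj x w).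
Proof.
move=> [z [zW ->]] xW; exists (amul z x); rewrite aconjM //; split=> //; exact: (inW_mul HD).
Qed.
Lemma inO_sym w : inO w -> exists x, inW x /\ y0 = aconj x w.
Proof.
move=> [z [zW ->]]; exists (ainv z); have vW := inW_inv HD zW; split=> //.
by rewrite -aconjM // amulV ?inW_unit // aconj1.
Qed.
Lemma inO_raut w : inO w -> exists p, raut p w.2.
Proof.
move=> [x [/(inW_raut HD)[p rp] ->]]; eexists; rewrite /aconj.
by apply: raut_amul; [exact: raut_ainv rp|exact: (raut_amul ry0 rp)].
Qed.

Definition shortest w := inO w /\ forall w', inO w' -> (ell D R w <= ell D R w')%N.

Lemma shortest_ex : exists w, shortest w.
Proof.
suff h N w : inO w -> (ell D R w < N)%N -> exists w', shortest w' by exact: (h _ _ inO_self (leqnn _)).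
elim: N w => // N IH w Ow; rewrite ltnS => hN.
case: (pselect (exists w', inO w' /\ (ell D R w' < ell D R w)%N)) => [[w' [Ow' lt]]|no].
  by apply: (IH w' Ow'); apply: leq_trans lt hN.
by exists w; split=> // w' Ow'; rewrite leqNgt; apply/negP => lt; apply: no; exists w'.
Qed.

Lemma disp_conj w x : inO w -> inW x -> disp D w (act x p0) = (2 * ell D R (aconj x w))%N.
Proof.
move=> Ow xW; have [p rp] := inO_raut (inO_conj Ow xW).
rewrite -(ell_dist HD R p0A rp) /disp -(dist_actW _ _ (inW_inv HD xW)).
by rewrite /aconj !act_mul -act_mul amulVx ?act_one ?inW_unit.
Qed.

Lemma disp_same w r r' : inO w -> same r r' -> disp D w r = disp D w r'.
Proof. by move=> /inO_raut[p rp] e; apply: dist_same => //; exact: fl_act_same rp e. Qed.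

(** Every alcove is the base alcove moved by an element of [W], and there the displacement is twice
    the length of a conjugate. *)
Lemma aMinW w x : shortest w -> inW x -> aMin w (act x p0) <-> ell D R (aconj x w) = ell D R w.
Proof.
move=> [Ow mw] xW; split=> [[_ h]|e].
  apply/eqP; rewrite eqn_leq (mw _ (inO_conj Ow xW)) andbT.
  have := h p0 agen_p0; rewrite disp_conj // -[in X in (_ <= X)%N](act_one p0) disp_conj //; last exact: inW1.
  by rewrite leq_pmul2l // aconj1.
split=> [|r gr]; first exact: (agen_actW xW agen_p0).
have [ss [sS es]] := alcove_word inW1 gr; rewrite mul1a in es; have zW := prodS_inW sS.
rewrite -(disp_same Ow es) !disp_conj // e leq_pmul2l //; exact: mw (inO_conj Ow zW).
Qed.

Lemma aconj_simple w x t : inW x -> inS t -> amul t (amul (aconj x w) t) = aconj (amul x t) w.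
Proof. by move=> xW tS; rewrite (aconjM _ xW (inS_inW tS)) {2}/aconj (inS_ainv tS). Qed.

Lemma path_conn w x ss : shortest w -> inW x -> aMin w (act x p0) -> isPath D R (aconj x w) ss ->
  aconn w (act x p0) (act (amul x (prodS ss)) p0).
Proof.
move=> sw; elim: ss x => [|t ss IH] x xW Mx /=; first by rewrite amul1 => _; exact: rst_refl.
case=> tS; rewrite aconj_simple // => le pt.
have xtW : inW (amul x t) by apply: (inW_mul HD) => //; exact: inS_inW.
have Mxt : aMin w (act (amul x t) p0).
  apply/aMinW => //; apply/eqP; rewrite eqn_leq (proj2 sw) ?andbT; last exact: inO_conj (proj1 sw) _.
  by apply: leq_trans le _; rewrite (proj1 (aMinW sw xW) Mx).
apply: rst_trans (rst_step _ _ _ (act (amul x t) p0) _) _; last first.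
  by rewrite amulA; exact: IH.
split=> //; have [i [k xt]] := wall_act xW tS; rewrite xt act_mul.
apply: (proj1 (adj_aref HD _ _)); first exact: Mx.1.
by rewrite -act_mul -xt act_mul dist_actW // inS_dist.
Qed.

(** Links inside one alcove are skipped and the others are right multiplications by simple
    reflections; minimality at both ends keeps the length constant. *)
Lemma conn_path w r r' : shortest w -> aconn w r r' -> forall x, inW x -> same (act x p0) r ->
  exists ss, isPath D R (aconj x w) ss /\ inW (prodS ss) /\ same (act (amul x (prodS ss)) p0) r'.
Proof.
move=> sw c; elim: {c}(clos_rst_rst1n _ _ _ _ c) => [s|s s1 s2 lk _ IH] x xW e.
  by exists [::]; rewrite [prodS _]/= amul1; split=> //; split; first exact: inW1.
have [Ms Ms1 ad] : alink w s s1.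
  case: lk => // -[M1 M2 [a1 a2]]; split=> //; split=> [i j|i]; last by rewrite KC abszN.
  by rewrite ![K _ s s1]KC !oppr_eq0; exact: a1.
have Mx : aMin w (act x p0).
  split=> [|u gu]; first exact: (agen_actW xW agen_p0).
  by rewrite (disp_same (proj1 sw) e); exact: Ms.2.
case: (pselect (exists i, K i s s1 != 0)) => [nz|no]; last first.
  apply: IH => // i; rewrite e; apply/eqP; apply/negPn/negP => ne; apply: no; exists i.
  by rewrite /floor_jump subr_eq0 eq_sym.
have [t [tS et]] := simple_step xW e Ms.1 Ms1.1 ad nz.
have xtW : inW (amul x t) by apply: (inW_mul HD) => //; exact: inS_inW.
have [ss [ps [wS es]]] := IH _ xtW et.
exists (t :: ss); rewrite /= [amul x _]amulA aconj_simple //; split; [split=> //|split=> //].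
  rewrite (proj1 (aMinW sw xW) Mx) (proj1 (aMinW sw xtW) _) //.
  split=> [|u gu]; first exact: (agen_actW xtW agen_p0).
  by rewrite (disp_same (proj1 sw) et); exact: Ms1.2.
by apply: (inW_mul HD) => //; exact: inS_inW.
Qed.

Lemma nice_conn : nice D R y0 -> exists w, shortest w /\
  forall r r', aMin w r -> aMin w r' -> aconn w r r'.
Proof.
move=> [w [Ow mw h]]; exists w; have sw : shortest w by [].
split=> //; have c r : aMin w r -> aconn w p0 r.
  move=> Mr; have [ss [sS es]] := alcove_word inW1 Mr.1; rewrite mul1a in es.
  have xW := prodS_inW sS; have [p rp] := inO_raut Ow.
  have es' : same r (act (prodS ss) p0) by move=> i; rewrite es.
  have [Mx cx] := aMin_same HD rp Mr (agen_actW xW agen_p0) es'.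
  have [ts [pt xE]] := h _ xW (proj1 (aMinW sw xW) Mx).
  have := @path_conn w (aone n) ts sw inW1; rewrite act_one aconj1 mul1a -xE => /(_ _ pt) c1.
  apply: rst_trans (c1 _) (rst_sym _ _ _ _ cx).
  by rewrite -(act_one p0); apply/(aMinW sw inW1); rewrite aconj1.
by move=> r r' Mr Mr'; apply: rst_trans (rst_sym _ _ _ _ (c _ Mr)) (c _ Mr').
Qed.

Lemma conn_nice w : shortest w -> (forall r r', aMin w r -> aMin w r' -> aconn w r r') -> nice D R y0.
Proof.
move=> sw h; exists w; split; [exact: sw.1|exact: sw.2|move=> x xW e].
have Mx : aMin w (act x p0) by apply/aMinW.
have M1 : aMin w (act (aone n) p0) by apply/(aMinW sw inW1); rewrite aconj1.
have [ss [ps [sW es]]] := conn_path sw (h _ _ M1 Mx) inW1 (fun i => erefl).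
exists ss; rewrite aconj1 in ps; split=> //; rewrite mul1a in es.
by symmetry; exact: simply_transitive sW xW es.
Qed.
End NiceGalleries.

(** * Newton points and conjugacy classes *)
Section NewtonPoint.
Variables (n : nat) (R : realFieldType).
Implicit Types (y x : aff n) (l : 'rV[int]_n).

Lemma apowD y j k : apow y (j + k) = amul (apow y j) (apow y k).
Proof. by elim: j => [|j IH] /=; rewrite ?mul1a // IH amulA. Qed.
Lemma apow_trans l k : apow ((l, 1%:M) : aff n) k = (k%:Z *: l, 1%:M).
Proof.
elim: k => [|k IH] /=; first by rewrite scale0r.
by rewrite IH /amul /= !mulmx1 intS scalerDl scale1r addrC.
Qed.
Lemma apowM y j k : apow y (j * k) = apow (apow y j) k.
Proof. by elim: k => [|k IH]; rewrite ?muln0 // mulnS apowD IH. Qed.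

(** Two translation powers of [y] are compared through a common power, so the value picked by
    [epsilon] does not depend on the choice. *)
Lemma newtonE y m l : (0 < m)%N -> apow y m = (l, 1%:M) -> newton R y = m%:R^-1 *: toR R l.
Proof.
move=> m0 ym; rewrite /newton; set P := (fun nu => _).
have : P (epsilon (inhabits 0) P) by apply: epsilon_spec; exists (m%:R^-1 *: toR R l), m; split=> //; exists l.
case=> k [k0 [l' [yk ->]]].
have e : m%:Z *: l' = k%:Z *: l.
  have := apowM y k m; rewrite yk apow_trans mulnC apowM ym apow_trans => -[] //.
have e' : m%:R *: toR R l' = k%:R *: toR R l by have := congr1 (@toR R 1 n) e; rewrite !toRZ.
have nz j : (0 < j)%N -> j%:R != 0 :> R by rewrite pnatr_eq0 -lt0n.
apply: (scalerI (nz _ m0)); apply: (scalerI (nz _ k0)).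
rewrite !scalerA [k%:R * m%:R / m%:R]mulfK ?nz // -e'.
by congr (_ *: _); rewrite mulrAC divff ?nz // mul1r.
Qed.

Lemma apow_aconj x y k : x.2 \in unitmx -> apow (aconj x y) k = aconj x (apow y k).
Proof.
move=> ux; elim: k => [|k IH] /=; first by rewrite /aconj mul1a amulVx.
rewrite IH /aconj !amulA; congr amul; congr amul.
by rewrite -[amul (amul _ x) _]amulA amulV // amul1.
Qed.

Lemma aconj_trans x l : x.2 \in unitmx -> aconj x (l, 1%:M) = (l *m invmx x.2, 1%:M).
Proof.
move=> ux; rewrite /aconj /amul /= !mulmx1 mulmxDl mulmxV //; congr pair.
by rewrite addrAC subrr add0r.
Qed.
End NewtonPoint.

(** * Condition (2) in integral terms *)

Section Condition.
Variables (n : nat) (I : finType) (D : RD n I).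
Hypothesis HD : is_based_root_datum D.
Variable R : realFieldType.
Local Notation rt := (root D).
Local Notation cr := (coroot D).
Local Notation raut := (raut D).
Variables (y : aff n) (p : {perm I}) (m : nat) (lm : 'rV[int]_n).
Hypothesis ry : raut p y.2.
Hypothesis m_gt0 : (0 < m)%N.
Hypothesis ym : apow y m = (lm, 1%:M).
Let z := toR R y.2.
Let nu := newton R y.
Implicit Types u v x : 'rV[R]_n.

Lemma newton_drift i : pairR nu (rt i) = 0 <-> drift D lm i = 0.
Proof.
rewrite /nu (newtonE R m_gt0 ym) pairRZ pairR_toR /drift; split=> [/eqP|->]; last by rewrite mulr0.
by rewrite mulf_eq0 invr_eq0 pnatr_eq0 intr_eq0 eqn0Ngt m_gt0 => /eqP.
Qed.
Lemma newton_fixed : nu *m z = nu.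
Proof. by rewrite /nu (newtonE R m_gt0 ym) -scalemxAl /z -toRM (lm_z ym). Qed.

(** Orbit sums are fixed by [z], and pairing an orbit sum with a root is pairing the vector with the
    sum of the root orbit. As [perp] is integral, this transports the condition between fields. *)
Lemma perpP i : perp D p m i <-> forall u, u *m z = u -> pairR u (rt i) = 0.
Proof.
have inv u k : u *m z = u -> pairR u (rt ((p ^+ k)%g i)) = pairR u (rt i).
  move=> uz; elim: k => [|k IH]; rewrite ?expg0 ?perm1 // expgSr permM.
  by rewrite -{1}uz (raut_pairR _ _ ry).
have sumE u x : (forall k : 'I_m, pairR x (rt ((p ^+ k)%g i)) = pairR u (rt i)) ->
    pairR x (\sum_(k < m) rt ((p ^+ k)%g i)) = m%:R * pairR u (rt i).
  by move=> e; rewrite pairR_sumr (eq_bigr (fun=> pairR u (rt i))) // sumr_const card_ord mulr_natl.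
split=> [/eqP pe u uz|h].
  have := sumE u u (fun k => inv u k uz); rewrite pe pairRE big1 => [/esym/eqP|k _]; last by rewrite mxE mulr0.
  by rewrite mulf_eq0 pnatr_eq0 eqn0Ngt m_gt0 => /eqP.
apply/eqP; apply: (@pairR0_eq0 R) => x; pose u := \sum_(k < m) x *m toR R (apow y k).2.
have uz : u *m z = u.
  rewrite /u mulmx_suml; case: (m) m_gt0 ym => // k _ yk.
  rewrite big_ord_recr [RHS]big_ord_recl /= addrC; congr (_ + _).
    by rewrite -mulmxA /z -toRM; have := congr1 snd yk => /= ->.
  by apply: eq_bigr => j _; rewrite -mulmxA /z -toRM.
have pm : (p ^+ m = 1)%g := p_period HD ry ym.
have pinv j k : (j + k = m)%N -> ((p ^+ j)^-1 = p ^+ k)%g.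
  by move=> e; apply: (mulgI (p ^+ j)%g); rewrite mulgV -expgD e.
rewrite -(h u uz) pairR_sumr /u pairR_sum.
have e k : pairR (x *m toR R (apow y k).2) (rt i) = pairR x (rt ((p ^+ k)^-1%g i)).
  by rewrite -{1}[i](permKV (p ^+ k)%g) (raut_pairR _ _ (raut_apow ry k)).
rewrite [RHS](eq_bigr (fun k : 'I_m => pairR x (rt ((p ^+ k)^-1%g i)))) => [|k _]; last exact: e.
case: (m) pinv => [|k] pinv; first by rewrite !big_ord0.
rewrite [LHS]big_ord_recl [RHS]big_ord_recl expg0 invg1; congr (_ + _).
rewrite [RHS](reindex_inj rev_ord_inj); apply: eq_bigr => j _ /=.
rewrite (pinv _ (bump 0 j)) //; by rewrite /bump /=; have := ltn_ord j; lia.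
Qed.

Lemma fixed_rootP i : p i = i <-> forall u, pairR (u *m z) (rt i) = pairR u (rt i).
Proof.
split=> [pi u|h]; first by rewrite -{1}pi (raut_pairR _ _ ry).
have : (p^-1)%g i = i.
  apply: (rt_inj HD); apply/eqP; rewrite -subr_eq0; apply/eqP; apply: (@pairR0_eq0 R) => u.
  by rewrite pairR_Dr pairR_Nr -(raut_pairR _ _ ry) permKV h subrr.
by move=> e; rewrite -{1}e permKV.
Qed.

Lemma root_dichotomy_int : root_dichotomy D nu y.2 <-> forall i, drift D lm i = 0 -> perp D p m i \/ p i = i.
Proof.
by split=> h i /newton_drift/h [h1|h1]; [left; apply/perpP|right; apply/fixed_rootP|
  left; exact/perpP|right; exact/fixed_rootP].
Qed.

Lemma Vy_ex : exists v, Vy y v.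
Proof.
pose b : 'rV[R]_n := m%:R^-1 *: \sum_(k < m) (act (apow y k) 0 - k%:R *: nu).
have mR0 : m%:R != 0 :> R by rewrite pnatr_eq0 -lt0n.
exists b; rewrite /Vy -/nu.
pose G k : 'rV[R]_n := act (apow y k) 0 - k%:R *: nu.
have e k : G k *m z + toR R y.1 = G k.+1 + nu.
  rewrite /G [apow y k.+1]/= act_mul; move: (act (apow y k) 0) => b'.
  by rewrite mulmxBl -scalemxAl newton_fixed -natr1 scalerDl scale1r opprD addrA subrK addrAC.
have Gm : G m = G 0%N.
  rewrite /G ym /act /= mul0mx !add0r scale0r (_ : toR R 0 = 0); last by apply/rowP => j; rewrite !mxE.
  by rewrite subr0 /nu (newtonE R m_gt0 ym) scalerA divff // scale1r subrr.
have S : \sum_(k < m) (G k *m z + toR R y.1) = \sum_(k < m) G k + m%:R *: nu.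
  rewrite (eq_bigr (fun k : 'I_m => G k.+1 + nu)) => [|k _]; last exact: e.
  rewrite big_split sumr_const card_ord -scaler_nat; congr (_ + _).
  case: (m) m_gt0 Gm => // k _ Gk; rewrite big_ord_recr [RHS]big_ord_recl addrC /= Gk.
  by congr (_ + _).
rewrite /act -scalemxAl mulmx_suml -/z.
apply: (scalerI mR0); rewrite !scalerDr !scalerA divff // !scale1r -S big_split /=.
by rewrite sumr_const card_ord -[RHS]/(_ + _ *+ m) scaler_nat.
Qed.

(** A reflection whose hyperplane meets the affine space [V_y] preserves it exactly when the
    hyperplane contains [V_y] or the coroot is a direction of [V_y], that is, is fixed by [z]. *)
Lemma cond2P : cond2 D R y <-> root_dichotomy D nu y.2.
Proof.
have VD v u : Vy y v -> u *m z = u -> Vy y (v + u).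
  by rewrite /Vy actD => -> ->; rewrite addrAC.
have VB v v' : Vy y v -> Vy y v' -> (v - v') *m z = v - v'.
  move=> e e'; have := actD y v' (v - v'); rewrite addrC subrK e e' -/z => h.
  by apply: (addrI (v' + nu)); rewrite -h [RHS]addrAC [v' + (v - v')]addrC subrK.
split=> h i.
  move=> nui; case: (pselect (forall u, u *m z = u -> pairR u (rt i) = 0)) => [|no]; [by left|right].
  apply/fixed_rootP; apply: (cr_inj HD); have [_ <- _] := ry.
  have [u [uz nz]] : exists u, u *m z = u /\ pairR u (rt i) != 0.
    apply: contrapT => h'; apply: no => u uz; apply/eqP/negPn/negP => nz; apply: h'; by exists u.
  have [v0 Vv0] := Vy_ex.
  have on (c : R) : exists v, Vy y v /\ pairR v (rt i) = c.
    exists (v0 + ((c - pairR v0 (rt i)) / pairR u (rt i)) *: u); split.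
      by apply: VD => //; rewrite -scalemxAl uz.
    by rewrite pairRD pairRZ divfK // addrC subrK.
  (* Reflecting a point with root value 1 in the hyperplane at level 0 moves it by the coroot, which
     is thus a difference of two points of [V_y]. *)
  have [v [Vv v1]] := on 1.
  have V' : Vy y (reflH D i 0 v) by apply/(h i 0 nui (on 0)); exists v.
  have := VB _ _ Vv V'; rewrite /reflH v1 subr0 scale1r opprB addrC subrK.
  by rewrite /z -toRM => /toR_inj.
move=> k nui [v1 [Vv1 k1]].
have [h1|h1] := h i nui.
  have all v : Vy y v -> reflH D i k v = v.
    move=> Vv; have := h1 _ (VB _ _ Vv Vv1); rewrite pairRB k1 => e.
    by rewrite /reflH e scale0r subr0.
  by move=> v; split=> [Vv|[u [Vu <-]]]; [exists v; rewrite all|rewrite all].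
have pi : p i = i by apply/fixed_rootP.
have crz : toR R (cr i) *m z = toR R (cr i).
  by rewrite /z -toRM; have [_ -> _] := ry; rewrite pi.
have VR v : Vy y v -> Vy y (reflH D i k v).
  by move=> Vv; apply: VD => //; rewrite mulNmx -scalemxAl crz.
move=> v; split=> [Vv|[u [Vu <-]]]; last exact: VR.
exists (reflH D i k v); split; first exact: VR.
rewrite /reflH pairRB pairRZ pairR_toR (cr_rt HD).
have -> : pairR v (rt i) - (pairR v (rt i) - k%:~R) * 2%:~R - k%:~R = - (pairR v (rt i) - k%:~R) by ring.
by rewrite scaleNr opprK subrK.
Qed.
End Condition.

(** * Passage to a whole conjugacy class *)

Section Classes.
Variables (n : nat) (I : finType) (D : RD n I).
Hypothesis HD : is_based_root_datum D.
Local Notation Sm := (simple D).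
Local Notation raut := (raut D).

(** The last letter of a nonempty reduced word is a simple root made negative. This is what
    identifies elements by their action on roots, although the roots need not span. *)
Lemma inW0_raut1 A : inW0 D A -> raut 1%g A -> A = 1%:M.
Proof.
move=> AW r1; have [s rs] := reduced_ex (AW : inWJ D Sm A); have [_ e _] := rs.
case/lastP: s rs e => [//|s i] rs e.
have sub : Sm \subset Sm by [].
have [ps _] := reduced_rcons HD sub rs.
have iS : i \in Sm by case: rs; rewrite all_rcons => /andP[].
have wp1 : word_perm HD (rcons s i) = 1%g by apply: (raut_uniq HD (A := A)) r1; rewrite e; exact: raut_word.
have := pos_simple HD iS; rewrite -[i in posroot D i](perm1 i) -wp1.
have -> : word_perm HD (rcons s i) i = root_opp HD (word_perm HD s i).
  have -> : word_perm HD (rcons s i) = (srp HD i * word_perm HD s)%g.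
    apply: (raut_uniq HD (raut_word HD _)); rewrite word_rcons.
    exact: raut_mul (raut_sref HD i) (raut_word HD s).
  by rewrite permM -(raut_opp HD _ (raut_word HD s)).
by move/(pos_opp HD).
Qed.

Variables (sigma : 'M[int]_n) (ps : {perm I}) (N : nat).
Hypothesis rsig : raut ps sigma.
Hypothesis ps_simple : forall i, (ps i \in Sm) = (i \in Sm).
Hypothesis N_gt0 : (0 < N)%N.
Hypothesis sigN : sigma ^+ N = 1%:M.

Lemma inW0_conj A k : inW0 D A -> exists B, inW0 D B /\ A *m sigma ^+ k = sigma ^+ k *m B.
Proof.
move=> [s [hs ->]]; exists (wordmx D (map (ps ^+ k)%g s)); split.
  exists (map (ps ^+ k)%g s); split=> //; rewrite all_map; apply: sub_all hs => i /=.
  by elim: k => [|k IH] iS; rewrite ?expg0 ?perm1 // expgSr permM ps_simple; exact: IH.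
have rk := raut_pow k rsig; have [u _ _] := rk.
by rewrite -(conj_word s rk) !mulmxA mulmxV // mul1mx.
Qed.

Lemma pow_coset w k : inW0 D w -> exists w', inW0 D w' /\ (sigma *m w) ^+ k = sigma ^+ k *m w'.
Proof.
move=> wW; elim: k => [|k [w' [wW' e]]].
  by exists 1%:M; split; [exists [::]|rewrite !expr0 mulmx1].
have [B [BW eB]] := inW0_conj k wW.
exists (B *m w'); split; first exact: (@inWJ_mul _ _ D Sm).
by rewrite exprS e [sigma ^+ k.+1]exprS -[LHS]/(_ *m _) -[sigma * _]/(_ *m _) -!mulmxA; congr mulmx; rewrite !mulmxA eB.
Qed.

(** The exponent kills both [sigma] and the root permutation: what remains is in the finite Weyl
    group and acts trivially on roots. *)
Lemma finite_part_order w : inW0 D w -> exists2 m, (0 < m)%N & (sigma *m w) ^+ m = 1%:M.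
Proof.
move=> wW; have [q rq] := inWJ_raut HD (wW : inWJ D Sm w).
pose A := sigma *m w; have rA : raut (ps * q)%g A by exact: raut_mul.
pose k := #[(ps * q)%g]%g; exists (N * k)%N; first by rewrite muln_gt0 N_gt0 order_gt0.
have [w' [wW' e]] := pow_coset (N * k) wW.
rewrite e exprM sigN [X in X *m _]expr1n mul1mx.
apply: inW0_raut1 => //; have := raut_pow (N * k) rA.
by rewrite /A e exprM sigN [X in X *m _]expr1n mul1mx mulnC expgM expg_order expg1n.
Qed.

Lemma apow_part (y : aff n) k : (apow y k).2 = y.2 ^+ k.
Proof. by elim: k => [|k IH] //=; rewrite IH exprSr. Qed.

Lemma translation_power (y : aff n) w : inW0 D w -> y.2 = fmul w sigma ->
  exists m lm, (0 < m)%N /\ apow y m = (lm, 1%:M).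
Proof.
move=> wW e; have [m m0 em] := finite_part_order wW.
exists m, (apow y m).1; split=> //.
by rewrite -em -[sigma *m w]/(fmul w sigma) -e -apow_part; case: apow.
Qed.

Variables (R : realFieldType) (y0 : aff n).
Hypothesis Hy0 : in_tWG_coset D sigma y0.
Local Notation inO := (inO D y0).

Lemma coset_inO y : inO y -> in_tWG_coset D sigma y.
Proof.
move=> [x [xW ->]]; have [w [wW e]] := Hy0; have [p rx] := inW_raut HD xW.
have [B [BW eB]] := inW0_conj 1 (proj2 xW); rewrite expr1 in eB.
exists (B *m w *m invmx x.2); split.
  by apply: (@inWJ_mul _ _ D Sm); [exact: (@inWJ_mul _ _ D Sm)|exact: (inWJ_inv HD (proj2 xW))].
by rewrite /aconj /amul /= e /fmul !mulmxA eB.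
Qed.

Lemma raut_inO y : inO y -> exists p, raut p y.2.
Proof.
move=> /coset_inO[w [wW ->]]; have [q rq] := inWJ_raut HD (wW : inWJ D Sm w).
by exists (ps * q)%g; exact: raut_mul.
Qed.

Lemma period_inO y : inO y -> exists m lm, (0 < m)%N /\ apow y m = (lm, 1%:M).
Proof. by move=> /coset_inO[w [wW e]]; exact: translation_power wW e. Qed.

Lemma newton_aconj x y : inW D x -> inO y ->
  newton R (aconj x y) = newton R y *m toR R (invmx x.2).
Proof.
move=> xW /period_inO[m [lm [m0 ym]]]; have u := inW_unit HD xW.
rewrite (newtonE R m0 ym) (newtonE (l := lm *m invmx x.2) R m0); last first.
  by rewrite apow_aconj // ym aconj_trans.
by rewrite toRM scalemxAl.
Qed.

Lemma root_dichotomy_inO y y' : inO y -> inO y' -> root_dichotomy D (newton R y) y.2 -> root_dichotomy D (newton R y') y'.2.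
Proof.
have step x u : inW D x -> inO u -> root_dichotomy D (newton R u) u.2 -> root_dichotomy D (newton R (aconj x u)) (aconj x u).2.
  move=> xW Ou; have [p rx] := inW_raut HD xW; have un := inW_unit HD xW => h.
  apply: (root_dichotomy_conj rx (z := u.2)); first by rewrite /aconj /amul /= mulmxKV.
  by rewrite newton_aconj // -mulmxA -toRM mulVmx // toR1 mulmx1.
move=> Oy [x' [xW' ->]] h; have [x [xW e]] := inO_sym HD Oy.
have Oyx := inO_conj HD Oy xW; have hx := step _ _ xW Oy h.
by rewrite -e in Oyx hx; exact: (step _ _ xW' Oyx hx).
Qed.

Lemma cond2_inO y : inO y -> cond2 D R y <-> root_dichotomy D (newton R y) y.2.
Proof.
move=> Oy; have [p ry] := raut_inO Oy; have [m [lm [m0 ym]]] := period_inO Oy.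
exact: (cond2P HD R ry m0 ym).
Qed.

Lemma nuOP : dominant D (nuO D R y0) /\ exists w, inW0 D w /\ nuO D R y0 = newton R y0 *m toR R w.
Proof.
apply: (epsilon_spec (inhabits 0) (fun nu => dominant D nu /\ exists w, inW0 D w /\ nu = newton R y0 *m toR R w)).
have sub : Sm \subset Sm by [].
have [w [wW d]] := dom_ex HD (newton R y0) sub.
by exists (newton R y0 *m toR R w); split=> //; exists w.
Qed.

Lemma newton_nuO_ex : exists y, inO y /\ newton R y = nuO D R y0.
Proof.
have [_ [w [wW e]]] := nuOP; pose x : aff n := (0, invmx w).
have xW : inW D x by split; [exact: inQ0|exact: (inWJ_inv HD wW)].
have O0 := inO_self D y0.
exists (aconj x y0); split; first by exists x.
by rewrite newton_aconj //= invmxK.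
Qed.

(** [sigma] keeps the dominant Newton point dominant and a finite Weyl group element brings it back,
    so [dom_uniq] gives invariance under [sigma]. *)
Lemma nuO_sigma y : inO y -> newton R y = nuO D R y0 ->
  nuO D R y0 *m toR R sigma = nuO D R y0 /\ nuO D R y0 *m toR R y.2 = nuO D R y0.
Proof.
move=> Oy e; have [w [wW ey]] := coset_inO Oy; have [m [lm [m0 ym]]] := period_inO Oy.
have fz : nuO D R y0 *m toR R y.2 = nuO D R y0 by rewrite -e (newton_fixed R m0 ym).
split=> //; have [dom _] := nuOP.
have [s rs] := reduced_ex (wW : inWJ D Sm w).
have sub : Sm \subset Sm by [].
have fz' : nuO D R y0 *m toR R sigma *m toR R w = nuO D R y0 by rewrite -mulmxA -toRM -[sigma *m w]/(fmul w sigma) -ey.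
have ds : domJ D Sm (nuO D R y0 *m toR R sigma).
  move=> i iS; rewrite -[i](permKV ps) (raut_pairR _ _ rsig); apply: dom.
  by rewrite -ps_simple permKV.
have [|_] := dom_uniq HD sub rs ds; first by rewrite fz'.
by rewrite fz' => <-.
Qed.

Lemma weakly_elliptic_inO y : inO y -> newton R y = nuO D R y0 ->
  weakly_elliptic D (JO D R y0) sigma y.2 <-> root_dichotomy D (newton R y) y.2.
Proof.
move=> Oy e; have [s1 s2] := nuO_sigma Oy e; have [w [wW ey]] := coset_inO Oy.
by rewrite e; exact: (weakly_ellipticP HD rsig ps_simple N_gt0 sigN (proj1 nuOP) s1 wW ey s2).
Qed.

(** Niceness over [R] involves only lengths, so alcoves may be taken over the real numbers; the
    dichotomy returns to [R] through [root_dichotomy_int]. *)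
Lemma nice_root_dichotomy y : inO y -> nice D R y0 <-> root_dichotomy D (newton R y) y.2.
Proof.
move=> Oy; have O0 := inO_self D y0.
have [p0 p0A] := alcove_ex HD Rdefinitions.R.
have [py ry0] := raut_inO O0.
split=> [/(nice_conn HD p0A ry0)[w [sw h]]|h].
  have Ow := proj1 sw; apply: (root_dichotomy_inO Ow Oy).
  have [p rw] := raut_inO Ow; have [m [lm [m0 wm]]] := period_inO Ow.
  apply/(root_dichotomy_int HD R rw m0 wm) => i.
  exact: (conn_necessary rw m0 wm (barycentre_inVy m0 wm 0) h).
have [w sw] := shortest_ex D R y0.
apply: (conn_nice p0A ry0 sw) => r r' Mr Mr'.
have Ow := proj1 sw; have [p rw] := raut_inO Ow; have [m [lm [m0 wm]]] := period_inO Ow.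
apply: (conn_sufficient HD rw m0 wm (barycentre_inVy m0 wm 0)) Mr Mr'.
by apply/(root_dichotomy_int HD R rw m0 wm); exact: root_dichotomy_inO Oy Ow h.
Qed.
End Classes.

Lemma finite_order n (Om : 'M[int]_n -> Prop) (g : 'M[int]_n) :
  Om 1%:M -> (forall g h, Om g -> Om h -> Om (fmul g h)) -> (exists s : seq 'M[int]_n, forall g, Om g <-> g \in s) ->
  Om g -> g \in unitmx -> exists2 N, (0 < N)%N & g ^+ N = 1%:M.
Proof.
move=> O1 OM [s hs] Og ug.
have Ok k : g ^+ k \in s.
  by apply/hs; elim: k => [//|k IH]; rewrite exprS; exact: OM.
pose t := [seq g ^+ k | k <- iota 0 (size s).+1].
have : ~~ uniq t.
  apply/negP => ut; have : (size t <= size s)%N.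
    by apply: uniq_leq_size ut _ => _ /mapP[k _ ->].
  by rewrite size_map size_iota ltnn.
case/(uniqPn 0) => i [j [ij]]; rewrite size_map size_iota => js.
rewrite !(nth_map 0%N) ?size_iota ?(ltn_trans ij) // !nth_iota ?(ltn_trans ij) // !add0n => e.
exists (j - i)%N; first by rewrite subn_gt0.
have ui : g ^+ i \in unitmx by elim: (i) => [|k IH]; rewrite ?unitmx1 // exprS unitmx_mul ug.
have : g ^+ (j - i) *m g ^+ i = 1%:M *m g ^+ i by rewrite mul1mx -[LHS]exprD subnK // ltnW.
by move/(can_inj (mulmxK ui)).
Qed.

Theorem theorem4p10 (R : realFieldType) (n : nat) (I : finType) (D : RD n I)
  (HD : is_based_root_datum D)
  (Om : 'M[int]_n -> Prop) (HOm : diag_aut_group D Om)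
  (sigma : 'M[int]_n) (Hsig : Om sigma)
  (y0 : aff n) (Hy0 : in_tWG_coset D sigma y0) :
  [/\ nice D R y0 <-> (exists y, inO D y0 y /\ cond2 D R y),
      nice D R y0 <-> (forall y, inO D y0 y -> cond2 D R y),
      nice D R y0 <-> (exists y, [/\ inO D y0 y, newton R y = nuO D R y0 &
                                   weakly_elliptic D (JO D R y0) sigma y.2]) &
      nice D R y0 <-> (forall y, inO D y0 y -> newton R y = nuO D R y0 ->
                                   weakly_elliptic D (JO D R y0) sigma y.2)].
Proof.
have [O1 OM Ofin Odiag] := HOm; have [us [ps [psc psr pss]]] := Odiag _ Hsig.
have rsig : raut D ps sigma by [].
have [N N0 sN] := finite_order O1 OM Ofin Hsig us.
have n2 y (Oy : inO D y0 y) := nice_root_dichotomy HD rsig pss N0 sN R Hy0 Oy.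
have c2 y (Oy : inO D y0 y) := cond2_inO HD rsig pss N0 sN R Hy0 Oy.
have w2 y (Oy : inO D y0 y) (e : newton R y = nuO D R y0) := weakly_elliptic_inO HD rsig pss N0 sN Hy0 Oy e.
have [yd [Od ed]] := newton_nuO_ex HD rsig pss N0 sN R Hy0.
have O0 := inO_self D y0.
split.
- split=> [h|[y [Oy /c2 h]]]; last by apply/(n2 y Oy); exact: h.
  by exists y0; split=> //; apply/c2 => //; apply/n2.
- split=> [h y Oy|h]; last by apply/(n2 y0 O0)/c2 => //; exact: h.
  by apply/c2 => //; apply/n2.
- split=> [h|[y [Oy e /(w2 y Oy e) h]]]; last by apply/(n2 y Oy).
  by exists yd; split=> //; apply/w2 => //; apply/n2.
- split=> [h y Oy e|h]; last by apply/(n2 yd Od)/(w2 yd Od ed); exact: h.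
  by apply/w2 => //; apply/n2.
Qed.
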